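(* Let $T>0$, and let $\mu$ be a stochastic measure on the Borel subsets of $[0,T]$, defined on a complete probability space $(\Omega,\mathcal F,\mathsf P)$, such that the process $\mu_t=\mu((0,t])$, $t\in[0,T]$, has continuous paths. Let $X_0$ be an arbitrary real random variable. Let $\sigma:\mathbb R\to\mathbb R$ and $b:\mathbb R^2\to\mathbb R$ satisfy: (i) $\sigma\in C^2(\mathbb R)$ and the derivatives $\sigma'$, $\sigma''$ are bounded; (ii) $b$ is continuous on $\mathbb R^2$ and bounded; (iii) for each $c>0$ there exists $L(c)$ such that $|b(x,t)-b(y,t)|\le L(c)|x-y|$ for all $|x|,|y|\le c$ and all $t$; (iv) for each $y\in\mathbb R$ the limit $\bar b(y)=\lim_{t\to\infty}\frac1t\int_0^t b(y,s)\,ds$ exists, and the function $G(y,r)=\int_0^r\bigl(b(y,s)-\bar b(y)\bigr)\,ds$, $r\in\mathbb R_+$, $y\in\mathbb R$, is bounded. For $\varepsilon>0$ let $X^\varepsilon_t$ be the solution of $$\circ\,dX^\varepsilon_t=\sigma(X^\varepsilon_t)\circ d\mu_t+b(X^\varepsilon_t,t/\varepsilon)\,dt,\quad 0\le t\le T,\qquad X^\varepsilon_0=X_0,$$ and let $\bar X_t$ be the solution of $$\circ\,d\bar X_t=\sigma(\bar X_t)\circ d\mu_t+\bar b(\bar X_t)\,dt,\quad 0\le t\le T,\qquad \bar X_0=X_0.$$ 1) Then for each $\omega\in\Omega$, $$\sup_{t\in[0,T]}|X^\varepsilon_t-\bar X_t|\to0,\qquad \varepsilon\to0.$$ 2) Assume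 in addition that there exists a real-valued finite measure $\mathsf m$ on the Borel $\sigma$-algebra of $[0,T]$ with the following property: every measurable $h:[0,T]\to\mathbb R$ with $\int_{[0,T]}h^2\,d\mathsf m<+\infty$ is integrable with respect to $\mu$ on $[0,T]$. Then the set of random variables $$\frac{\sup_{t\in[0,T]}|X^\varepsilon_t-\bar X_t|}{\varepsilon^{1/3}},\qquad \varepsilon>0,$$ is bounded in probability.
   Context: Stochastic measure: let $\mathsf L_0$ be the set of (equivalence classes of) real random variables on $(\Omega,\mathcal F,\mathsf P)$ with convergence in probability. A stochastic measure on a $\sigma$-algebra $\mathcal B$ of subsets of $\mathsf X$ is a $\sigma$-additive map $\mu:\mathcal B\to\mathsf L_0$ (the series converging in probability). No moment or martingale assumptions are made. Integral of deterministic functions: for a simple measurable function $f=\sum_i c_i\mathbf 1_{A_i}$ put $\int_A f\,d\mu=\sum_i c_i\mu(A_i\cap A)$. A measurable $f:\mathsf X\to\mathbb R$ is integrable with respect to $\mu$ if there are simple functions $f_n\to f$ pointwise such that for every $A\in\mathcal B$ the sequence $\int_A f_n\,d\mu$ converges in probability; the limit is $\int_A f\,d\mu$. Bounded in probability: a set of random variables $\{\xi_\alpha\}_{\alpha\in\mathcal A}$ is bounded in probability if $\sup_{\alpha\in\mathcal A}\mathsf P(|\xi_\alpha|\ge c)\to0$ as $c\to\infty$. Symmetric integral: for processes $\xi_t,\eta_t$ on $[0,T]$ and a sequence of partitions $0=t^n_0<t^n_1<\dots<t^n_{j_n}=T$ with $\max_k|t^n_k-t^n_{k-1}|\to0$,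 $$\int_{(0,T]}\xi_t\circ d\eta_t:=\mathrm{p}\lim_{n\to\infty}\sum_{k=1}^{j_n}\frac{\xi_{t^n_{k-1}}+\xi_{t^n_k}}2\,(\eta_{t^n_k}-\eta_{t^n_{k-1}}),$$ provided that this limit in probability exists; similarly on $(0,t]$. Solution: a process $X_t$, $0\le t\le T$, is a solution of $\circ\,dX_t=\sigma(X_t)\circ d\mu_t+\beta(X_t,t)\,dt$ with given $X_0$ if (1) $X_t=f(\mu_t,Y_t)$ for some $f\in C^{2,1}(\mathbb R^2)$ and some continuous process $Y_t$ of bounded variation, and (2) for every process $Z_s=\psi(\mu_s,X_s)$ with $\psi\in C^{1,1}(\mathbb R^2)$, $$\int_{(0,t]}Z_s\circ dX_s=\int_{(0,t]}Z_s\sigma(X_s)\circ d\mu_s+\int_{(0,t]}Z_s\beta(X_s,s)\,ds,\qquad t\in[0,T].$$ The definition is applied with $\beta(x,t)=b(x,t/\varepsilon)$ for $X^\varepsilon$ and with $\beta(x,t)=\bar b(x)$ for $\bar X$. Form of the solution: let $F:\mathbb R^2\to\mathbb R$ be the (global) solution of $\frac{\partial F}{\partial r}(r,x)=\sigma(F(r,x))$, $F(0,x)=x$, and let $H(r,\cdot)=F(r,\cdot)^{-1}$ be the inverse in $x$. By a known theorem (Doss–Sussmann transformation), when $\sigma$ satisfies (i) and $\beta$ is bounded, continuous and locally Lipschitz in $x$ in the sense of (iii), the equation has a unique solution, and it is $X_t=F(\mu_t,Y_t)$, where $Y$ solves the random equation $$Y_t=H(0,X_0)+\int_0^t\frac{\partial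 H}{\partial x}(\mu_s,F(\mu_s,Y_s))\,\beta(F(\mu_s,Y_s),s)\,ds.$$ Convention: a version of $\mu_t$ with $t\mapsto\mu_t(\omega)$ continuous for every $\omega$ is fixed, the equation for $Y$ is solved for each fixed $\omega\in\Omega$, and $X^\varepsilon$, $\bar X$ denote the processes so obtained. *)

(* Defs.v *)
From HB Require Import structures.
From mathcomp Require Import all_boot all_order all_algebra.
From mathcomp Require Import all_classical all_reals all_analysis.
Set Implicit Arguments.
Unset Strict Implicit.
Unset Printing Implicit Defensive.
Import Order.TTheory GRing.Theory Num.Theory.
Import numFieldNormedType.Exports.
Import HBSimple.
Local Open Scope classical_set_scope.
Local Open Scope ring_scope.

(* Elements of L_0 (equivalence classes of random variables) are represented
   by measurable functions [{RV P >-> R}]; equalities in L_0 are then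
   almost-sure equalities, and limits in probability are only determined up to
   almost-sure equality. Random processes on [0, T] are families
   [X : R -> {RV P >-> R}], whose values outside [0, T] are irrelevant. *)

Section probability_notions.
Context d (Omega : measurableType d) (R : realType) (P : probability Omega R).

Definition cvg_in_probability (xi_ : nat -> Omega -> R) (xi : Omega -> R) :=
  forall e : R, 0 < e ->
    P [set w | e <= `|xi_ n w - xi w|] @[n --> \oo] --> 0%E.

Definition bounded_in_probability (I : Type) (A : set I)
    (xi : I -> Omega -> R) :=
  ereal_sup [set P [set w | c <= `|xi a w|] | a in A] @[c --> +oo] --> 0%E.

End probability_notions.

(* Stochastic measures on the sigma-algebra of the measurable subsets of D. *)
Section stochastic_measure.
Context d (Omega : measurableType d) (R : realType) (P : probability Omega R).
Context d' (S : measurableType d') (D : set S).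

Definition stochastic_measure (mu : set S -> {RV P >-> R}) :=
  forall A : nat -> set S,
    (forall n, measurable (A n) /\ A n `<=` D) -> trivIset setT A ->
    cvg_in_probability P (fun n w => \sum_(0 <= k < n) mu (A k) w)
                         (mu (\bigcup_n A n)).

Definition simple_integral (mu : set S -> {RV P >-> R}) (f : {sfun S >-> R})
    (A : set S) (w : Omega) : R :=
  \sum_(c \in range f) c * mu (f @^-1` [set c] `&` A) w.

Definition sm_integrable (mu : set S -> {RV P >-> R}) (f : S -> R) :=
  measurable_fun D f /\
  exists f_ : nat -> {sfun S >-> R},
    (forall x, D x -> f_ n x @[n --> \oo] --> f x) /\
    forall A, measurable A -> A `<=` D ->
      exists xi : {RV P >-> R},
        cvg_in_probability P (fun n => simple_integral mu (f_ n) A) xi.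

End stochastic_measure.

Section differentiability_classes.
Context (R : realType).

Definition class_C (k : nat) (f : R -> R) :=
  (forall i x, (i < k)%N -> derivable (derive1n i f) x 1) /\
  continuous (derive1n k f).

(* f(r, x) has continuous (on R^2) partial derivatives up to order m in r and
   up to order n in x. *)
Definition class_C2 (m n : nat) (f : R -> R -> R) :=
  [/\ forall i r x, (i < m)%N -> derivable (derive1n i (f ^~ x)) r 1,
      forall i r x, (i < n)%N -> derivable (derive1n i (f r)) x 1,
      forall i, (i <= m)%N ->
        continuous (fun p : R * R => derive1n i (f ^~ p.2) p.1)
    & forall i, (i <= n)%N ->
        continuous (fun p : R * R => derive1n i (f p.1) p.2)].

End differentiability_classes.

Section symmetric_integral.
Context d (Omega : measurableType d) (R : realType) (P : probability Omega R).

(* The points of the partition of [0, t] given by the library predicate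
   [itv_partition 0 t s]: t_0 = 0 and t_k = s_(k-1) for 1 <= k <= size s. *)
Definition partition_point (s : seq R) (k : nat) : R := nth 0 (0 :: s) k.

Definition mesh (s : seq R) : R :=
  \big[Num.max/0]_(k < size s)
    `|partition_point s k.+1 - partition_point s k|.

Definition symmetric_sum (xi eta : R -> Omega -> R) (s : seq R)
    (w : Omega) : R :=
  \sum_(k < size s)
    (xi (partition_point s k) w + xi (partition_point s k.+1) w) / 2 *
    (eta (partition_point s k.+1) w - eta (partition_point s k) w).

(* The symmetric integral of xi with respect to eta on (0, t] exists and equals
   I: the sums converge to I in probability along every sequence of
   partitions whose mesh tends to 0. *)
Definition is_symmetric_integral (t : R) (xi eta : R -> Omega -> R)
    (I : {RV P >-> R}) :=
  forall s : nat -> seq R,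
    (forall n, itv_partition 0 t (s n)) -> mesh (s n) @[n --> \oo] --> 0 ->
    cvg_in_probability P (fun n => symmetric_sum xi eta (s n)) I.

End symmetric_integral.

Section equation.
Context d (Omega : measurableType d) (R : realType) (P : probability Omega R).
Implicit Types (T : R) (sigma : R -> R) (beta F H : R -> R -> R).
Implicit Types (mut X Y : R -> {RV P >-> R}).

Definition continuous_paths T X :=
  forall w, {within `[0, T], continuous (fun t => X t w)}.

(* mut is a version of t |-> mu(]0, t]) all of whose paths are continuous. *)
Definition continuous_version T (mu : set R -> {RV P >-> R}) mut :=
  continuous_paths T mut /\
  forall t : R, t \in `[0, T] ->
    {ae P, forall w, mut t w = mu `]0, t]%classic w}.

(* X solves odX_t = sigma(X_t) o dmu_t + beta(X_t, t) dt on [0, T]. *)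
Definition is_solution T mut sigma beta (X0 : {RV P >-> R}) X :=
  [/\ {ae P, forall w, X 0 w = X0 w},
      exists f Y,
        [/\ class_C2 2 1 f, continuous_paths T Y,
            forall w, bounded_variation 0 T (fun t => Y t w)
          & forall (t : R) w, t \in `[0, T] -> X t w = f (mut t w) (Y t w)]
    & forall psi, class_C2 1 1 psi ->
        let Z s w := psi (mut s w) (X s w) in
        forall t : R, t \in `[0, T] ->
          exists I J : {RV P >-> R},
            [/\ is_symmetric_integral t Z X I,
                is_symmetric_integral t (fun s w => Z s w * sigma (X s w)) mut J
              & {ae P, forall w, I w = J w +
                  \int[lebesgue_measure]_(s in `]0, t])
                     (Z s w * beta (X s w) s)}]].

Definition is_flow sigma F :=
  (forall r x : R, is_derive r 1 (F ^~ x) (sigma (F r x))) /\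
  forall x, F 0 x = x.

Definition is_flow_inverse F H :=
  forall r, cancel (F r) (H r) /\ cancel (H r) (F r).

(* The random equation for Y is required for every w, not almost surely. *)
Definition is_doss_sussmann T mut beta F H (X0 : {RV P >-> R}) X :=
  exists Y,
    [/\ continuous_paths T Y,
        forall (t : R) w, t \in `[0, T] ->
          Y t w = H 0 (X0 w) +
            \int[lebesgue_measure]_(s in `[0, t])
               (derive1 (H (mut s w)) (F (mut s w) (Y s w)) *
                beta (F (mut s w) (Y s w)) s)
      & forall (t : R) w, t \in `[0, T] -> X t w = F (mut t w) (Y t w)].

Definition sup_distance T X Y (w : Omega) : R :=
  sup [set `|X t w - Y t w| | t in `[0, T]].

End equation.

(* Main.v *)
Require Import Defs.
From HB Require Import structures.
From mathcomp Require Import all_boot all_order all_algebra.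
From mathcomp Require Import all_classical all_reals all_analysis.
From mathcomp Require Import measurable_realfun ring lra.
Set Implicit Arguments.
Unset Strict Implicit.
Unset Printing Implicit Defensive.
Import Order.TTheory GRing.Theory Num.Theory.
Import numFieldNormedType.Exports.
Local Open Scope classical_set_scope.
Local Open Scope ring_scope.

(** By the Doss-Sussmann representation both equations are ordinary differential
    equations along each path of [mut]: the solution is [F (mut t) (Y t)], where
    [Y] has the speed [field (mut t) (Y t) (t / eps)], respectively
    [averaged_field (mut t) (Y t)]. Everything therefore follows from an estimate
    for one path. Cut [[0, T]] into [2 ^ a] cells and freeze [mut] and [Y] at the
    left end of each cell. With frozen arguments the difference of the two speeds
    integrates to [O(eps)] over a cell, because [G] is bounded. The cost of
    freezing is controlled by the Lipschitz continuity of the speeds: [Y] moves by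
    the length of the cell, and [mut] by its oscillation. Gronwall's inequality
    then gives [pathwise_averaging]: the distance of the solutions is at most
    [C * (oscillation a + 2 ^ - a + 2 ^ a * eps)], where [C] depends on the path and
    on the initial value only through a bound of their size. For a fixed path, a
    large [a] and then a small [eps] make this small, which is the first part.

    The speeds contain the derivative of the inverse flow. It is controlled through
    the logarithm of a difference quotient of [F r]: its derivative in [r] is a
    difference quotient of [sigma], hence bounded and nearly Lipschitz in the space
    variable ([flow_estimates]).

    For the second part take [2 ^ a] close to [eps `^ (- 2 / 3)]. It remains to see
    that [2 ^ (a / 2) * oscillation a] is bounded in probability, uniformly in [a].
    By the Cauchy-Schwarz inequality it suffices to bound [2 ^ a] times the mean square,
    over a fine grid, of the increments of [mut] from the preceding coarse point. Random
    signs turn these increments into the integral of a step function whose second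
    moment with respect to [m] is at most of order one on average, and a Rademacher
    sum is comparable to its quadratic mean with a fixed probability
    ([rademacher_lower]). So [coarse_square_bounded] follows from
    [L2_step_bounded]: the integrals of the step functions [h] with
    [\int h ^ 2 dm <= 1] are bounded in probability.

    This last fact is where the hypothesis on [m] enters, and its proof is by
    contradiction. If the integrals were unbounded, a random selection of cells
    would produce step functions [h_k] with disjoint supports and with
    [\int h_k ^ 2 dm <= 2 ^ - k], whose integrals exceed [1] with a probability
    bounded below ([thinning_sequence]). Their sum is square integrable, hence
    integrable with respect to [mu]. Its approximating simple functions are close to
    [h_k], uniformly, on most of the support of [h_k], and so have integrals over
    disjoint sets that do not become small, although they converge over every
    measurable set; a gliding hump argument excludes this ([gliding_hump]). To
    compare a simple function with [h_k] one needs that uniformly small simple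
    functions have small integrals. This holds because the range of [mu] is bounded
    in probability ([range_bounded], again by thinning, now of indicators), and
    boundedness passes to convex combinations although the space of random
    variables is not locally convex ([tail_convex_hull]). *)

(** * Finite products of two-point distributions *)

Section randomization.
Context {R : realType}.
Implicit Types (p : nat -> R) (f g : (nat -> bool) -> R) (x : nat -> R).

Definition update (s : nat -> bool) (n : nat) (b : bool) (j : nat) : bool :=
  if j == n then b else s j.

(** The expectation of [f] when the first [n] coordinates are independent and the
    [j]-th is [true] with probability [p j]. The recursion replaces a product measure,
    so that moments are computed by induction on [n]. *)
Fixpoint avg p (n : nat) f : R :=
  if n is n'.+1 then
    p n' * avg p n' (fun s => f (update s n' true)) +
    (1 - p n') * avg p n' (fun s => f (update s n' false))
  else f (fun=> false).

Lemma avg_cst p n c : avg p n (fun=> c) = c.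
Proof. by elim: n => //= n ->; ring. Qed.

Lemma avgD p n f g : avg p n (fun s => f s + g s) = avg p n f + avg p n g.
Proof.
elim: n f g => //= n IH f g.
rewrite (IH (fun s => f (update s n true)) (fun s => g (update s n true))).
rewrite (IH (fun s => f (update s n false)) (fun s => g (update s n false))).
by ring.
Qed.

Lemma avgZ p n c f : avg p n (fun s => c * f s) = c * avg p n f.
Proof.
elim: n f => //= n IH f.
rewrite (IH (fun s => f (update s n true))) (IH (fun s => f (update s n false))).
by ring.
Qed.

Lemma avgB p n f g : avg p n (fun s => f s - g s) = avg p n f - avg p n g.
Proof.
rewrite -mulN1r -avgZ -avgD; congr avg; apply: funext => s.
by rewrite mulN1r.
Qed.

Lemma avg_sum p n k (F : nat -> (nat -> bool) -> R) :
  avg p n (fun s => \sum_(j < k) F j s) = \sum_(j < k) avg p n (F j).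
Proof.
elim: k => [|k IH].
  by under eq_fun do rewrite big_ord0; rewrite avg_cst big_ord0.
by under eq_fun do rewrite big_ord_recr /=; rewrite avgD IH big_ord_recr.
Qed.

Definition is_prob p := forall j, 0 <= p j <= 1.

Lemma is_prob_cst (a : R) : 0 <= a <= 1 -> is_prob (fun=> a).
Proof. by move=> a01 j. Qed.

Lemma avg_le p n f g : is_prob p -> (forall s, f s <= g s) ->
  avg p n f <= avg p n g.
Proof.
move=> p01; elim: n f g => //= n IH f g fg.
have /andP[p0 p1] := p01 n.
by apply: lerD; apply: ler_wpM2l; rewrite ?subr_ge0 //; apply: IH.
Qed.

Lemma avg_ge0 p n f : is_prob p -> (forall s, 0 <= f s) -> 0 <= avg p n f.
Proof. by move=> p01 f0; rewrite -(avg_cst p n 0); exact: avg_le. Qed.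

Lemma avg_gt_exists p n f (c : R) : is_prob p -> c < avg p n f ->
  exists s, c < f s.
Proof.
move=> p01 cf; apply: contrapT => /forallNP fc.
suff : avg p n f <= c by rewrite leNgt cf.
by rewrite -[leRHS](avg_cst p n c); apply: avg_le => // s; rewrite leNgt; apply/negP.
Qed.

(** There are finitely many outcomes, so a threshold that depends on the outcome
    can be chosen uniformly. *)
Lemma avg_eventually p n (F : nat -> (nat -> bool) -> R) f :
  (forall s, exists N0, forall N, (N0 <= N)%N -> F N s = f s) ->
  exists N0, forall N, (N0 <= N)%N -> avg p n (F N) = avg p n f.
Proof.
elim: n F f => [|n IH] F f Ff /=; first exact: Ff.
have [N1 F1] := IH (fun N s => F N (update s n true))
  (fun s => f (update s n true)) (fun s => Ff _).
have [N2 F2] := IH (fun N s => F N (update s n false))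
  (fun s => f (update s n false)) (fun s => Ff _).
exists (maxn N1 N2) => N; rewrite geq_max => /andP[? ?].
by rewrite F1 // F2.
Qed.

Lemma avg_bool p n j : (j < n)%N -> avg p n (fun s => (s j)%:R) = p j.
Proof.
elim: n => // n IH; rewrite ltnS leq_eqVlt => /predU1P[->|jn] /=.
  under eq_fun do rewrite /update eqxx.
  under [X in _ + _ * avg _ _ X]eq_fun do rewrite /update eqxx.
  by rewrite !avg_cst /= mulr0 addr0 mulr1.
under eq_fun do rewrite /update (ltn_eqF jn).
under [X in _ + _ * avg _ _ X]eq_fun do rewrite /update (ltn_eqF jn).
by rewrite !IH//; ring.
Qed.

Lemma sum_update (F : nat -> bool -> R) s n b :
  \sum_(j < n) F j (update s n b j) = \sum_(j < n) F j (s j).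
Proof. by apply: eq_bigr => j _; rewrite /update (ltn_eqF (ltn_ord j)). Qed.

Definition centered p x n (s : nat -> bool) : R :=
  \sum_(j < n) ((s j)%:R - p j) * x j.

Definition variance p x n : R := \sum_(j < n) p j * (1 - p j) * x j ^+ 2.

Lemma variance_ge0 p x n : is_prob p -> 0 <= variance p x n.
Proof.
move=> p01; apply: sumr_ge0 => j _; have /andP[? ?] := p01 j.
by rewrite mulr_ge0 ?sqr_ge0 // mulr_ge0 // subr_ge0.
Qed.

Lemma avg_centeredS p x n (phi : R -> R) :
  avg p n.+1 (fun s => phi (centered p x n.+1 s)) =
  p n * avg p n (fun s => phi (centered p x n s + (1 - p n) * x n)) +
  (1 - p n) * avg p n (fun s => phi (centered p x n s - p n * x n)).
Proof.
rewrite /= /centered; congr (_ * _ + _ * _); congr avg; apply: funext => s;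
  congr phi; rewrite big_ord_recr /= (sum_update (fun j b => (b%:R - p j) * x j));
  by rewrite /update eqxx ?sub0r ?mulNr.
Qed.

Lemma avg_centered p x n : avg p n (centered p x n) = 0.
Proof.
elim: n => [|n IH]; first by rewrite /= /centered big_ord0.
by rewrite (avg_centeredS _ _ _ id) !avgD IH !avg_cst; ring.
Qed.

Lemma avg_centered2 p x n :
  avg p n (fun s => centered p x n s ^+ 2) = variance p x n.
Proof.
elim: n => [|n IH].
  by rewrite /= /centered /variance !big_ord0 expr0n.
rewrite (avg_centeredS _ _ _ (fun y => y ^+ 2)).
have E c : avg p n (fun s => (centered p x n s + c) ^+ 2) = variance p x n + c ^+ 2.
  rewrite -IH -[in RHS](avg_cst p n (c ^+ 2)) -avgD.
  rewrite -[RHS]addr0 -(mulr0 (2 * c)) -(avg_centered p x n) -avgZ -avgD.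
  by congr avg; apply: funext => s; ring.
rewrite !E /variance big_ord_recr /=; ring.
Qed.

(** In the induction the terms of odd degree vanish: the linear one because the added
    variable is centred, the cubic one because the sum is. The hypothesis bounds the
    fourth moment of one term; it holds with [kappa = 0] for fair signs, and for any probabilities as
    soon as [`|x j| <= kappa]. *)
Lemma avg_centered4_le p x n (kappa : R) : is_prob p ->
  (forall j, (j < n)%N -> (1 - 3 * (p j * (1 - p j))) * x j ^+ 4 <=
     3 * (p j * (1 - p j)) * x j ^+ 4 + kappa ^+ 2 * x j ^+ 2) ->
  avg p n (fun s => centered p x n s ^+ 4) <=
  3 * variance p x n ^+ 2 + kappa ^+ 2 * variance p x n.
Proof.
move=> p01; elim: n => [_|n IH small].
  by rewrite /= /centered /variance !big_ord0 !expr0n /= !mulr0 addr0.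
rewrite (avg_centeredS _ _ _ (fun y => y ^+ 4)).
have E c : avg p n (fun s => (centered p x n s + c) ^+ 4) =
    avg p n (fun s => centered p x n s ^+ 4) +
    4 * c * avg p n (fun s => centered p x n s ^+ 3) +
    6 * c ^+ 2 * variance p x n + c ^+ 4.
  rewrite -avg_centered2 -!avgZ -(avg_cst p n (c ^+ 4)) -!avgD.
  rewrite -[RHS]addr0 -(mulr0 (4 * c ^+ 3)) -(avg_centered p x n) -avgZ -avgD.
  by congr avg; apply: funext => s; ring.
rewrite !E.
have := small n (ltnSn n).
have {IH small} := IH (fun j jn => small j (ltnW jn)).
have := variance_ge0 x n p01.
have /andP[p0 p1] := p01 n.
rewrite (_ : variance p x n.+1 = variance p x n + p n * (1 - p n) * x n ^+ 2);
  last by rewrite /variance big_ord_recr.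
set A := avg _ _ _; set B := avg _ _ _; set V := variance p x n.
set y := x n; set q := p n => V0 A4 K.
have q0 : 0 <= q * (1 - q) by rewrite mulr_ge0 ?subr_ge0.
have K' := ler_wpM2l q0 K.
have -> : q * (A + 4 * ((1 - q) * y) * B + 6 * ((1 - q) * y) ^+ 2 * V + ((1 - q) * y) ^+ 4) +
  (1 - q) * (A + 4 * - (q * y) * B + 6 * (- (q * y)) ^+ 2 * V + (- (q * y)) ^+ 4) =
  A + 6 * (q * (1 - q)) * y ^+ 2 * V + q * (1 - q) * ((1 - 3 * (q * (1 - q))) * y ^+ 4) by ring.
have -> : 3 * (V + q * (1 - q) * y ^+ 2) ^+ 2 + kappa ^+ 2 * (V + q * (1 - q) * y ^+ 2) =
  (3 * V ^+ 2 + kappa ^+ 2 * V) + 6 * (q * (1 - q)) * y ^+ 2 * V +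
  q * (1 - q) * (3 * (q * (1 - q)) * y ^+ 4 + kappa ^+ 2 * y ^+ 2) by ring.
lra.
Qed.

(** The Paley-Zygmund inequality, in the form without Cauchy-Schwarz: with
    [u = f s ^+ 2] and [A] its mean, the part of [A] carried by large values of [u] is
    bounded by the second moment of [u] through a tangent parabola. *)
Lemma paley_zygmund p n f (B : R) : is_prob p -> 0 < B ->
  0 < avg p n (fun s => f s ^+ 2) ->
  avg p n (fun s => f s ^+ 4) <= B * avg p n (fun s => f s ^+ 2) ^+ 2 ->
  (4 * B)^-1 <= avg p n (fun s => (avg p n (fun s => f s ^+ 2) / 2 <= f s ^+ 2)%R%:R).
Proof.
move=> p01 B0; set A := avg p n (fun s => f s ^+ 2) => A0 M4.
set Q := avg _ _ _.
(* The truncation level [2 * B * A] makes the fourth moment cost [A / 4]. *)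
have tau0 : 0 < 2 * B * A by rewrite !mulr_gt0.
have pw s : f s ^+ 2 - A / 2 <=
   (2 * (2 * B * A))^-1 * f s ^+ 4 + (B * A) * (A / 2 <= f s ^+ 2)%R%:R.
  have u0 := sqr_ge0 (f s).
  have i0 : 0 <= (2 * (2 * B * A))^-1 by rewrite invr_ge0 mulr_ge0 // ltW.
  have -> : f s ^+ 4 = (f s ^+ 2) ^+ 2 by ring.
  case: (leP (A / 2) (f s ^+ 2)) => h /=; last by have := mulr_ge0 i0 (sqr_ge0 (f s ^+ 2)); lra.
  set u := f s ^+ 2 in u0 h *.
  have -> : (2 * (2 * B * A))^-1 * u ^+ 2 + B * A * 1 =
     u + (2 * (2 * B * A))^-1 * (u - 2 * B * A) ^+ 2.
    by field; rewrite !gt_eqF.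
  have := mulr_ge0 i0 (sqr_ge0 (u - 2 * B * A)); lra.
have := avg_le n p01 pw.
rewrite avgB avgD !avgZ avg_cst -/A -/Q => h.
have i0 : 0 <= (2 * (2 * B * A))^-1 by rewrite invr_ge0 mulr_ge0 // ltW.
have h2 := ler_wpM2l i0 M4.
have E : (2 * (2 * B * A))^-1 * (B * A ^+ 2) = A / 4 by field; rewrite !gt_eqF.
rewrite E in h2.
have h3 : A / 4 <= B * A * Q by lra.
rewrite -(ler_pM2l (mulr_gt0 B0 A0)); apply: le_trans h3.
by have -> : B * A * (4 * B)^-1 = A / 4 by field; rewrite gt_eqF.
Qed.

Lemma avg_markov p n f (c : R) : is_prob p -> 0 < c -> (forall s, 0 <= f s) ->
  avg p n (fun s => (c <= f s)%R%:R) <= avg p n f / c.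
Proof.
move=> p01 c0 f0; rewrite mulrC -avgZ; apply: avg_le => // s.
have ic : 0 <= c^-1 by rewrite invr_ge0 ltW.
case: (leP c (f s)) => h /=; last by rewrite mulr_ge0.
by rewrite mulrC ler_pdivlMr // mul1r.
Qed.

Lemma signed_sum_centered x n (s : nat -> bool) :
  \sum_(j < n) (if s j then x j else - x j) =
  centered (fun=> 2^-1) (fun j => 2 * x j) n s.
Proof. by apply: eq_bigr => j _; case: (s j) => /=; field. Qed.

Lemma variance_signed_sum x n :
  variance (fun=> 2^-1) (fun j => 2 * x j) n = \sum_(j < n) x j ^+ 2.
Proof. by apply: eq_bigr => j _; field. Qed.

Lemma avg_signed_sum2 x n :
  avg (fun=> 2^-1) n (fun s => (\sum_(j < n) (if s j then x j else - x j)) ^+ 2)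
  = \sum_(j < n) x j ^+ 2.
Proof.
rewrite -variance_signed_sum -avg_centered2; congr avg; apply: funext => s.
by rewrite signed_sum_centered.
Qed.

Lemma is_prob_half : is_prob (fun=> 2^-1 : R).
Proof. by apply: is_prob_cst; rewrite invr_ge0 ler0n invf_le1 ?ler1n ?ltr0n. Qed.

(** The fourth moment of a Rademacher sum is at most three times the square of its
    variance, so [paley_zygmund] applies with a universal constant. *)
Lemma rademacher_lower x n (Q : R) : Q = \sum_(j < n) x j ^+ 2 ->
  12^-1 <= avg (fun=> 2^-1) n
    (fun s => (Q / 2 <= (\sum_(j < n) (if s j then x j else - x j)) ^+ 2)%R%:R).
Proof.
move=> QE.
have p01 := is_prob_half.
have E := signed_sum_centered x n.
have V : variance (fun=> 2^-1) (fun j => 2 * x j) n = Q.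
  by rewrite QE variance_signed_sum.
pose Y := centered (fun=> 2^-1) (fun j => 2 * x j) n.
suff H : 12^-1 <= avg (fun=> 2^-1) n
    (fun s => (avg (fun=> 2^-1) n (fun s => Y s ^+ 2) / 2 <= Y s ^+ 2)%R%:R).
  by apply: le_trans H _; apply: avg_le => // s; rewrite avg_centered2 V E.
have [Q0|Q0] := eqVneq Q 0.
  rewrite avg_centered2 V Q0 mul0r -[leLHS](avg_cst (fun=> 2^-1) n 12^-1).
  by apply: avg_le => // s; rewrite sqr_ge0 invf_le1 ?ler1n ?ltr0n.
have Qp : 0 < Q by rewrite lt_def Q0 QE sumr_ge0 // => j _; rewrite sqr_ge0.
have -> : 12 = 4 * 3 :> R by ring.
apply: paley_zygmund => //; rewrite avg_centered2 V //.
apply: le_trans (avg_centered4_le (kappa := 0) p01 _) _; last by rewrite V; lra.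
move=> j _; have := sqr_ge0 ((2 * x j) ^+ 2); rewrite -exprM; lra.
Qed.

(** Thinning: the selected sum has mean [rho * X] with [`|X| >= N]. As the terms are
    small compared with this mean, its fourth moment is controlled by the square of the
    second one even when the variance dominates, so the lower bound does not depend
    on [rho]. *)
Lemma thinning_lower x n (rho N kappa : R) : 0 < rho <= 2^-1 -> 0 < N ->
  (forall j, (j < n)%N -> `|x j| <= kappa) -> kappa <= rho * N ->
  N <= `|\sum_(j < n) x j| ->
  128^-1 <= avg (fun=> rho) n
    (fun s => ((rho * N / 2) <= `|\sum_(j < n) (s j)%:R * x j|)%R%:R).
Proof.
move=> /andP[r0 r2] N0 xk kN; set X := \sum_(j < n) x j => NX.
have p01 : is_prob (fun=> rho) by apply: is_prob_cst; lra.
have V0 := variance_ge0 x n p01.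
pose Y := centered (fun=> rho) x n.
have E (s : nat -> bool) : \sum_(j < n) (s j)%:R * x j = rho * X + Y s.
  by rewrite mulr_sumr -big_split /=; apply: eq_bigr => j _; ring.
have M1 : avg (fun=> rho) n Y = 0 by exact: avg_centered.
have M2 : avg (fun=> rho) n (fun s => (rho * X + Y s) ^+ 2) =
    (rho * X) ^+ 2 + variance (fun=> rho) x n.
  rewrite -avg_centered2 -[in RHS](avg_cst (fun=> rho) n ((rho * X) ^+ 2)) -avgD.
  rewrite -[RHS]addr0 -(mulr0 (2 * (rho * X))) -M1 -avgZ -avgD.
  by congr avg; apply: funext => s; rewrite /Y; ring.
have rN : rho * N <= `|rho * X| by rewrite normrM (gtr0_norm r0) ler_pM2l.
have rN2 : (rho * N) ^+ 2 <= (rho * X) ^+ 2.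
  by rewrite -[leRHS]real_normK ?num_real // lerXn2r // nnegrE ?mulr_ge0 // ltW.
have rNp : 0 < (rho * N) ^+ 2 by rewrite exprn_gt0 // mulr_gt0.
have k2 : 0 <= kappa -> kappa ^+ 2 <= (rho * X) ^+ 2.
  by move=> k0; apply: le_trans rN2; rewrite lerXn2r // nnegrE mulr_ge0 // ltW.
have M4 : avg (fun=> rho) n (fun s => Y s ^+ 4) <=
    3 * variance (fun=> rho) x n ^+ 2 + 4 * ((rho * X) ^+ 2) * variance (fun=> rho) x n.
  apply: (@le_trans _ _ (3 * variance (fun=> rho) x n ^+ 2 +
     (2 * (rho * X)) ^+ 2 * variance (fun=> rho) x n)); last first.
    by rewrite le_eqVlt; apply/orP; left; apply/eqP; ring.
  apply: avg_centered4_le => // j jn.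
  have xj : x j ^+ 2 <= (rho * X) ^+ 2.
    have k0 : 0 <= kappa by apply: le_trans (normr_ge0 (x j)) (xk _ jn).
    apply: le_trans (k2 k0).
    by rewrite -[leLHS]real_normK ?num_real // lerXn2r ?nnegrE // xk.
  have x20 := sqr_ge0 (x j).
  have -> : x j ^+ 4 = x j ^+ 2 * x j ^+ 2 by ring.
  have -> : (2 * (rho * X)) ^+ 2 = 4 * (rho * X) ^+ 2 by ring.
  have v0 : 0 <= rho * (1 - rho) by rewrite mulr_ge0 //; lra.
  have H1 := ler_wpM2l x20 xj.
  have H2 := mulr_ge0 x20 x20.
  have H3 := mulr_ge0 v0 H2.
  have H4 := le_trans H2 H1.
  lra.
have M4' : avg (fun=> rho) n (fun s => (rho * X + Y s) ^+ 4) <=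
    32 * avg (fun=> rho) n (fun s => (rho * X + Y s) ^+ 2) ^+ 2.
  apply: (@le_trans _ _ (avg (fun=> rho) n
     (fun s => 8 * (rho * X) ^+ 4 + 8 * Y s ^+ 4))).
    apply: avg_le => // s; move: (Y s) (rho * X) => a b.
    have -> : 8 * b ^+ 4 + 8 * a ^+ 4 = (b + a) ^+ 4 +
       7 * (b ^+ 2 - a ^+ 2) ^+ 2 + 4 * (b * a) * (- b ^+ 2 - a ^+ 2 + 2 * (b * a)) by ring.
    have -> : 7 * (b ^+ 2 - a ^+ 2) ^+ 2 = 7 * ((b + a) ^+ 2 * (b - a) ^+ 2) by ring.
    have -> : 4 * (b * a) * (- b ^+ 2 - a ^+ 2 + 2 * (b * a)) =
      - 4 * (b * a) * (b - a) ^+ 2 by ring.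
    have -> : b * a = ((b + a) ^+ 2 - (b - a) ^+ 2) / 4 by field.
    have := sqr_ge0 ((b - a) ^+ 2).
    have := mulr_ge0 (sqr_ge0 (b + a)) (sqr_ge0 (b - a)).
    move: ((b + a) ^+ 2) ((b - a) ^+ 2) => u v; lra.
  rewrite avgD avg_cst avgZ M2.
  have h := ler_wpM2l (ler0n R 8) M4.
  have A0 := sqr_ge0 (rho * X).
  have A00 := mulr_ge0 A0 A0.
  have AV := mulr_ge0 A0 V0.
  have VV := mulr_ge0 V0 V0.
  rewrite -/Y in h.
  have -> : (rho * X) ^+ 4 = (rho * X) ^+ 2 * (rho * X) ^+ 2 by ring.
  lra.
have -> : 128 = 4 * 32 :> R by ring.
apply: le_trans (paley_zygmund p01 _ _ M4') _; rewrite ?M2 //; first lra.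
apply: avg_le => // s; rewrite E -M2.
case: (leP _ ((rho * X + Y s) ^+ 2)) => [h|]; last by rewrite ler0n.
rewrite M2 in h.
suff -> : rho * N / 2 <= `|rho * X + Y s| by [].
rewrite -ler_sqr ?nnegrE ?divr_ge0 // ?mulr_ge0 // ?(ltW r0) ?(ltW N0) //.
rewrite real_normK ?num_real //.
have -> : (rho * N / 2) ^+ 2 = (rho * N) ^+ 2 / 4 by field.
lra.
Qed.

(** Whatever the other terms, the sums with and without the term [j0] differ by
    [x j0], so that one of them is at least [`|x j0| / 2]. *)
Lemma random_subset_lower x n j0 : (j0 < n)%N ->
  2^-1 <= avg (fun=> 2^-1) n
    (fun s => (`|x j0| / 2 <= `|\sum_(j < n) (s j)%:R * x j|)%R%:R).
Proof.
have p01 := is_prob_half.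
suff H : forall z, (j0 < n)%N -> 2^-1 <= avg (fun=> 2^-1) n
    (fun s => (`|x j0| / 2 <= `|z + \sum_(j < n) (s j)%:R * x j|)%R%:R).
  by move=> jn; apply: le_trans (H 0 jn) _; apply: avg_le => // s; rewrite add0r.
elim: n => // n IH z; rewrite ltnS leq_eqVlt => /predU1P[->|jn] /=; last first.
  rewrite [leLHS](_ : _ = 2^-1 * 2^-1 + (1 - 2^-1) * 2^-1); last by field.
  apply: lerD; apply: ler_wpM2l; rewrite ?subr_ge0 ?invr_ge0 ?invf_le1 ?ler1n ?ltr0n //.
    apply: le_trans (IH (z + x n) jn) _; apply: avg_le => // s.
    rewrite big_ord_recr /= (sum_update (fun j b => b%:R * x j)).
    by rewrite /update eqxx mul1r -addrA (addrC (x n)).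
  apply: le_trans (IH z jn) _; apply: avg_le => // s.
  rewrite big_ord_recr /= (sum_update (fun j b => b%:R * x j)).
  by rewrite /update eqxx mul0r addr0.
rewrite (_ : 1 - 2^-1 = 2^-1 :> R); last by field.
rewrite -mulrDr -[leLHS]mulr1 ler_pM2l ?invr_gt0 // -avgD.
rewrite -[leLHS](avg_cst (fun=> 2^-1) n 1); apply: avg_le => // s.
rewrite !big_ord_recr /= !(sum_update (fun j b => b%:R * x j)) /update eqxx mul1r mul0r addr0.
set S := \sum_(_ < _) _.
case: (leP _ `|z + (S + x n)|) => h1; first by rewrite lerDl ler0n.
case: (leP _ `|z + S|) => h2; first by rewrite add0r.
have : `|x n| <= `|z + (S + x n)| + `|z + S|.
  by rewrite -[in leLHS](_ : (z + (S + x n)) - (z + S) = x n) ?ler_normB //; ring.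
lra.
Qed.

End randomization.

(** * Outer probability *)

Section outer_probability.
Context {d} {Omega : measurableType d} {R : realType}.
Variable P : probability Omega R.
Implicit Types (A B : set Omega) (xi zeta : Omega -> R).

(** The outer probability: it allows events to be compared before their
    measurability is known. *)
Definition pr A : R := fine (mu_ext P A).

Lemma prE A : measurable A -> P A = (pr A)%:E.
Proof. by move=> mA; rewrite /pr measurable_mu_extE // fineK // fin_num_measure. Qed.

Lemma mu_ext_prE A : mu_ext P A = (pr A)%:E.
Proof.
rewrite /pr fineK // ge0_fin_numE; last exact: mu_ext_ge0.
apply: (@le_lt_trans _ _ (mu_ext P setT)); first exact: le_mu_ext.
by rewrite measurable_mu_extE // -ge0_fin_numE // fin_num_measure.
Qed.

Lemma pr_le A B : A `<=` B -> pr A <= pr B.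
Proof. by move=> AB; rewrite -lee_fin -!mu_ext_prE; exact: le_mu_ext. Qed.

Lemma pr_ge0 A : 0 <= pr A.
Proof. by rewrite -lee_fin -mu_ext_prE; exact: mu_ext_ge0. Qed.

Lemma pr0 : pr set0 = 0.
Proof. by rewrite /pr measurable_mu_extE // measure0. Qed.

Lemma prT : pr setT = 1.
Proof. by apply: EFin_inj; rewrite -prE // probability_setT. Qed.

Lemma pr_le1 A : pr A <= 1.
Proof. by rewrite -prT; exact: pr_le. Qed.

Lemma pr_eq0 A : pr A <= 0 -> pr A = 0.
Proof. by move=> A0; apply/eqP; rewrite eq_le A0 pr_ge0. Qed.

Lemma pr_bigcup0 (A : nat -> set Omega) : (forall n, pr (A n) = 0) ->
  pr (\bigcup_n A n) = 0.
Proof.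
move=> A0; apply: pr_eq0; rewrite -lee_fin -mu_ext_prE.
apply: le_trans (mu_ext_sigma_subadditive (measure_ge0 P) A) _.
by rewrite eseries0 // => n _ _; rewrite mu_ext_prE A0.
Qed.

Lemma prU A B : pr (A `|` B) <= pr A + pr B.
Proof.
rewrite -lee_fin EFinD -!mu_ext_prE.
have -> : A `|` B = \bigcup_n bigcup2 A B n by rewrite bigcup2E.
apply: le_trans (mu_ext_sigma_subadditive (measure_ge0 P) _) _.
rewrite (nneseries_split 0%N 2%N); last by move=> *; exact: mu_ext_ge0.
rewrite big_mkord !big_ord_recl big_ord0 /= adde0 eseries0 ?adde0 //.
move=> [|[|n]] // _ _ /=; rewrite measurable_mu_extE // measure0 //.
Qed.

Lemma pr_le_add A B C (a b : R) : A `<=` B `|` C -> pr B <= a -> pr C <= b ->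
  pr A <= a + b.
Proof.
by move=> ABC Ba Cb; apply: le_trans (pr_le ABC) _;
  apply: le_trans (prU _ _) _; exact: lerD.
Qed.

Lemma pr_setC A : measurable A -> pr (~` A) = 1 - pr A.
Proof.
move=> mA; apply: EFin_inj; rewrite -prE; last exact: measurableC.
by rewrite probability_setC // prE.
Qed.

Lemma pr_negligible A : P.-negligible A -> pr A = 0.
Proof.
move=> [B [mB B0 AB]]; apply: pr_eq0; apply: le_trans (pr_le AB) _.
by rewrite -lee_fin -prE // B0.
Qed.

(** The sets [\bigcap_(n >= N) A n] increase to a set that contains [B]. *)
Lemma pr_liminf (A : nat -> set Omega) B (e : R) :
  (forall n, measurable (A n)) -> (forall n, pr (A n) <= e) ->
  (forall w, B w -> exists N, forall n, (N <= n)%N -> A n w) -> pr B <= e.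
Proof.
move=> mA Ae BA.
pose F N := \bigcap_(n in [set n | (N <= n)%N]) A n.
have mF N : measurable (F N) by apply: bigcap_measurable => //; exists N => /=.
have BF : B `<=` \bigcup_N F N.
  by move=> w /BA[N Nw]; exists N => // n /= Nn; exact: Nw.
apply: le_trans (pr_le BF) _; rewrite -lee_fin -prE; last exact: bigcupT_measurable.
have ndF : nondecreasing_seq F.
  by move=> m n mn; apply/subsetPset => w Fm k /= nk; apply: Fm; exact: leq_trans nk.
have cF := nondecreasing_cvg_mu (mu := P) mF (bigcupT_measurable _ mF) ndF.
rewrite -(cvg_lim _ cF) //; apply: lime_le; first by apply/cvg_ex; eexists; exact: cF.
apply: nearW => N /=; rewrite prE // lee_fin; apply: le_trans (Ae N).
by apply: pr_le => w; apply => /=.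
Qed.

(** Otherwise the complements of a subsequence of the [A n] would have probabilities
    bounded away from one, although each point is eventually in all of them. *)
Lemma pr_cvg0 (A : nat -> set Omega) (e : R) :
  (forall n, measurable (A n)) -> 0 < e ->
  (forall w, exists N, forall n, (N <= n)%N -> ~ A n w) ->
  exists N, forall n, (N <= n)%N -> pr (A n) <= e.
Proof.
move=> mA e0 Aw; apply: contrapT => /forallNP H.
have {}H N : exists n, (N <= n)%N /\ e < pr (A n).
  have /existsNP[n /not_implyP[Nn /negP]] := H N; rewrite -ltNge => ?.
  by exists n.
have /choice[f fP] := H.
pose g := fix g n := if n is n'.+1 then f (g n').+1 else f 0%N.
have gn n : (n <= g n)%N.
  elim: n => // n IH; apply: leq_ltn_trans IH _.
  by have [] := fP (g n).+1.
have ge n : e < pr (A (g n)) by case: n => [|n]; apply: (fP _).2.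
suff : pr setT <= 1 - e by rewrite prT; lra.
apply: (@pr_liminf (fun n => ~` A (g n))) => [n|n|w _].
- exact: measurableC.
- by rewrite pr_setC // lerD2l lerN2 ltW.
- have [N Nw] := Aw w; exists N => n Nn; apply: Nw.
  exact: leq_trans (gn n).
Qed.

Lemma measurable_gt_norm xi (c : R) : measurable_fun setT xi ->
  measurable [set w | c < `|xi w|].
Proof.
move=> mxi; rewrite -[X in measurable X]setTI.
have -> : [set w | c < `|xi w|] = ((fun x : R => `|x|) \o xi) @^-1` `]c, +oo[.
  by apply/seteqP; split => w /=; rewrite in_itv /= andbT.
exact: (measurableT_comp (@normr_measurable R setT)).
Qed.

Lemma measurable_ge_norm xi (c : R) : measurable_fun setT xi ->
  measurable [set w | c <= `|xi w|].
Proof.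
move=> mxi; rewrite -[X in measurable X]setTI.
have -> : [set w | c <= `|xi w|] = ((fun x : R => `|x|) \o xi) @^-1` `[c, +oo[.
  by apply/seteqP; split => w /=; rewrite in_itv /= andbT.
exact: (measurableT_comp (@normr_measurable R setT)).
Qed.

(** * Averages of probabilities over a finite random choice *)

(** A finite form of Fubini's theorem: it exchanges the auxiliary finite randomization
    and the probability [P]. *)
Lemma integral_avg p n (A : (nat -> bool) -> set Omega) : is_prob p ->
  (forall s, measurable (A s)) ->
  measurable_fun setT (fun w => avg p n (fun s => \1_(A s) w)) /\
  (\int[P]_w (avg p n (fun s => \1_(A s) w))%:E =
   (avg p n (fun s => pr (A s)))%:E)%E.
Proof.
move=> p01; elim: n A => [|n IH] A mA /=.
  split; first exact: measurable_indic.
  by rewrite integral_indic // setIT -prE.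
have [m1 I1] := IH (fun s => A (update s n true)) (fun s => mA _).
have [m2 I2] := IH (fun s => A (update s n false)) (fun s => mA _).
have /andP[p0 p1] := p01 n.
have q0 : 0 <= 1 - p n by rewrite subr_ge0.
have a0 b w : 0 <= avg p n (fun s => \1_(A (update s n b)) w) :> R.
  by apply: avg_ge0 => // s; rewrite indicE ler0n.
split; first by apply: measurable_funD; apply: measurable_funM.
under eq_integral do rewrite EFinD !EFinM.
rewrite ge0_integralD //=; first last.
- by apply: emeasurable_funM => //; exact/measurable_EFinP.
- by move=> w _; rewrite mule_ge0 // lee_fin // a0.
- by apply: emeasurable_funM => //; exact/measurable_EFinP.
- by move=> w _; rewrite mule_ge0 // lee_fin // a0.
rewrite !ge0_integralZl_EFin //; first last.
- exact/measurable_EFinP.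
- by move=> w _; rewrite lee_fin a0.
- exact/measurable_EFinP.
- by move=> w _; rewrite lee_fin a0.
by rewrite I1 I2.
Qed.

(** The probabilistic method for random events: if at each point of [B] a proportion
    [c] of the events occurs, then the events have on average a probability of at least
    [c] times that of [B]. *)
Lemma avg_pr_ge p n (A : (nat -> bool) -> set Omega) B (c : R) : is_prob p ->
  (forall s, measurable (A s)) -> measurable B -> 0 <= c ->
  (forall w, B w -> c <= avg p n (fun s => \1_(A s) w)) ->
  c * pr B <= avg p n (fun s => pr (A s)).
Proof.
move=> p01 mA mB c0 H; have [m I] := integral_avg n p01 mA.
rewrite -lee_fin -I EFinM -prE // -[B in P B]setIT -integral_indic //.
rewrite -ge0_integralZl_EFin //; first last.
  by apply/measurable_EFinP; exact: measurable_indic.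
apply: ge0_le_integral => //.
- by move=> w _; rewrite mule_ge0 // lee_fin // indicE ler0n.
- apply: emeasurable_funM => //; apply/measurable_EFinP.
  exact: measurable_indic.
- exact/measurable_EFinP.
move=> w _; rewrite -EFinM lee_fin indicE.
have [/set_mem Bw|_] := boolP (w \in B); first by rewrite mulr1 H.
by rewrite mulr0; apply: avg_ge0 => // s; rewrite indicE ler0n.
Qed.

Lemma avg_pr_le p n (A : (nat -> bool) -> set Omega) (c : R) : is_prob p ->
  (forall s, measurable (A s)) ->
  (forall w, avg p n (fun s => \1_(A s) w) <= c) ->
  avg p n (fun s => pr (A s)) <= c.
Proof.
move=> p01 mA H; have [m I] := integral_avg n p01 mA.
have c0 : 0 <= c.
  by apply: le_trans (H point); apply: avg_ge0 => // s; rewrite indicE ler0n.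
rewrite -lee_fin -I; apply: (@le_trans _ _ (\int[P]_w (cst c%:E w))%E).
  apply: ge0_le_integral => //.
  - by move=> w _; rewrite lee_fin; apply: avg_ge0 => // s; rewrite indicE ler0n.
  - exact/measurable_EFinP.
  - by move=> w _; rewrite lee_fin H.
by rewrite integral_cst //= [X in (_ * X)%E]probability_setT mule1.
Qed.

(** * Smallness in probability *)

Definition tail xi (c : R) : R := pr [set w | c < `|xi w|].
(** [small e xi] means that the Ky Fan distance from [xi] to [0] is at most [e]. *)
Definition small (e : R) xi := tail xi e <= e.

Lemma tail_ge0 xi c : 0 <= tail xi c. Proof. exact: pr_ge0. Qed.

Lemma tail_le xi a b : a <= b -> tail xi b <= tail xi a.
Proof. by move=> ab; apply: pr_le => w /=; exact: le_lt_trans. Qed.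

Lemma tailD xi zeta a b : tail (fun w => xi w + zeta w) (a + b) <=
  tail xi a + tail zeta b.
Proof.
apply: pr_le_add (lexx _) (lexx _) => w /= H.
have [h1|h1] := ltP a `|xi w|; first by left.
right; have := ler_normD (xi w) (zeta w); rewrite /=; lra.
Qed.

Lemma tailN xi a : tail (fun w => - xi w) a = tail xi a.
Proof. by congr pr; apply/seteqP; split => w /=; rewrite normrN. Qed.

Lemma tailB xi zeta a b : tail (fun w => xi w - zeta w) (a + b) <=
  tail xi a + tail zeta b.
Proof. by rewrite -(tailN zeta); exact: tailD. Qed.

Lemma small_ge0 e xi : small e xi -> 0 <= e.
Proof. exact: le_trans (tail_ge0 _ _). Qed.

Lemma small_le a b xi : a <= b -> small a xi -> small b xi.
Proof. by move=> ab h; apply: le_trans (tail_le _ ab) _; exact: le_trans ab. Qed.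

Lemma smallD a b xi zeta : small a xi -> small b zeta ->
  small (a + b) (fun w => xi w + zeta w).
Proof. by move=> h1 h2; apply: le_trans (tailD _ _ _ _) _; exact: lerD. Qed.

Lemma smallN a xi : small a xi -> small a (fun w => - xi w).
Proof. by rewrite /small tailN. Qed.

Lemma smallB a b xi zeta : small a xi -> small b zeta ->
  small (a + b) (fun w => xi w - zeta w).
Proof. by move=> h1 /smallN h2; exact: smallD. Qed.

Lemma small0 e : 0 <= e -> small e (fun=> 0).
Proof.
move=> e0; rewrite /small /tail (_ : [set _ | _] = set0) ?pr0 //.
by apply/seteqP; split => w //=; rewrite normr0 ltNge e0.
Qed.

Lemma small_sum (I : Type) (r : seq I) (e : I -> R) (xi : I -> Omega -> R) :
  (forall i, small (e i) (xi i)) ->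
  small (\sum_(i <- r) e i) (fun w => \sum_(i <- r) xi i w).
Proof.
move=> h; elim: r => [|i r IH].
  by rewrite big_nil; under [X in small _ X]eq_fun do rewrite big_nil; exact: small0.
rewrite big_cons; under [X in small _ X]eq_fun do rewrite big_cons.
exact: smallD.
Qed.

Lemma smallZ e xi (c : R) : small e xi ->
  small (Num.max 1 `|c| * e) (fun w => c * xi w).
Proof.
move=> h; have e0 := small_ge0 h.
set m := Num.max 1 `|c|.
have m1 : 1 <= m by rewrite /m le_max lexx.
have mc : `|c| <= m by rewrite /m le_max lexx orbT.
have em : e <= m * e by rewrite ler_peMl.
apply: le_trans em; apply: le_trans h; apply: pr_le => w /=.
rewrite normrM => H; rewrite -(ltr_pM2l (lt_le_trans ltr01 m1)).
by apply: lt_le_trans H _; rewrite ler_wpM2r.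
Qed.

(** * Almost sure equality *)

Definition aeq xi zeta := pr [set w | xi w != zeta w] = 0.

Lemma aeq_refl xi : aeq xi xi.
Proof.
rewrite /aeq (_ : [set _ | _] = set0) ?pr0 //.
by apply/seteqP; split => w //=; rewrite eqxx.
Qed.

Lemma aeq_eq xi zeta : xi =1 zeta -> aeq xi zeta.
Proof. by move=> /funext ->; exact: aeq_refl. Qed.

Lemma aeq_sym xi zeta : aeq xi zeta -> aeq zeta xi.
Proof. by rewrite /aeq => <-; congr pr; apply/seteqP; split => w /=; rewrite eq_sym. Qed.

Lemma aeq_le xi zeta xi' zeta' : aeq xi zeta ->
  (forall w, xi w = zeta w -> xi' w = zeta' w) -> aeq xi' zeta'.
Proof.
move=> h H; apply: pr_eq0; rewrite -h; apply: pr_le => w /= /eqP n.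
by apply/eqP => /H.
Qed.

Lemma aeq_le2 xi zeta xi1 zeta1 xi' zeta' : aeq xi zeta -> aeq xi1 zeta1 ->
  (forall w, xi w = zeta w -> xi1 w = zeta1 w -> xi' w = zeta' w) ->
  aeq xi' zeta'.
Proof.
move=> h h1 H; apply: pr_eq0; rewrite -[leRHS]addr0.
apply: (@pr_le_add _ [set w | xi w != zeta w] [set w | xi1 w != zeta1 w]);
  rewrite ?h ?h1 // => w /= /eqP n.
have [e|e] := eqVneq (xi w) (zeta w); last by left.
by right; apply/eqP => /(H _ e).
Qed.

Lemma aeq_trans zeta xi chi : aeq xi zeta -> aeq zeta chi -> aeq xi chi.
Proof. by move=> h1 h2; apply: (aeq_le2 h1 h2) => w -> ->. Qed.

Lemma aeqD xi zeta xi' zeta' : aeq xi zeta -> aeq xi' zeta' ->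
  aeq (fun w => xi w + xi' w) (fun w => zeta w + zeta' w).
Proof. by move=> h1 h2; apply: (aeq_le2 h1 h2) => w -> ->. Qed.

Lemma aeqB xi zeta xi' zeta' : aeq xi zeta -> aeq xi' zeta' ->
  aeq (fun w => xi w - xi' w) (fun w => zeta w - zeta' w).
Proof. by move=> h1 h2; apply: (aeq_le2 h1 h2) => w -> ->. Qed.

Lemma aeqZ c xi zeta : aeq xi zeta -> aeq (fun w => c * xi w) (fun w => c * zeta w).
Proof. by move=> h1; apply: (aeq_le h1) => w ->. Qed.

Lemma aeq_sum (I : eqType) (r : seq I) (xi zeta : I -> Omega -> R) :
  (forall i, i \in r -> aeq (xi i) (zeta i)) ->
  aeq (fun w => \sum_(i <- r) xi i w) (fun w => \sum_(i <- r) zeta i w).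
Proof.
elim: r => [|i r IH] h; first by apply: aeq_eq => w; rewrite !big_nil.
under [X in aeq X _]eq_fun do rewrite big_cons.
under [X in aeq _ X]eq_fun do rewrite big_cons.
apply: aeqD; first by apply: h; rewrite mem_head.
by apply: IH => j jr; apply: h; rewrite in_cons jr orbT.
Qed.

Lemma aeq_tail xi zeta c : aeq xi zeta -> tail xi c = tail zeta c.
Proof.
suff H a b : aeq a b -> tail a c <= tail b c.
  by move=> h; apply/eqP; rewrite eq_le !H //; exact: aeq_sym.
move=> h; rewrite -[leRHS]addr0.
apply: (@pr_le_add _ [set w | c < `|b w|] [set w | a w != b w]);
  rewrite ?h // => w /= n.
have [e|e] := eqVneq (a w) (b w); last by right.
by left; rewrite -e.
Qed.

Lemma aeq_small e xi zeta : aeq xi zeta -> small e xi -> small e zeta.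
Proof. by move=> h; rewrite /small (aeq_tail _ h). Qed.

Lemma ae_aeq xi zeta : {ae P, forall w, xi w = zeta w} -> aeq xi zeta.
Proof.
move=> h; apply: pr_negligible; apply: negligibleS h => w /= /eqP ne; exact: ne.
Qed.

Lemma small_aeq0 xi : (forall e, 0 < e -> small e xi) -> aeq xi (fun=> 0).
Proof.
move=> h; have t0 c : 0 < c -> tail xi c = 0.
  move=> c0; apply: pr_eq0; apply/ler_addgt0Pr => e e0; rewrite add0r.
  have [ec|ce] := leP e c; first by apply: le_trans (tail_le _ ec) _; exact: h.
  by apply: le_trans (h _ c0) _; exact: ltW.
have : pr (\bigcup_n [set w | n.+1%:R^-1 < `|xi w|]) = 0.
  by apply: pr_bigcup0 => n; apply: t0; rewrite invr_gt0.
move=> E; apply: pr_eq0; rewrite -[leRHS]E; apply: pr_le => w /= xw.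
have x0 : 0 < `|xi w| by rewrite normr_gt0.
have [n nx] := ltr_add_invr x0.
by exists n => //=; rewrite add0r in nx.
Qed.

Lemma cvg_in_probability_small (xi_ : nat -> Omega -> R) xi :
  (forall n, measurable_fun setT (xi_ n)) -> measurable_fun setT xi ->
  cvg_in_probability P xi_ xi ->
  forall e, 0 < e -> exists N, forall n, (N <= n)%N ->
    small e (fun w => xi_ n w - xi w).
Proof.
move=> mxi_ mxi cv e e0; have /fine_cvgP[_ /cvgrPdist_le /(_ _ e0)[N _ HN]] := cv e e0.
exists N => n Nn; have := HN n Nn; rewrite /= sub0r normrN => H.
have mD : measurable [set w | e <= `|xi_ n w - xi w|].
  by apply: measurable_ge_norm; exact: measurable_funB.
rewrite (prE mD) /= ger0_norm ?pr_ge0 // in H.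
by apply: le_trans H; apply: pr_le => w /=; exact: ltW.
Qed.

End outer_probability.

(** * Convex hulls of bounded families of subset sums *)

Section bounded_subset_sums.
Context {d} {Omega : measurableType d} {R : realType}.
Variable P : probability Omega R.
Variables (n : nat) (x : nat -> Omega -> R) (lambda eta : R).
Hypothesis mx : forall j, measurable_fun setT (x j).
Hypothesis lambda_gt0 : 0 < lambda.
Hypothesis subset_sums : forall s : nat -> bool,
  tail P (fun w => \sum_(j < n) (s j)%:R * x j w) lambda <= eta.

Let Q w := \sum_(j < n) x j w ^+ 2.

Let mQ : measurable_fun setT Q.
Proof. by apply: measurable_sum => j; exact: measurable_funX. Qed.

Let msum_coef (c : nat -> R) :
  measurable_fun setT (fun w => \sum_(j < n) c j * x j w).
Proof. by apply: measurable_sum => j; apply: measurable_funM. Qed.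

(** A signed sum is the difference of two subset sums. *)
Lemma tail_signed_sum (s : nat -> bool) :
  tail P (fun w => \sum_(j < n) (if s j then x j w else - x j w)) (2 * lambda)
  <= 2 * eta.
Proof.
have E : (fun w => \sum_(j < n) (if s j then x j w else - x j w)) =
    (fun w => \sum_(j < n) (s j)%:R * x j w - \sum_(j < n) (~~ s j)%:R * x j w).
  apply: funext => w; rewrite -sumrB; apply: eq_bigr => j _.
  by case: (s j); rewrite /= mul1r mul0r ?subr0 ?sub0r.
rewrite E mulr_natl mulr2n; apply: le_trans (tailB _ _ _ _ _) _.
rewrite mulr_natl mulr2n; apply: lerD => //; exact: (subset_sums (fun j => ~~ s j)).
Qed.

(** By [rademacher_lower] a large square sum makes a twelfth of the signed sums
    large. *)
Lemma square_sum_bounded : pr P [set w | 8 * lambda ^+ 2 < Q w] <= 24 * eta.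
Proof.
have hp : is_prob (fun=> 2^-1 : R) := is_prob_half.
have mB : measurable [set w | 8 * lambda ^+ 2 < Q w].
  rewrite (_ : [set _ | _] = Q @^-1` `]8 * lambda ^+ 2, +oo[).
    by rewrite -[X in measurable X]setTI; exact: mQ.
  by apply/seteqP; split => w /=; rewrite in_itv /= andbT.
pose S (s : nat -> bool) w := \sum_(j < n) (if s j then x j w else - x j w).
have mS s : measurable_fun setT (S s).
  by apply: measurable_sum => j; case: (s j) => //; exact: measurable_funN.
have := @avg_pr_ge _ _ _ P (fun=> 2^-1) n (fun s => [set w | 2 * lambda < `|S s w|])
  _ 12^-1 is_prob_half (fun s => measurable_gt_norm _ (mS s)) mB.
rewrite invr_ge0 ler0n => /(_ isT) H.
have {}H : 12^-1 * pr P [set w | 8 * lambda ^+ 2 < Q w] <= 2 * eta.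
  apply: le_trans (H _) _.
    move=> w /= wB; apply: le_trans (rademacher_lower (x := fun j => x j w) (erefl (Q w))) _.
    apply: avg_le => // s; case: (leP (Q w / 2)) => [h|_]; last by rewrite indicE ler0n.
    rewrite indicE mem_set //=.
    have p0 : 0 < 2 * lambda by rewrite mulr_gt0.
    rewrite ltNge; apply/negP => h2.
    have : `|S s w| ^+ 2 <= (2 * lambda) ^+ 2 by rewrite lerXn2r ?nnegrE // ltW.
    rewrite real_normK ?num_real // /S; move: h wB.
    have -> : (2 * lambda) ^+ 2 = 4 * lambda ^+ 2 by ring.
    lra.
  rewrite -[leRHS](avg_cst (fun=> 2^-1) n); apply: avg_le => // s.
  exact: tail_signed_sum.
lra.
Qed.

(** Select each index [j] with probability [a j]. The selected sum has the convex
    combination as its mean, and its variance is at most a quarter of the square sum, so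
    by Chebyshev's inequality half of the selected sums are within [2 * lambda] of it. *)
Lemma tail_convex_hull (a : nat -> R) : is_prob a ->
  tail P (fun w => \sum_(j < n) a j * x j w) (3 * lambda) <= 26 * eta.
Proof.
move=> a01.
pose B := [set w | 3 * lambda < `|\sum_(j < n) a j * x j w|] `&`
          [set w | Q w <= 8 * lambda ^+ 2].
have mB : measurable B.
  apply: measurableI; first exact: measurable_gt_norm.
  rewrite (_ : [set _ | _] = Q @^-1` `]-oo, 8 * lambda ^+ 2]).
    by rewrite -[X in measurable X]setTI; exact: mQ.
  by apply/seteqP; split => w /=; rewrite in_itv.
have := @avg_pr_ge _ _ _ P a n (fun s => [set w | lambda < `|\sum_(j < n) (s j)%:R * x j w|])
  B 2^-1 a01 (fun s => measurable_gt_norm _ (msum_coef (fun j => (s j)%:R))) mB.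
rewrite invr_ge0 ler0n => /(_ isT) H.
have {}H : 2^-1 * pr P B <= eta.
  apply: le_trans (H _) _.
    move=> w /= [/= wB QB].
    pose y j := x j w.
    have V : variance a y n <= 2 * lambda ^+ 2.
      apply: (@le_trans _ _ (\sum_(j < n) 4^-1 * x j w ^+ 2)); last first.
        by rewrite -mulr_sumr -/(Q w); lra.
      apply: ler_sum => j _; apply: ler_wpM2r; first exact: sqr_ge0.
      by have := sqr_ge0 (a j - 2^-1); lra.
    have l2 : 0 < 4 * lambda ^+ 2 by rewrite mulr_gt0 // exprn_gt0.
    have M := @avg_markov R a n (fun s => centered a y n s ^+ 2) _ a01 l2
      (fun s => sqr_ge0 _).
    rewrite avg_centered2 in M.
    have M2 : variance a y n / (4 * lambda ^+ 2) <= 2^-1.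
      rewrite ler_pdivrMr //; lra.
    apply: (@le_trans _ _ (avg a n (fun s => 1 - (4 * lambda ^+ 2 <= centered a y n s ^+ 2)%R%:R))).
      by rewrite avgB avg_cst; lra.
    apply: avg_le => // s; case: (leP (4 * lambda ^+ 2)) => h; first by rewrite subrr indicE ler0n.
    rewrite indicE mem_set ?subr0 //=.
    have E : \sum_(j < n) (s j)%:R * x j w =
       \sum_(j < n) a j * x j w + centered a y n s.
      by rewrite -big_split /=; apply: eq_bigr => j _; rewrite /y; ring.
    have h2 : `|centered a y n s| < 2 * lambda.
      rewrite ltNge; apply/negP => h2; move: h; apply/negP; rewrite -leNgt.
      rewrite -[leRHS]real_normK ?num_real //.
      have -> : 4 * lambda ^+ 2 = (2 * lambda) ^+ 2 by ring.
      by rewrite lerXn2r ?nnegrE // mulr_ge0 // ltW.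
    rewrite E; have := lerB_normD (\sum_(j < n) a j * x j w) (centered a y n s).
    lra.
  by rewrite -[leRHS](avg_cst a n); apply: avg_le.
have -> : 26 * eta = 2 * eta + 24 * eta by ring.
apply: pr_le_add _ square_sum_bounded; last by lra.
move=> w /= h; have [h2|h2] := leP (Q w) (8 * lambda ^+ 2); first by left.
by right.
Qed.

(** Positive and negative parts of the coefficients. *)
Lemma tail_symmetric_hull (a : nat -> R) : (forall j, -1 <= a j <= 1) ->
  tail P (fun w => \sum_(j < n) a j * x j w) (6 * lambda) <= 52 * eta.
Proof.
move=> a1.
have p1 : is_prob (fun j => Num.max 0 (a j)).
  by move=> j; rewrite le_max lexx ge_max ler01 /=; have /andP[] := a1 j.
have p2 : is_prob (fun j => Num.max 0 (- a j)).
  by move=> j; rewrite le_max lexx ge_max ler01 /=; have /andP[] := a1 j; lra.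
have E : (fun w => \sum_(j < n) a j * x j w) =
    (fun w => \sum_(j < n) Num.max 0 (a j) * x j w -
              \sum_(j < n) Num.max 0 (- a j) * x j w).
  apply: funext => w; rewrite -sumrB; apply: eq_bigr => j _; rewrite -mulrBl.
  congr (_ * _); rewrite /Num.max; case: ltP => h1; case: ltP => h2; lra.
rewrite E; have -> : 6 * lambda = 3 * lambda + 3 * lambda by ring.
have -> : 52 * eta = 26 * eta + 26 * eta by ring.
apply: le_trans (tailB _ _ _ _ _) _.
by apply: lerD; [exact: (tail_convex_hull p1)|exact: (tail_convex_hull p2)].
Qed.

End bounded_subset_sums.

(** * Stochastic measures *)

Section stochastic_measures.
Context {d} {Omega : measurableType d} {R : realType}.
Variable P : probability Omega R.
Context {d'} {S : measurableType d'}.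
Variables (D : set S) (mu : set S -> {RV P >-> R}).
Hypothesis mD : measurable D.
Hypothesis mu_sm : stochastic_measure D mu.
Implicit Types (A B C : set S) (xi zeta : Omega -> R).

Notation small := (small P).
Notation tail := (tail P).
Notation aeq := (aeq P).

Definition meas_in A := measurable A /\ A `<=` D.

Lemma meas_in0 : meas_in set0. Proof. by split. Qed.
Lemma meas_inU A B : meas_in A -> meas_in B -> meas_in (A `|` B).
Proof. by move=> [? ?] [? ?]; split; [exact: measurableU|rewrite subUset]. Qed.
Lemma meas_inI A B : meas_in A -> measurable B -> meas_in (A `&` B).
Proof. by move=> [? h] ?; split; [exact: measurableI|apply: subIset; left]. Qed.
Lemma meas_inD A B : meas_in A -> measurable B -> meas_in (A `\` B).
Proof. by move=> ? ?; rewrite setDE; apply: meas_inI => //; exact: measurableC. Qed.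

Lemma msum (I : Type) (r : seq I) (f : I -> Omega -> R) :
  (forall i, measurable_fun setT (f i)) ->
  measurable_fun setT (fun w => \sum_(i <- r) f i w).
Proof. by move=> mf; apply: measurable_sum. Qed.

(** Convergence in probability, as a statement about the Ky Fan distance. *)
Lemma sm_small (A : nat -> set S) : (forall n, meas_in (A n)) ->
  trivIset setT A -> forall e, 0 < e -> exists N, forall n, (N <= n)%N ->
  small e (fun w => \sum_(0 <= k < n) mu (A k) w - mu (\bigcup_n A n) w).
Proof.
move=> mA tA; apply: cvg_in_probability_small => //.
  by move=> n; apply: msum.
exact: mu_sm.
Qed.

(** The terms of a convergent series tend to zero. *)
Lemma sm_exhaustive (A : nat -> set S) : (forall n, meas_in (A n)) ->
  trivIset setT A -> forall e, 0 < e -> exists N, forall n, (N <= n)%N ->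
  small e (mu (A n)).
Proof.
move=> mA tA e e0; have e2 : 0 < e / 2 by rewrite divr_gt0.
have [N HN] := sm_small mA tA e2.
exists N => n Nn; rewrite [e]splitr.
apply: aeq_small (smallB (HN n.+1 (leqW Nn)) (HN n Nn)).
by apply: aeq_eq => w; rewrite big_nat_recr //=; ring.
Qed.

Lemma sm0 : aeq (mu set0) (fun=> 0).
Proof.
apply: small_aeq0 => e e0.
have [|N HN] := sm_exhaustive (fun=> meas_in0) _ e0; last exact: HN (leqnn N).
by apply/trivIsetP => i j _ _ _; rewrite set0I.
Qed.

Lemma smU A B : meas_in A -> meas_in B -> A `&` B = set0 ->
  aeq (mu (A `|` B)) (fun w => mu A w + mu B w).
Proof.
move=> mA mB AB.
have tAB : trivIset setT (bigcup2 A B).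
  by apply/trivIsetP => -[|[|i]] [|[|j]] _ _ //= _; rewrite ?set0I ?setI0 // setIC.
have mAB n : meas_in (bigcup2 A B n) by case: n => [|[|n]] //=; exact: meas_in0.
have E n : aeq (fun w => \sum_(0 <= k < n.+2) mu (bigcup2 A B k) w)
    (fun w => mu A w + mu B w).
  elim: n => [|n IH]; first by apply: aeq_eq => w; rewrite !big_nat_recl // big_geq //= addr0.
  by apply: (aeq_le2 IH sm0) => w h1 h2; rewrite big_nat_recr // h1 /= h2 addr0.
suff h : aeq (fun w => (mu A w + mu B w) - mu (A `|` B) w) (fun=> 0).
  by apply: (aeq_le h) => w /eqP; rewrite subr_eq0 => /eqP.
apply: small_aeq0 => e e0; have [N HN] := sm_small mAB tAB e0.
rewrite bigcup2E in HN.
by apply: aeq_small (HN N.+2 (leqW (leqW (leqnn N)))); apply: aeqB => //; exact: aeq_refl.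
Qed.

Lemma smD A B : meas_in A -> meas_in B -> B `<=` A ->
  aeq (mu (A `\` B)) (fun w => mu A w - mu B w).
Proof.
move=> mA mB BA; have := smU (meas_inD mA mB.1) mB _.
rewrite setDKI setUC setDUK // => /(_ erefl) h.
by apply: (aeq_le h) => w ->; ring.
Qed.

Lemma sm_split A B : meas_in A -> measurable B ->
  aeq (mu A) (fun w => mu (A `&` B) w + mu (A `\` B) w).
Proof.
move=> mA mB; rewrite -[in X in aeq X _](setUIDK A B).
apply: smU; [exact: meas_inI|exact: meas_inD|].
by rewrite setDE setIACA setICr setI0.
Qed.

Lemma sm_bigU n (A : nat -> set S) : (forall j, meas_in (A j)) ->
  (forall i j, (i < n)%N -> (j < n)%N -> i != j -> A i `&` A j = set0) ->
  aeq (mu (\big[setU/set0]_(j < n) A j)) (fun w => \sum_(j < n) mu (A j) w).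
Proof.
move=> mA; elim: n => [_|n IH tA].
  by rewrite big_ord0; under [X in aeq _ X]eq_fun do rewrite big_ord0; exact: sm0.
rewrite big_ord_recr /=; under [X in aeq _ X]eq_fun do rewrite big_ord_recr /=.
have mU k : meas_in (\big[setU/set0]_(j < k) A j).
  elim: k => [|k IHk]; first by rewrite big_ord0; exact: meas_in0.
  by rewrite big_ord_recr /=; exact: meas_inU.
apply: aeq_trans (smU (mU n) (mA n) _) _.
  rewrite big_distrl big1 //= => i _; apply: tA => //.
    exact: ltnW (ltn_ord i).
  by rewrite neq_ltn ltn_ord.
apply: aeqD; last exact: aeq_refl.
by apply: IH => i j ni nj; apply: tA; exact: ltnW.
Qed.

Lemma bigcupD_shrink (B : nat -> set S) : (forall n, B n.+1 `<=` B n) ->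
  \bigcap_n B n = set0 -> \bigcup_n (B n `\` B n.+1) = B 0%N.
Proof.
move=> dB B0; apply/seteqP; split => x.
  have B0n n : B n `<=` B 0%N by elim: n => // n IH; exact: subset_trans (dB n) IH.
  by move=> [n _ [/B0n]].
move=> B0x; apply: contrapT => nx.
have : (\bigcap_n B n) x; last by rewrite B0.
move=> n _; elim: n => // n IH; apply: contrapT => nB; apply: nx.
by exists n.
Qed.

Lemma shrink_le (B : nat -> set S) : (forall n, B n.+1 `<=` B n) ->
  forall m n, (m <= n)%N -> B n `<=` B m.
Proof.
by move=> dB m n /subnK <-; elim: (n - m)%N => // k IH; exact: subset_trans (dB _) IH.
Qed.

(** The differences [B n `\` B n.+1] partition [B 0], and their partial sums
    telescope. *)
Lemma sm_shrink (B : nat -> set S) : (forall n, meas_in (B n)) ->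
  (forall n, B n.+1 `<=` B n) -> \bigcap_n B n = set0 ->
  forall e, 0 < e -> exists N, forall n, (N <= n)%N -> small e (mu (B n)).
Proof.
move=> mB dB B0 e e0.
have tB : trivIset setT (fun n => B n `\` B n.+1).
  apply/trivIsetP => i j _ _; rewrite neq_ltn => /orP[] ij; apply/seteqP; split => x //=;
    move=> [[Bi nBi] [Bj nBj]].
    by apply: nBi; exact: (shrink_le dB ij).
  by apply: nBj; exact: (shrink_le dB ij).
have mBD n : meas_in (B n `\` B n.+1) by apply: meas_inD => //; exact: (mB _).1.
have [N HN] := sm_small mBD tB e0; exists N => n Nn.
have := smallN (HN n Nn); apply: aeq_small.
rewrite bigcupD_shrink //.
have E k : aeq (fun w => \sum_(0 <= j < k) mu (B j `\` B j.+1) w)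
    (fun w => mu (B 0%N) w - mu (B k) w).
  elim: k => [|k IH]; first by apply: aeq_eq => w; rewrite big_geq // subrr.
  apply: (aeq_le2 IH (smD (mB k) (mB k.+1) (dB k))) => w.
  by rewrite big_nat_recr //= => -> ->; ring.
by apply: (aeq_le (E n)) => w ->; ring.
Qed.

(** Order continuity at the empty set, uniformly over subsets; otherwise the
    differences of suitable subsets of the [B n] would be disjoint sets whose
    measures do not tend to zero. *)
Lemma sm_shrink_uniform (B : nat -> set S) : (forall n, meas_in (B n)) ->
  (forall n, B n.+1 `<=` B n) -> \bigcap_n B n = set0 ->
  forall e, 0 < e -> exists N, forall C, measurable C -> C `<=` B N ->
  small e (mu C).
Proof.
move=> mB dB B0 e e0; apply: contrapT => /forallNP H.
have {}H N : exists C, [/\ measurable C, C `<=` B N & ~ small e (mu C)].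
  have /existsNP[C /not_implyP[mC /not_implyP[CB nC]]] := H N.
  by exists C.
have /choice[C CP] := H.
have mC n : meas_in (C n).
  have [m1 s1 _] := CP n; split => //; apply: subset_trans s1 _; exact: (mB n).2.
have e2 : 0 < e / 2 by rewrite divr_gt0.
have {}H n : exists m, (n < m)%N /\ ~ small (e / 2) (mu (C n `\` B m)).
  have mCB k : meas_in (C n `&` B k) by apply: meas_inI => //; exact: (mB k).1.
  have dCB k : C n `&` B k.+1 `<=` C n `&` B k by apply: setIS; exact: dB.
  have CB0 : \bigcap_k (C n `&` B k) = set0.
    apply/seteqP; split => x // h.
    have : (\bigcap_n B n) x by move=> k _; have [] := h k I.
    by rewrite B0.
  have [M HM] := sm_shrink mCB dCB CB0 e2.
  exists (maxn M n.+1); rewrite leq_maxr; split => // sm.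
  have [_ _] := CP n; apply; rewrite [e]splitr.
  apply: aeq_small (smallD (HM _ (leq_maxl M n.+1)) sm).
  by apply: aeq_sym; apply: sm_split => //; exact: (mB _).1.
have /choice[f fP] := H.
pose g := fix g n := if n is n'.+1 then f (g n') else 0%N.
have gn n : (g n < g n.+1)%N by have [] := fP (g n).
have gmn m n : (m < n)%N -> (g m.+1 <= g n)%N.
  move=> /subnK <-; elim: (n - m.+1)%N => // k IH.
  by apply: leq_trans IH _; rewrite addSn; exact: ltnW.
have mX n : meas_in (C (g n) `\` B (g n.+1)) by apply: meas_inD => //; exact: (mB _).1.
have tX : trivIset setT (fun n => C (g n) `\` B (g n.+1)).
  apply/trivIsetP => i j _ _; rewrite neq_ltn => /orP[] ij; apply/seteqP; split => x //=;
    move=> [[Bi nBi] [Bj nBj]].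
    apply: nBi; apply: (shrink_le dB (gmn _ _ ij)).
    by have [_ s1 _] := CP (g j); exact: s1.
  apply: nBj; apply: (shrink_le dB (gmn _ _ ij)).
  by have [_ s1 _] := CP (g i); exact: s1.
have [N HN] := sm_exhaustive mX tX e2.
by have := HN N (leqnn N); exact: (fP (g N)).2.
Qed.

(** * Approximation by an algebra of sets *)

(** The error of the approximation of [A] by [V] is that all measurable subsets of
    the symmetric difference have small measure; smallness of the symmetric difference
    alone would not be subadditive. *)
Definition approximable (U : set (set S)) A := measurable A /\
  forall e, 0 < e -> exists2 V, U V & forall C, measurable C ->
    C `<=` D `&` ((A `\` V) `|` (V `\` A)) -> small e (mu C).

Section approximation.
Variable U : set (set S).
Hypothesis U_meas : forall V, U V -> measurable V.
Hypothesis U0 : U set0.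
Hypothesis U_setC : forall V, U V -> U (~` V).
Hypothesis U_setU : forall V W, U V -> U W -> U (V `|` W).

Lemma approximable_sub A : U A -> approximable U A.
Proof.
move=> UA; split; first exact: U_meas.
move=> e e0; exists A => // C mC; rewrite setDv setU0 setI0 subset0 => ->.
by apply: aeq_small (aeq_sym sm0) _; apply: small0; exact: ltW.
Qed.

Lemma approximableC A : approximable U A -> approximable U (~` A).
Proof.
move=> [mA hA]; split; first exact: measurableC.
move=> e e0; have [V UV HV] := hA e e0; exists (~` V); first exact: U_setC.
move=> C mC; rewrite !setDE !setCK => CD; apply: HV => //.
by apply: subset_trans CD _; rewrite !setDE setUC (setIC V) (setIC A).
Qed.

Lemma small_cover e1 e2 C A B : measurable C -> measurable A -> measurable B ->
  C `<=` D -> C `<=` A `|` B ->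
  (forall C', measurable C' -> C' `<=` C `&` A -> small e1 (mu C')) ->
  (forall C', measurable C' -> C' `<=` C `&` B -> small e2 (mu C')) ->
  small (e1 + e2) (mu C).
Proof.
move=> mC mA mB CD CAB h1 h2.
apply: aeq_small (aeq_sym (sm_split (conj mC CD) mA)) (smallD _ _).
  by apply: h1 => //; exact: measurableI.
apply: h2; first exact: measurableD.
by move=> x [Cx nA]; split => //; have [] := CAB _ Cx.
Qed.

Lemma approximableU A B : approximable U A -> approximable U B ->
  approximable U (A `|` B).
Proof.
move=> [mA hA] [mB hB]; split; first exact: measurableU.
move=> e e0; have e2 : 0 < e / 2 by rewrite divr_gt0.
have [V UV HV] := hA _ e2; have [W UW HW] := hB _ e2.
exists (V `|` W); first exact: U_setU.
move=> C mC CD; rewrite [e]splitr.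
apply: (@small_cover _ _ C ((A `\` V) `|` (V `\` A)) ((B `\` W) `|` (W `\` B))) => //.
- by apply: measurableU; apply: measurableD => //; exact: U_meas.
- by apply: measurableU; apply: measurableD => //; exact: U_meas.
- by move=> x /CD [].
- move=> x /CD [_ [[[Ax|Bx] /not_orP[nV nW]]|[[Vx|Wx] /not_orP[nA nB]]]].
  + by left; left.
  + by right; left.
  + by left; right.
  + by right; right.
- move=> C' mC' s; apply: HV => // x /s [/CD [Dx _] h]; by split.
- move=> C' mC' s; apply: HW => // x /s [/CD [Dx _] h]; by split.
Qed.

Lemma approximable_bigU n (A : nat -> set S) : (forall k, approximable U (A k)) ->
  approximable U (\big[setU/set0]_(k < n) A k).
Proof.
move=> hA; elim: n => [|n IH]; first by rewrite big_ord0; exact: approximable_sub.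
by rewrite big_ord_recr; exact: approximableU.
Qed.

Lemma approximable_bigcup (A : nat -> set S) : (forall k, approximable U (A k)) ->
  approximable U (\bigcup_k A k).
Proof.
move=> hA; have mA k : measurable (A k) := (hA k).1.
split; first exact: bigcupT_measurable.
move=> e e0; have e2 : 0 < e / 2 by rewrite divr_gt0.
pose B n := D `&` (\bigcup_k A k `\` \big[setU/set0]_(k < n) A k).
have mU n : measurable (\big[setU/set0]_(k < n) A k) by exact: bigsetU_measurable.
have mB n : meas_in (B n).
  by split; [apply: measurableI => //; apply: measurableD => //; exact: bigcupT_measurable
            |exact: subIsetl].
have dB n : B n.+1 `<=` B n.
  by apply: setIS; apply: setDS; rewrite big_ord_recr /=; exact: subsetUl.
have B0 : \bigcap_n B n = set0.
  apply/seteqP; split => x // h; have [_ [[k _ Ak] _]] := h 0%N I.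
  have [_ [_]] := h k.+1 I; apply; rewrite big_ord_recr /=; by right.
have [N HN] := sm_shrink_uniform mB dB B0 e2.
have [_ /(_ _ e2)[V UV HV]] := approximable_bigU N hA.
exists V => // C mC CD; rewrite [e]splitr.
have mV := U_meas UV.
apply: (@small_cover _ _ C (B N) ((\big[setU/set0]_(k < N) A k `\` V) `|` (V `\` \big[setU/set0]_(k < N) A k))) => //.
- exact: (mB N).1.
- by apply: measurableU; apply: measurableD.
- by move=> x /CD [].
- move=> x /CD [Dx [[Ax nV]|[Vx nA]]].
    have [h|h] := pselect ((\big[setU/set0]_(k < N) A k) x); first by right; left.
    by left.
  right; right; split => // h; apply: nA.
  by rewrite -bigcup_mkord in h; case: h => k _ Ak; exists k.
- by move=> C' mC' s; apply: HN => //; apply: subset_trans s _; exact: subIsetr.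
- move=> C' mC' s; apply: HV => // x /s [/CD [Dx _] h]; by split.
Qed.

Lemma approximable_sigma A : <<s U >> A -> approximable U A.
Proof.
apply: smallest_sub; last by move=> V; exact: approximable_sub.
split.
- exact: approximable_sub.
- by move=> B hB; rewrite setTD; exact: approximableC.
- exact: approximable_bigcup.
Qed.

(** The approximable sets form a sigma-algebra, so boundedness in probability
    passes from an algebra to the sigma-algebra which it generates. *)
Lemma tail_sigma (lambda eta : R) :
  (forall V, U V -> tail (mu (D `&` V)) lambda <= eta) ->
  forall A, <<s U >> A -> forall e, 0 < e ->
  tail (mu (D `&` A)) (lambda + e) <= eta + e.
Proof.
move=> hU A /approximable_sigma [mA hA] e e0.
have e2 : 0 < e / 2 by rewrite divr_gt0.
have [V UV HV] := hA _ e2; have mV := U_meas UV.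
have mDV : meas_in (D `&` V) by split; [exact: measurableI|exact: subIsetl].
have mDA : meas_in (D `&` A) by split; [exact: measurableI|exact: subIsetl].
have E : aeq (mu (D `&` A)) (fun w => mu (D `&` V) w +
    (mu ((D `&` A) `\` V) w - mu ((D `&` V) `\` A) w)).
  have h1 := sm_split mDA mV; have h2 := sm_split mDV mA.
  rewrite [D `&` V `&` A]setIAC in h2.
  by apply: (aeq_le2 h1 h2) => w -> ->; ring.
rewrite (aeq_tail _ E); apply: le_trans (tailD _ _ _ _ _) _.
apply: lerD; first exact: hU.
rewrite [e]splitr; apply: smallB; apply: HV.
- exact: measurableD mDA.1 _.
- by move=> x [[Dx Ax] nV]; split => //; left.
- exact: measurableD mDV.1 _.
- by move=> x [[Dx Vx] nA]; split => //; right.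
Qed.

End approximation.

(** The sums over subfamilies of the disjoint sets [E j] are the values of [mu] on their
    unions, so [tail_symmetric_hull] applies. *)
Lemma tail_simple_sum n (E : nat -> set S) (a : nat -> R) (lambda eta : R) :
  0 < lambda -> (forall A, meas_in A -> tail (mu A) lambda <= eta) ->
  (forall j, meas_in (E j)) ->
  (forall i j, (i < n)%N -> (j < n)%N -> i != j -> E i `&` E j = set0) ->
  (forall j, -1 <= a j <= 1) ->
  tail (fun w => \sum_(j < n) a j * mu (E j) w) (6 * lambda) <= 52 * eta.
Proof.
move=> l0 hb mE tE a1; apply: (tail_symmetric_hull (x := fun j => mu (E j)) _ l0 _ a1) => // s.
pose F j := if s j then E j else set0.
have mF j : meas_in (F j) by rewrite /F; case: ifP => // _; exact: meas_in0.
rewrite (aeq_tail _ (zeta := mu (\big[setU/set0]_(j < n) F j))).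
  apply: hb; elim: (n) => [|k IHk]; first by rewrite big_ord0; exact: meas_in0.
  by rewrite big_ord_recr /=; exact: meas_inU.
have tF i j : (i < n)%N -> (j < n)%N -> i != j -> F i `&` F j = set0.
  by rewrite /F => *; case: ifP => _; case: ifP => _; rewrite ?set0I ?setI0 // tE.
apply: aeq_trans (aeq_sym (sm_bigU mF tF)).
apply: aeq_sum => j _; rewrite /F; case: (s j).
  by apply: aeq_eq => w; rewrite mul1r.
by apply: aeq_trans (aeq_sym sm0); apply: aeq_eq => w; rewrite mul0r.
Qed.

End stochastic_measures.

(** * Dyadic step functions *)

Lemma sum_pairs (V : zmodType) (F : nat -> V) n m :
  \sum_(q < n * m) F q = \sum_(j < n) \sum_(c < m) F (j * m + c)%N.
Proof.
elim: n => [|n IH]; first by rewrite !big_ord0.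
by rewrite mulSnr big_split_ord /= IH big_ord_recr.
Qed.

Section dyadic_steps.
Context {R : realType}.
Variable T : R.
Hypothesis T_gt0 : 0 < T.
Implicit Types (g h : R -> R) (s : nat -> bool).

Definition pt (i j : nat) : R := T * (j%:R / 2 ^+ i).

Lemma pt_lt i j k : (j < k)%N -> pt i j < pt i k.
Proof.
by move=> jk; rewrite /pt ltr_pM2l // ltr_pM2r ?invr_gt0 ?exprn_gt0 // ltr_nat.
Qed.

Lemma pt_le i j k : (j <= k)%N -> pt i j <= pt i k.
Proof. by rewrite leq_eqVlt => /predU1P[->//|/(pt_lt i)/ltW]. Qed.

Lemma pt0 i : pt i 0 = 0. Proof. by rewrite /pt mul0r mulr0. Qed.

Lemma pt_end i : pt i (2 ^ i) = T.
Proof. by rewrite /pt natrX divff ?mulr1 // expf_neq0. Qed.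

Lemma pt_ge0 i j : 0 <= pt i j.
Proof. by rewrite -(pt0 i); exact: pt_le. Qed.

Lemma pt_gt0 i j : 0 < pt i j.+1.
Proof. by rewrite -(pt0 i); exact: pt_lt. Qed.

Lemma pt_leT i j : (j <= 2 ^ i)%N -> pt i j <= T.
Proof. by move=> ji; rewrite -(pt_end i); exact: pt_le. Qed.

Lemma pt_refine i j k : pt (i + k) (j * 2 ^ k) = pt i j.
Proof. by rewrite /pt natrM natrX exprD; field; rewrite !expf_neq0. Qed.

Lemma pt_step i j : pt i j.+1 - pt i j = T / 2 ^+ i.
Proof. by rewrite /pt -mulrBr -mulrBl -natrB // subSnn mul1r. Qed.

(** The index of the cell [`]pt i j, pt i j.+1]] which contains a point. *)
Definition cell (i : nat) (t : R) : nat := (`|Num.ceil (t / T * 2 ^+ i)|%N).-1.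

Lemma cellE i j t : pt i j < t <= pt i j.+1 -> cell i t = j.
Proof.
rewrite /pt => /andP[h1 h2]; have e2 : 0 < 2 ^+ i :> R by rewrite exprn_gt0.
have {}h1 : j%:R < t / T * 2 ^+ i.
  by rewrite -ltr_pdivrMr // ltr_pdivlMr // mulrC.
have {}h2 : t / T * 2 ^+ i <= j.+1%:R.
  by rewrite -ler_pdivlMr // ler_pdivrMr // mulrC.
rewrite /cell (_ : Num.ceil _ = j.+1%:Z) //.
by apply/eqP; rewrite ceil_eq -{1}(addn1 j) PoszD addrK h1.
Qed.

Lemma cell_pt i j : cell i (pt i j.+1) = j.
Proof. by apply: cellE; rewrite lexx andbT; exact: pt_lt. Qed.

Lemma cell_bounds i t : 0 < t <= T ->
  (cell i t < 2 ^ i)%N /\ pt i (cell i t) < t <= pt i (cell i t).+1.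
Proof.
move=> /andP[t0 tT]; have e2 : 0 < 2 ^+ i :> R by rewrite exprn_gt0.
set u := t / T * 2 ^+ i.
have u0 : 0 < u by rewrite mulr_gt0 // divr_gt0.
have ui : u <= 2 ^+ i by rewrite ger_pMl // ler_pdivrMr // mul1r.
have c0 : (0 < Num.ceil u)%R by rewrite ceil_gt0.
have [n cn] : exists n, Num.ceil u = n.+1%:Z.
  by case: (Num.ceil u) c0 => // -[//|n] _; exists n.
have cE : cell i t = n by rewrite /cell -/u cn.
have /andP[h1 h2] := ceil_itv u; rewrite cn in h1 h2.
rewrite -{1}(addn1 n) PoszD addrK in h1.
rewrite cE; split.
  rewrite -(ltr_nat R) natrX; apply: lt_le_trans ui.
  exact: h1.
have tE : t = T * (u / 2 ^+ i) by rewrite /u; field; rewrite !gt_eqF.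
rewrite {1 2}tE /pt ltr_pM2l // ler_pM2l // ltr_pM2r ?invr_gt0 // ler_pM2r ?invr_gt0 //.
by rewrite h2 andbT; exact: h1.
Qed.

Lemma cell_coarse i k t : 0 < t <= T -> cell i t = (cell (i + k) t %/ 2 ^ k)%N.
Proof.
move=> t0; have [_ /andP[h1 h2]] := cell_bounds (i + k) t0.
set c := cell (i + k) t in h1 h2 *.
have p2 : (0 < 2 ^ k)%N by rewrite expn_gt0.
apply: cellE; rewrite -!(pt_refine i _ k); apply/andP; split.
  by apply: le_lt_trans h1; apply: pt_le; exact: leq_divM.
by apply: le_trans h2 _; apply: pt_le; exact: ltn_ceil.
Qed.

(** The cells are open on the left, like the intervals [`]0, t]] whose measures are the
    values of the path. *)
Definition dyadic_step (i : nat) h := forall j t, (j < 2 ^ i)%N ->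
  pt i j < t <= pt i j.+1 -> h t = h (pt i j.+1).

Definition dsum (i : nat) h g : R :=
  \sum_(j < 2 ^ i) h (pt i j.+1) * (g (pt i j.+1) - g (pt i j)).

Lemma sum_double (F : nat -> R) n :
  \sum_(j < n * 2) F j = \sum_(j < n) (F (j * 2)%N + F (j * 2).+1).
Proof.
elim: n => [|n IH]; first by rewrite !big_ord0.
by rewrite mulSnr addn2 !big_ord_recr /= IH addrA.
Qed.

Lemma pt_double i j : pt i.+1 (j * 2) = pt i j.
Proof. by rewrite -addn1 -(pt_refine i j 1). Qed.

Lemma dyadic_stepS i h : dyadic_step i h -> dyadic_step i.+1 h.
Proof.
move=> hi j t j2 /andP[t1 t2].
have j2' : (j %/ 2 < 2 ^ i)%N by rewrite ltn_divLR // mulnC -expnS.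
have jd : (j %/ 2 * 2 <= j)%N by exact: leq_divM.
have ju : (j.+1 <= (j %/ 2).+1 * 2)%N by exact: ltn_ceil.
rewrite (hi (j %/ 2)%N t j2'); last first.
  rewrite -(pt_double i (j %/ 2)) -(pt_double i (j %/ 2).+1); apply/andP; split.
    by apply: le_lt_trans t1; exact: pt_le.
  by apply: le_trans t2 _; exact: pt_le.
rewrite (hi (j %/ 2)%N (pt i.+1 j.+1) j2') //.
rewrite -(pt_double i (j %/ 2)) -(pt_double i (j %/ 2).+1); apply/andP; split.
  by apply: pt_lt; rewrite ltnS.
exact: pt_le.
Qed.

Lemma dsumS i h g : dyadic_step i h -> dsum i.+1 h g = dsum i h g.
Proof.
move=> hi; rewrite /dsum expnS mulnC (sum_double (fun j =>
  h (pt i.+1 j.+1) * (g (pt i.+1 j.+1) - g (pt i.+1 j)))).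
apply: eq_bigr => j _.
have -> : pt i.+1 (j * 2).+2 = pt i j.+1 by rewrite -(pt_double i j.+1) mulSnr addn2.
rewrite (hi j (pt i.+1 (j * 2).+1) (ltn_ord j)) ?pt_double; first by ring.
rewrite -(pt_double i j) -(pt_double i j.+1); apply/andP; split; first exact: pt_lt.
by apply: pt_le; rewrite mulSnr addn2.
Qed.

Lemma dyadic_step_le i l h : (i <= l)%N -> dyadic_step i h -> dyadic_step l h.
Proof. by move=> /subnK <- hi; elim: (l - i)%N => // n; exact: dyadic_stepS. Qed.

Lemma dsum_le i l h g : (i <= l)%N -> dyadic_step i h -> dsum l h g = dsum i h g.
Proof.
move=> /subnK <- hi; elim: (l - i)%N => // n IH.
by rewrite addSn dsumS //; apply: dyadic_step_le hi; exact: leq_addl.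
Qed.

(** The integral with respect to the increments of [g]. It is computed at some level
    at which [h] is a step function, so that the level is not part of its type. *)
Definition step_integral g h : R := dsum (xget 0%N [set i | dyadic_step i h]) h g.

Lemma step_integralE i g h : dyadic_step i h -> step_integral g h = dsum i h g.
Proof.
move=> hi; rewrite /step_integral; set l := xget _ _.
have hl : dyadic_step l h by rewrite /l; case: xgetP => [k _ //|/(_ i)]; exact.
rewrite -(dsum_le g (leq_maxl i l) hi) -(dsum_le g (leq_maxr i l) hl) //.
Qed.

Definition restrict_to (i : nat) s h (t : R) : R := if s (cell i t) then h t else 0.

Lemma dyadic_step_restrict i l s h : (i <= l)%N -> dyadic_step l h ->
  dyadic_step l (restrict_to i s h).
Proof.
move=> il hl j t jl tj; rewrite /restrict_to (hl _ _ jl tj).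
have t0 : 0 < t <= T.
  case/andP: tj => t1 t2; rewrite (le_lt_trans (pt_ge0 l j) t1) /=.
  by apply: le_trans t2 _; exact: pt_leT.
have p0 : 0 < pt l j.+1 <= T by rewrite pt_gt0 pt_leT.
by rewrite -(subnKC il) !(cell_coarse i (l - i)) // subnKC // cell_pt (cellE tj).
Qed.

Lemma step_integral_restrict i s h g : (exists l, dyadic_step l h) ->
  step_integral g (restrict_to i s h) =
  \sum_(j < 2 ^ i) (s j)%:R * step_integral g (restrict_to i (pred1 (j : nat)) h).
Proof.
move=> [l0 hl0]; pose l := maxn i l0.
have il : (i <= l)%N by exact: leq_maxl.
have hl : dyadic_step l h by apply: dyadic_step_le hl0; exact: leq_maxr.
rewrite (step_integralE _ (dyadic_step_restrict s il hl)).
under eq_bigr do rewrite (step_integralE _ (dyadic_step_restrict _ il hl)) mulr_sumr.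
rewrite exchange_big /=; apply: eq_bigr => c _.
have p0 : 0 < pt l c.+1 <= T by rewrite pt_gt0 pt_leT.
have [ci _] := cell_bounds i p0.
rewrite (bigD1 (Ordinal ci)) //= big1 ?addr0.
  by rewrite /restrict_to /= eqxx; case: (s _); rewrite ?mul1r ?mul0r.
move=> j ne; rewrite /restrict_to /= ifF ?mul0r ?mulr0 //.
by apply/eqP => e; move/negP: ne; apply; apply/eqP/val_inj.
Qed.

Lemma eq_step_integral l g h h' : dyadic_step l h -> dyadic_step l h' ->
  (forall t, 0 < t <= T -> h t = h' t) -> step_integral g h = step_integral g h'.
Proof.
move=> hl hl' e; rewrite (step_integralE _ hl) (step_integralE _ hl').
by apply: eq_bigr => j _; rewrite e // pt_gt0 pt_leT.
Qed.

(** The integral over a cell is the sum of the integrals over its parts of a finer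
    level. *)
Lemma step_integral_refine i k j h g : (exists l, dyadic_step l h) ->
  step_integral g (restrict_to i (pred1 j) h) =
  \sum_(c < 2 ^ (i + k)) (c %/ 2 ^ k == j)%N%:R *
     step_integral g (restrict_to (i + k) (pred1 (c : nat)) h).
Proof.
move=> [l0 hl0]; pose l := maxn (i + k) l0.
have hl : dyadic_step l h by apply: dyadic_step_le hl0; exact: leq_maxr.
have ikl : (i + k <= l)%N by exact: leq_maxl.
rewrite -(step_integral_restrict (i + k) (fun c => c %/ 2 ^ k == j)%N); last by exists l0.
apply: (@eq_step_integral l).
- by apply: dyadic_step_restrict => //; apply: leq_trans ikl; exact: leq_addr.
- exact: dyadic_step_restrict.
- by move=> t t0; rewrite /restrict_to /= (cell_coarse i k).
Qed.

(** At finer levels a step function takes the same finitely many values. *)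
Lemma dyadic_step_bounded i h : dyadic_step i h ->
  exists2 K, 0 < K & forall l j, (i <= l)%N -> (j < 2 ^ l)%N -> `|h (pt l j.+1)| <= K.
Proof.
move=> hi; exists (1 + \sum_(j < 2 ^ i) `|h (pt i j.+1)|).
  by apply: ltr_pwDl => //; exact: sumr_ge0.
move=> l j il jl; have p0 : 0 < pt l j.+1 <= T by rewrite pt_gt0 pt_leT.
have [c1 c2] := cell_bounds i p0.
rewrite (hi _ _ c1 c2) (bigD1 (Ordinal c1)) //=.
rewrite addrCA lerDl addr_ge0 // sumr_ge0 //.
Qed.

End dyadic_steps.

(** * Thinning *)

Lemma sum_pigeonhole (R : realType) n (F : nat -> R) (N : R) : (0 < n)%N ->
  N * n%:R <= \sum_(c < n) F c -> exists2 c, (c < n)%N & N <= F c.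
Proof.
move=> n0 H; apply: contrapT => h.
have {}h (c : 'I_n) : F c < N.
  by rewrite ltNge; apply/negP => Nc; apply: h; exists c.
have : \sum_(c < n) F c < \sum_(c < n) N.
  by apply: ltr_sum => //; apply/hasP; exists (Ordinal n0).
by rewrite sumr_const card_ord -mulr_natr ltNge H.
Qed.

Section thinning.
Context {d} {Omega : measurableType d} {R : realType}.
Variable P : probability Omega R.
Variable T : R.
Hypothesis T_gt0 : 0 < T.
Variable mt : R -> Omega -> R.
Hypothesis mmt : forall t, measurable_fun setT (mt t).
Variable M : R -> R.
Hypothesis M_incr : forall i j, M (pt T i j) <= M (pt T i j.+1).
Variable HH : (R -> R) -> Prop.
Implicit Types (h : R -> R) (s E : nat -> bool).

Definition path_integral h (w : Omega) : R := step_integral T (mt^~ w) h.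
(** When [M] is the distribution function of a measure, this is the integral of
    [h ^+ 2] with respect to it. *)
Definition energy h : R := step_integral T M (fun t => h t ^+ 2).

Hypothesis HH_step : forall h, HH h -> exists i, dyadic_step T i h.
Hypothesis HH_restrict : forall i s h, HH h -> HH (restrict_to T i s h).
Hypothesis HH_energy : forall h, HH h -> energy h <= 1.
Hypothesis small_increments : forall kappa e : R, 0 < kappa -> 0 < e ->
  exists i0, forall i, (i0 <= i)%N ->
  pr P [set w | exists2 j, (j < 2 ^ i)%N &
    kappa < `|mt (pt T i j.+1) w - mt (pt T i j) w|] <= e.

Lemma measurable_path_integral h : measurable_fun setT (path_integral h).
Proof.
apply: measurable_sum => j; apply: measurable_funM => //.
exact: measurable_funB.
Qed.

Lemma measurable_exists_lt (n : nat) (A : nat -> set Omega) :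
  (forall j, measurable (A j)) ->
  measurable [set w | exists2 j, (j < n)%N & A j w].
Proof.
move=> mA; rewrite (_ : [set _ | _] = \bigcup_(j in `I_n) A j).
  exact: bigcup_measurable.
by apply/seteqP; split => w /= [j]; exists j.
Qed.

Definition large_cell i E h (N : R) : set Omega :=
  [set w | exists2 j, (j < 2 ^ i)%N &
     (E j && (N <= `|path_integral (restrict_to T i (pred1 j) h) w|))].

Lemma measurable_large_cell i E h N : measurable (large_cell i E h N).
Proof.
apply: measurable_exists_lt => j; case: (E j) => /=.
  exact: measurable_ge_norm (measurable_path_integral _).
by rewrite (_ : (fun=> _) = set0) //; apply/seteqP; split.
Qed.

(** The state that is preserved by thinning. The integral over the whole of [E] would not do:
    it is not monotone in [E], whereas the event [large_cell] is, and it survives a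
    refinement of the grid. *)
Definition unbounded_on (theta : R) i E := forall N, 0 < N ->
  exists2 h, HH h & theta <= pr P (large_cell i E h N).

(** The integral over a cell is a sum of [2 ^ k] integrals over smaller cells, one
    of which is at least the mean. *)
Lemma large_cell_refine i k E h N : HH h ->
  large_cell i E h (N * (2 ^ (i + k))%:R) `<=`
  large_cell (i + k) (fun c => E (c %/ 2 ^ k)%N) h N.
Proof.
move=> /HH_step hs w [j ji /andP[Ej]]; rewrite /path_integral.
rewrite (step_integral_refine T_gt0 _ k) // => H.
have p0 : (0 < 2 ^ (i + k))%N by rewrite expn_gt0.
have [N0|N0] := leP N 0.
  exists (j * 2 ^ k)%N; first by rewrite expnD ltn_pmul2r // expn_gt0.
  by rewrite mulnK ?expn_gt0 // Ej /=; exact: le_trans N0 _.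
pose G (c : nat) := `|(c %/ 2 ^ k == j)%N%:R *
  step_integral T (mt^~ w) (restrict_to T (i + k) (pred1 c) h)|.
have [c cl] := sum_pigeonhole (F := G) p0 (le_trans H (ler_norm_sum _ _ _)).
rewrite /G.
case: eqP => [cj|_].
  by rewrite mul1r => hc; exists c; rewrite // cj Ej.
by rewrite mul0r normr0 leNgt N0.
Qed.

Lemma unbounded_on_refine theta i k E : unbounded_on theta i E ->
  unbounded_on theta (i + k) (fun c => E (c %/ 2 ^ k)%N).
Proof.
move=> H N N0; have [|h Hh Hp] := H (N * (2 ^ (i + k))%:R).
  by rewrite mulr_gt0 // ltr0n expn_gt0.
by exists h => //; apply: le_trans Hp _; apply: pr_le; exact: large_cell_refine.
Qed.

(** A uniformly random family of cells keeps half of the largest integral with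
    probability at least one half, by [random_subset_lower]; some family is as good as
    the average. *)
Lemma unbounded_on_single theta i E N : 0 < theta -> 0 < N ->
  unbounded_on theta i E ->
  exists2 h, HH h & (forall t, h t != 0 -> E (cell T i t)) /\
    theta / 4 < pr P [set w | N <= `|path_integral h w|].
Proof.
move=> th0 N0 /(_ (2 * N)) []; first by rewrite mulr_gt0.
move=> h Hh Hp.
pose y j w := (E j)%:R * path_integral (restrict_to T i (pred1 j) h) w.
have E1 s w : path_integral (restrict_to T i (fun j => s j && E j) h) w =
    \sum_(j < 2 ^ i) (s j)%:R * y j w.
  rewrite /path_integral step_integral_restrict //; last exact: HH_step.
  by apply: eq_bigr => j _; rewrite /y mulrA -natrM mulnb.
have p01 : is_prob (fun=> 2^-1 : R) := is_prob_half.
have := @avg_pr_ge _ _ _ P (fun=> 2^-1) (2 ^ i)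
  (fun s => [set w | N <= `|path_integral (restrict_to T i (fun j => s j && E j) h) w|])
  (large_cell i E h (2 * N)) 2^-1 p01
  (fun s => measurable_ge_norm _ (measurable_path_integral _))
  (measurable_large_cell _ _ _ _).
rewrite invr_ge0 ler0n => /(_ isT) H.
have {}H : theta / 4 < avg (fun=> 2^-1) (2 ^ i)
  (fun s => pr P [set w | N <= `|path_integral (restrict_to T i (fun j => s j && E j) h) w|]).
  apply: lt_le_trans (H _); first lra.
  move=> w [j ji /andP[Ej hj]].
  apply: le_trans (random_subset_lower (fun j => y j w) ji) _.
  apply: avg_le => // s; case: (leP (`|y j w| / 2)) => h1; last by rewrite indicE ler0n.
  rewrite indicE mem_set //= E1; apply: le_trans h1.
  by rewrite /y Ej mul1r; lra.
have [s sP] := avg_gt_exists p01 H.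
exists (restrict_to T i (fun j => s j && E j) h); first exact: HH_restrict.
split => // t; rewrite /restrict_to.
by case: (E _); rewrite ?andbF //= eqxx.
Qed.

Lemma energy_restrict l s h : dyadic_step T l h ->
  energy (restrict_to T l s h) =
  \sum_(c < 2 ^ l) (s c)%:R * (h (pt T l c.+1) ^+ 2 * (M (pt T l c.+1) - M (pt T l c))).
Proof.
move=> hl; have hl2 : dyadic_step T l (fun t => restrict_to T l s h t ^+ 2).
  by move=> j t jl tj; rewrite (dyadic_step_restrict T_gt0 s (leqnn l) hl jl tj).
rewrite /energy (step_integralE T_gt0 _ hl2).
apply: eq_bigr => c _; rewrite /restrict_to cell_pt //.
by case: (s c); rewrite ?mul1r // expr0n /= !mul0r.
Qed.

Lemma path_integral_restrict l s h w : dyadic_step T l h ->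
  path_integral (restrict_to T l s h) w =
  \sum_(c < 2 ^ l) (s c)%:R * (h (pt T l c.+1) * (mt (pt T l c.+1) w - mt (pt T l c) w)).
Proof.
move=> hl; rewrite /path_integral.
rewrite (step_integralE T_gt0 _ (dyadic_step_restrict T_gt0 s (leqnn l) hl)).
apply: eq_bigr => c _; rewrite /restrict_to cell_pt //.
by case: (s c); rewrite ?mul1r // !mul0r.
Qed.

(** After the removal of the event that some increment is not small, this is
    [thinning_lower] at each point. *)
Lemma thinned_large l h (N rho theta : R) : HH h -> dyadic_step T l h ->
  0 < rho <= 2^-1 -> 0 < N -> 1 <= rho * N / 2 ->
  theta <= pr P ([set w | N <= `|path_integral h w|] `\`
    [set w | exists2 c, (c < 2 ^ l)%N &
      rho * N < `|h (pt T l c.+1) * (mt (pt T l c.+1) w - mt (pt T l c) w)|]) ->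
  128^-1 * theta <= avg (fun=> rho) (2 ^ l)
    (fun s => pr P [set w | 1 <= `|path_integral (restrict_to T l s h) w|]).
Proof.
move=> Hh hl rho01 N0 rN Hth.
have p01 : is_prob (fun=> rho) by apply: is_prob_cst; lra.
set B := (X in pr P X) in Hth.
have mB : measurable B.
  apply: measurableD.
    exact: measurable_ge_norm (measurable_path_integral _).
  apply: measurable_exists_lt => c; apply: measurable_gt_norm.
  by apply: measurable_funM => //; exact: measurable_funB.
have := @avg_pr_ge _ _ _ P (fun=> rho) (2 ^ l)
  (fun s => [set w | 1 <= `|path_integral (restrict_to T l s h) w|]) B 128^-1 p01
  (fun s => measurable_ge_norm _ (measurable_path_integral _)) mB.
rewrite invr_ge0 ler0n => /(_ isT) H.
apply: (@le_trans _ _ (128^-1 * pr P B)); first by rewrite ler_wpM2l // invr_ge0.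
apply: H => w [/= Bw nw].
pose x c := h (pt T l c.+1) * (mt (pt T l c.+1) w - mt (pt T l c) w).
have xk j : (j < 2 ^ l)%N -> `|x j| <= rho * N.
  by move=> jl; rewrite leNgt; apply/negP => xj; apply: nw; exists j.
have NX : N <= `|\sum_(j < 2 ^ l) x j|.
  apply: le_trans Bw _.
  by rewrite /path_integral (step_integralE T_gt0 _ hl).
apply: le_trans (thinning_lower rho01 N0 xk (lexx _) NX) _.
apply: avg_le => // s; case: (leP (rho * N / 2)) => h1; last by rewrite indicE ler0n.
rewrite indicE mem_set //=; apply: le_trans rN _.
by rewrite path_integral_restrict.
Qed.

(** Removing a thin random set does not destroy unboundedness: the cell that
    carries the large part survives with probability [1 - rho]. The witness [h] of
    unboundedness must not depend on the random set; as this set has finitely many values,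
    one level [N0] of boundedness serves for all those values for which the remaining
    set has lost the property. *)
Lemma unbounded_after_thinning theta l E (rho delta : R) : 0 < delta ->
  0 <= rho <= 1 -> unbounded_on theta l E ->
  avg (fun=> rho) (2 ^ l) (fun s =>
    (`[< ~ unbounded_on (theta - delta) l (fun c => E c && ~~ s c) >])%:R)
  <= rho / delta.
Proof.
move=> d0 rho01 HE.
have p01 : is_prob (fun=> rho) by exact: is_prob_cst.
pose bad (N : nat) s := `[< forall h, HH h ->
  pr P (large_cell l (fun c => E c && ~~ s c) h N.+1%:R) < theta - delta >].
have bad_mono m n s : (m <= n)%N -> bad m s -> bad n s.
  move=> mn /asboolP bm; apply/asboolP => h Hh; apply: le_lt_trans (bm h Hh).
  apply: pr_le => w [j jl /andP[Ej hj]]; exists j => //; rewrite Ej /=.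
  by apply: le_trans hj; rewrite ler_nat ltnS.
have badE s : exists N0, forall N, (N0 <= N)%N ->
    (bad N s)%:R = (`[< ~ unbounded_on (theta - delta) l (fun c => E c && ~~ s c) >])%:R :> R.
  case: (pselect (exists N0, bad N0 s)) => [[N0 bN0]|nb].
    exists N0 => N NN0; rewrite (bad_mono _ _ _ NN0 bN0); congr (_%:R).
    congr nat_of_bool; apply/esym/asboolP => /(_ N0.+1%:R); rewrite ltr0n => /(_ isT)[h Hh].
    by apply/negP; rewrite -ltNge; move/asboolP: bN0; apply.
  exists 0%N => N _; rewrite (_ : bad N s = false); last first.
    by apply/negP => bN; apply: nb; exists N.
  rewrite asboolF // => nu; apply: nu => K K0.
  apply: contrapT => H; apply: nb; exists (Num.bound K); apply/asboolP => h Hh.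
  rewrite ltNge; apply/negP => H2; apply: H; exists h => //; apply: le_trans H2 _.
  apply: pr_le => w [j jl /andP[Ej hj]]; exists j => //; rewrite Ej /=.
  apply: le_trans hj; apply: ltW; apply: lt_trans (_ : (Num.bound K)%:R < _); last by rewrite ltr_nat.
  by have := archi_boundP (ltW K0).
have [N0 /(_ N0 (leqnn N0)) <-] := avg_eventually (fun=> rho) (2 ^ l) badE.
have [|h Hh HB] := HE N0.+1%:R; first by rewrite ltr0n.
pose B := large_cell l E h N0.+1%:R.
pose B' s := large_cell l (fun c => E c && ~~ s c) h N0.+1%:R.
have mB : measurable B by exact: measurable_large_cell.
have mB' s : measurable (B' s) by exact: measurable_large_cell.
apply: (@le_trans _ _ (avg (fun=> rho) (2 ^ l) (fun s => (delta <= pr P (B `\` B' s))%R%:R))).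
  apply: avg_le => // s; case: (boolP (bad N0 s)) => [/asboolP /(_ h Hh) hb|_]; last by rewrite ler0n.
  suff -> : delta <= pr P (B `\` B' s) by [].
  have : pr P B <= pr P (B' s) + pr P (B `\` B' s).
    apply: le_trans (prU _ _ _); apply: pr_le => w Bw.
    by have [|] := pselect (B' s w); [left|right].
  move: hb HB; rewrite -/(B' s) -/B; lra.
apply: le_trans (avg_markov _ p01 d0 (fun s => pr_ge0 _ _)) _.
rewrite ler_pM2r ?invr_gt0 //; apply: avg_pr_le => //.
  by move=> s; exact: measurableD.
move=> w; have [[c cl /andP[Ec hc]]|nB] := pselect (B w).
  rewrite -[leRHS](avg_bool (fun=> rho) cl); apply: avg_le => // s.
  rewrite indicE ler_nat; case: (boolP (s c)) => sc; first by case: (_ \in _).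
  rewrite memNset // => -[_]; apply; exists c => //.
  by rewrite Ec sc.
rewrite -[leRHS]addr0 -(avg_cst (fun=> rho) (2 ^ l) 0) -[leLHS]add0r lerD //; first by case/andP: rho01.
by apply: avg_le => // s; rewrite indicE memNset // => -[/nB].
Qed.

Lemma avg_energy rho l h : dyadic_step T l h ->
  avg (fun=> rho) (2 ^ l) (fun s => energy (restrict_to T l s h)) = rho * energy h.
Proof.
move=> hl; rewrite (_ : (fun s => _) = (fun s => \sum_(c < 2 ^ l)
  (s c)%:R * (h (pt T l c.+1) ^+ 2 * (M (pt T l c.+1) - M (pt T l c))))); last first.
  by apply: funext => s; exact: energy_restrict.
rewrite (avg_sum _ _ _ (fun c s => (s c)%:R *
  (h (pt T l c.+1) ^+ 2 * (M (pt T l c.+1) - M (pt T l c))))).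
have hl2 : dyadic_step T l (fun t => h t ^+ 2) by move=> j t jl tj; rewrite (hl _ _ jl tj).
rewrite /energy (step_integralE T_gt0 _ hl2) mulr_sumr; apply: eq_bigr => c _.
rewrite -[in RHS](avg_bool (fun=> rho) (ltn_ord c)) [RHS]mulrC -avgZ.
by congr avg; apply: funext => s; rewrite mulrC.
Qed.

Lemma energy_ge0 h : (exists i, dyadic_step T i h) -> 0 <= energy h.
Proof.
move=> [i hi]; have hi2 : dyadic_step T i (fun t => h t ^+ 2).
  by move=> j t jl tj; rewrite (hi _ _ jl tj).
rewrite /energy (step_integralE T_gt0 _ hi2); apply: sumr_ge0 => j _.
by rewrite mulr_ge0 ?sqr_ge0 // subr_ge0.
Qed.

(** One step of the construction. Take [h] on [E] with a very large integral, refine the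
    grid until the increments of the path are small, and keep each cell independently
    with a small probability [rho]. On average the kept part has energy at most [rho] and
    an integral of at least [1] with a probability that does not depend on [rho], and the
    rest of [E] is still unbounded. Hence some choice has the three properties. *)
Lemma thinning_step theta i E (delta gamma : R) : 0 < theta <= 1 ->
  0 < delta <= 1 -> 0 < gamma <= 1 -> unbounded_on theta i E ->
  exists l h E', [/\ HH h, energy h <= gamma,
    theta / 1024 / 4 <= pr P [set w | 1 <= `|path_integral h w|],
    unbounded_on (theta - delta) l E' &
    forall t, 0 < t <= T -> (h t != 0 -> E (cell T i t) && ~~ E' (cell T l t)) /\
      (E' (cell T l t) -> E (cell T i t))].
Proof.
move=> /andP[th0 th1] /andP[d0 d1] /andP[g0 g1] HE.
(* This [rho] makes the bounds [rho / delta] and [rho / gamma] of the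
   two bad events at most a quarter of the gain. *)
pose rho := theta * (delta * gamma) / 1024 / 4.
have dg0 : 0 < delta * gamma by rewrite mulr_gt0.
have tdg0 : 0 < theta * (delta * gamma) by rewrite mulr_gt0.
have dg1 : delta * gamma <= 1 by rewrite mulr_ile1 // ltW.
have tdg1 : theta * (delta * gamma) <= 1 by rewrite mulr_ile1 // ltW.
have rho0 : 0 < rho by rewrite /rho; lra.
have rho2 : rho <= 2^-1 by rewrite /rho; lra.
(* The thinned integral then has a mean of at least [rho * N = 2]. *)
pose N := 2 / rho.
have N0 : 0 < N by rewrite divr_gt0.
have rN : rho * N = 2 by rewrite /N; field; rewrite gt_eqF.
have [h Hh [hE hN]] := unbounded_on_single th0 N0 HE.
have [l0 hl0] := HH_step Hh.
have [K K0 hK] := dyadic_step_bounded T_gt0 hl0.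
have k0 : 0 < 2 / K by rewrite divr_gt0.
have t8 : 0 < theta / 8 by rewrite divr_gt0.
have [i0 Hi0] := small_increments k0 t8.
pose l := (i + maxn l0 i0)%N.
have l0l : (l0 <= l)%N by rewrite (leq_trans (leq_maxl l0 i0)) // leq_addl.
have i0l : (i0 <= l)%N by rewrite (leq_trans (leq_maxr l0 i0)) // leq_addl.
have hl : dyadic_step T l h by exact: dyadic_step_le hl0.
have large : theta / 8 <= pr P ([set w | N <= `|path_integral h w|] `\`
    [set w | exists2 c, (c < 2 ^ l)%N &
      rho * N < `|h (pt T l c.+1) * (mt (pt T l c.+1) w - mt (pt T l c) w)|]).
  have : pr P [set w | N <= `|path_integral h w|] <= theta / 8 +
    pr P ([set w | N <= `|path_integral h w|] `\`
    [set w | exists2 c, (c < 2 ^ l)%N &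
      rho * N < `|h (pt T l c.+1) * (mt (pt T l c.+1) w - mt (pt T l c) w)|]).
    apply: pr_le_add (Hi0 l i0l) (lexx _) => w wN.
    case: (pselect (exists2 c, (c < 2 ^ l)%N &
      rho * N < `|h (pt T l c.+1) * (mt (pt T l c.+1) w - mt (pt T l c) w)|)) => [[c cl]|nw]; last by right.
    rewrite rN normrM => hc; left; exists c => //.
    rewrite ltr_pdivrMr //; apply: lt_le_trans hc _.
    by rewrite mulrC ler_wpM2l // hK.
  lra.
have rho01 : 0 < rho <= 2^-1 by rewrite rho0 rho2.
have rho01' : 0 <= rho <= 1 by lra.
have p01 : is_prob (fun=> rho) by exact: is_prob_cst.
have rN1 : 1 <= rho * N / 2 by rewrite rN; lra.
have avg1 := thinned_large Hh hl rho01 N0 rN1 large.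
have HE' := unbounded_on_refine (maxn l0 i0) HE.
have avg2 := unbounded_after_thinning d0 rho01' HE'.
have avg3 : avg (fun=> rho) (2 ^ l)
    (fun s => (gamma <= energy (restrict_to T l s h))%R%:R) <= rho / gamma.
  apply: le_trans (avg_markov _ p01 g0 _) _.
    by move=> s; apply: energy_ge0; exists l; exact: dyadic_step_restrict.
  rewrite avg_energy // ler_pM2r ?invr_gt0 // ger_pMr //; exact: HH_energy.
have rd : rho / delta <= theta / 1024 / 4.
  rewrite /rho (_ : _ / delta = theta * gamma / 1024 / 4); last by field; rewrite gt_eqF.
  have := ler_wpM2l (ltW th0) g1; lra.
have rg : rho / gamma <= theta / 1024 / 4.
  rewrite /rho (_ : _ / gamma = theta * delta / 1024 / 4); last by field; rewrite gt_eqF.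
  have := ler_wpM2l (ltW th0) d1; lra.
pose E' s c := E (c %/ 2 ^ maxn l0 i0)%N && ~~ s c.
have : theta / 1024 / 4 < avg (fun=> rho) (2 ^ l) (fun s =>
    (pr P [set w | 1 <= `|path_integral (restrict_to T l s h) w|] -
     (`[< ~ unbounded_on (theta - delta) l (E' s) >])%:R) -
     (gamma <= energy (restrict_to T l s h))%R%:R).
  by rewrite !avgB; move: avg1 avg2 avg3; rewrite -/l -/E'; lra.
move=> /(avg_gt_exists p01)[s].
have p1 := pr_le1 P [set w | 1 <= `|path_integral (restrict_to T l s h) w|].
case: (asboolP (~ unbounded_on (theta - delta) l (E' s))) => [_|ubd].
  by case: (leP gamma) => _ /= Hs; exfalso; clear -Hs p1 th0; lra.
case: (leP gamma) => [_|en] /= Hs; first by exfalso; clear -Hs p1 th0; lra.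
exists l, (restrict_to T l s h), (E' s); split.
- exact: HH_restrict.
- exact: ltW.
- by lra.
- by apply: contrapT; exact: ubd.
move=> t t0; rewrite /E' -(cell_coarse T_gt0 i) //; split; last by case/andP.
rewrite /restrict_to; case: ifP => [st|]; last by rewrite eqxx.
by move=> /hE ->.
Qed.

(** Iterating [thinning_step] on the remaining cells, with losses [delta] that sum to
    [theta / 2], gives disjoint supports and a uniform lower bound. *)
Lemma thinning_sequence theta : 0 < theta <= 1 ->
  (forall N, 0 < N -> exists2 h, HH h &
     theta <= pr P [set w | N <= `|path_integral h w|]) ->
  exists h_ : nat -> R -> R, [/\ forall k, HH (h_ k),
    forall k, energy (h_ k) <= 2^-1 ^+ k,
    forall k, theta / 1024 / 8 <= pr P [set w | 1 <= `|path_integral (h_ k) w|] &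
    forall k k' t, (k < k')%N -> 0 < t <= T -> h_ k t != 0 -> h_ k' t = 0].
Proof.
move=> /andP[th0 th1] H.
(* The level of unboundedness that is left after [k] steps. *)
pose th k := theta / 2 + theta / 2 * 2^-1 ^+ k.
have hk k : 0 < (2^-1 : R) ^+ k <= 1.
  by rewrite exprn_gt0 ?invr_gt0 // exprn_ile1 ?invr_ge0 // invf_le1 ?ler1n.
have U0 : unbounded_on (th 0%N) 0 xpredT.
  move=> N N0; have [h Hh hN] := H N N0; exists h => //.
  have [i hi] := HH_step Hh.
  rewrite /th expr0 (_ : _ + _ = theta); last by field.
  apply: le_trans hN _; apply: pr_le => w wN; exists 0%N => //=.
  rewrite (_ : path_integral _ w = path_integral h w) //.
  apply: (eq_step_integral T_gt0 _ (dyadic_step_restrict T_gt0 _ (leq0n i) hi) hi).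
  move=> t t0; rewrite /restrict_to /=; have [] := cell_bounds T_gt0 0 t0.
  by rewrite expn0 ltnS leqn0 => ->.
pose good k (x : nat * (nat -> bool)) := unbounded_on (th k) x.1 x.2.
pose rel (kx : nat * (nat * (nat -> bool))) (y : (R -> R) * (nat * (nat -> bool))) :=
  good kx.1 kx.2 -> [/\ HH y.1, energy y.1 <= 2^-1 ^+ kx.1,
    theta / 1024 / 8 <= pr P [set w | 1 <= `|path_integral y.1 w|],
    good kx.1.+1 y.2 &
    forall t, 0 < t <= T -> (y.1 t != 0 -> kx.2.2 (cell T kx.2.1 t) && ~~ y.2.2 (cell T y.2.1 t)) /\
      (y.2.2 (cell T y.2.1 t) -> kx.2.2 (cell T kx.2.1 t))].
have /choice[f fP] : forall kx, exists y, rel kx y.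
  move=> [k [i E]]; case: (pselect (good k (i, E))) => [g|ng]; last by exists (fun=> 0, (i, E)).
  have /andP[h0 h1] := hk k.
  have tk : 0 < theta * 2^-1 ^+ k <= 1.
    by rewrite mulr_gt0 //= mulr_ile1 // ltW.
  have [||//|l [h [E' [H1 H2 H3 H4 H5]]]] := @thinning_step (th k) i E (theta / 4 * 2^-1 ^+ k) (2^-1 ^+ k) _ _ _ g.
  - rewrite /th; lra.
  - lra.
  exists (h, (l, E')) => _; split => //=.
    apply: le_trans H3; rewrite /th; lra.
  rewrite /good /th exprS /=.
  rewrite (_ : _ + _ = th k - theta / 4 * 2^-1 ^+ k) //.
  by rewrite /th; field.
pose st := fix st k := if k is k'.+1 then (f (k', st k')).2 else (0%N, xpredT).
have gst k : good k (st k).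
  by elim: k => //= k IH; have [] := fP (k, st k) IH.
have stP k := fP (k, st k) (gst k).
exists (fun k => (f (k, st k)).1); split.
- by move=> k; have [] := stP k.
- by move=> k; have [] := stP k.
- by move=> k; have [] := stP k.
move=> k k' t kk' t0 hkt; apply/eqP; apply: contraT => hk't.
have [_ _ _ _ /(_ t t0)[/(_ hkt)/andP[_ nE] _]] := stP k.
have [_ _ _ _ /(_ t t0)[/(_ hk't)/andP[Ek' _] _]] := stP k'.
have : (st k.+1).2 (cell T (st k.+1).1 t).
  move: Ek'; rewrite -(subnK kk') /=.
  elim: (k' - k.+1)%N => // n IH.
  rewrite addSn => h; apply: IH.
  by have [_ _ _ _ /(_ t t0)[_]] := stP (n + k.+1)%N; apply.
by move=> h; rewrite h in nE.
Qed.

End thinning.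

(** * Continuous functions on a segment and dyadic sets *)

Section compact_interval.
Context {R : realType}.
Implicit Types (a b : R) (f : R -> R).

Lemma within_continuous_dist a b f : {within `[a, b], continuous f} ->
  forall x, a <= x <= b -> forall e, 0 < e -> exists2 dl, 0 < dl &
  forall y, a <= y <= b -> `|y - x| < dl -> `|f y - f x| < e.
Proof.
move=> /subspace_continuousP fc x xab e e0.
have xI : `[a, b]%classic x by rewrite /= in_itv.
have /cvgrPdist_lt /(_ e e0) := fc x xI.
rewrite /prop_near1 /= => /nbhs_ballP [dl /= dl0 H].
exists dl => // y yab yx; rewrite distrC; apply: H => /=.
- by rewrite /ball /= distrC.
- by rewrite in_itv.
Qed.

Lemma dist_within_continuous a b f :
  (forall x, a <= x <= b -> forall e, 0 < e -> exists2 dl, 0 < dl &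
  forall y, a <= y <= b -> `|y - x| < dl -> `|f y - f x| < e) ->
  {within `[a, b], continuous f}.
Proof.
move=> H; apply/subspace_continuousP => x; rewrite /= in_itv /= => xab.
apply/cvgrPdist_lt => e e0; have [dl dl0 Hd] := H x xab e e0.
rewrite /prop_near1 /=; apply/nbhs_ballP; exists dl => //= y.
rewrite /ball /= => xy; rewrite in_itv /= => yab.
by rewrite distrC; apply: Hd => //; rewrite distrC.
Qed.

Lemma geometric_small (c e : R) : 0 < e ->
  exists N, forall n, (N <= n)%N -> c / 2 ^+ n < e.
Proof.
move=> e0; have := @cvg_geometric R c (2^-1).
rewrite ger0_norm ?invr_ge0 // invf_lt1 // ltr1n => /(_ isT).
move=> /cvgrPdist_lt /(_ e e0) [N _ HN]; exists N => n Nn.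
have := HN n Nn; rewrite /= sub0r normrN /geometric /= exprVn.
exact: le_lt_trans (ler_norm _).
Qed.

(** The Heine-Cantor theorem, by a cluster point of a sequence of counterexamples. *)
Lemma uniformly_continuous_itv a b f : a < b -> {within `[a, b], continuous f} ->
  forall e, 0 < e -> exists2 dl, 0 < dl &
  forall x y, a <= x <= b -> a <= y <= b -> `|x - y| <= dl -> `|f x - f y| <= e.
Proof.
move=> ab fc e e0; apply: contrapT => H.
have {}H i : exists xy : R * R, [/\ a <= xy.1 <= b, a <= xy.2 <= b,
    `|xy.1 - xy.2| <= 1 / 2 ^+ i & e < `|f xy.1 - f xy.2|].
  apply: contrapT => nH; apply: H; exists (1 / 2 ^+ i); first by rewrite divr_gt0 ?exprn_gt0.
  move=> x y xab yab xy; rewrite leNgt; apply/negP => h; apply: nH.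
  by exists (x, y).
have /choice[g gP] := H.
pose F := (fun n => (g n).1) @ \oo.
have Fab : F `[a, b]%classic.
  by exists 0%N => // n _ /=; rewrite in_itv; have [] := gP n.
have [p [pab cp]] := @segment_compact R a b F _ Fab.
rewrite /= in_itv /= in pab.
have e2 : 0 < e / 2 by rewrite divr_gt0.
have [dl dl0 Hd] := within_continuous_dist fc pab e2.
have d2 : 0 < dl / 2 by rewrite divr_gt0.
have [N HN] := @geometric_small 1 _ d2.
have F2 : F [set x | exists2 n, (N <= n)%N & x = (g n).1].
  by exists N => // n Nn; exists n.
have [x [[n Nn ->] /= xp]] := cp _ _ F2 (nbhsx_ballx p _ d2).
have [g1 g2 g12 eg] := gP n.
rewrite /ball /= distrC in xp.
have h1 : `|f (g n).1 - f p| < e / 2 by apply: Hd => //; lra.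
have h2 : `|f (g n).2 - f p| < e / 2.
  apply: Hd => //; have h12 := le_lt_trans g12 (HN n Nn).
  have -> : (g n).2 - p = ((g n).1 - p) - ((g n).1 - (g n).2) by ring.
  by apply: le_lt_trans (ler_normB _ _) _; lra.
have : `|f (g n).1 - f (g n).2| <= `|f (g n).1 - f p| + `|f (g n).2 - f p|.
  by rewrite -[in leLHS](_ : (f (g n).1 - f p) - (f (g n).2 - f p) = f (g n).1 - f (g n).2) ?ler_normB //; ring.
lra.
Qed.

Lemma bounded_itv a b f : a <= b -> {within `[a, b], continuous f} ->
  exists2 K, 0 < K & forall x, a <= x <= b -> `|f x| <= K.
Proof.
move=> ab fc; have cf : {within `[a, b], continuous (fun x => `|f x|)}.
  apply: dist_within_continuous => x xab e e0.
  have [dl dl0 H] := within_continuous_dist fc xab e0.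
  exists dl => // y yab yx; apply: le_lt_trans (H y yab yx).
  by rewrite ler_dist_dist.
have [c cab H] := EVT_max ab cf.
exists (`|f c| + 1); first by rewrite ltr_wpDl.
by move=> x xab; apply: le_trans (H x _) _; rewrite ?in_itv // lerDl.
Qed.

End compact_interval.

Section dyadic_path.
Context {R : realType}.
Variable T : R.
Hypothesis T_gt0 : 0 < T.

(** Uniform continuity, at the scale of the grid. *)
Lemma dyadic_oscillation (f : R -> R) : {within `[0, T], continuous f} ->
  forall e, 0 < e -> exists i0, forall i, (i0 <= i)%N -> forall j t,
    (j < 2 ^ i)%N -> pt T i j <= t <= pt T i j.+1 -> `|f t - f (pt T i j)| <= e.
Proof.
move=> fc e e0; have [dl dl0 H] := uniformly_continuous_itv T_gt0 fc e0.
have [i0 H0] := geometric_small T dl0.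
exists i0 => i ii0 j t ji /andP[t1 t2].
have h0 := pt_ge0 T_gt0 i j; have hT := pt_leT T_gt0 ji.
have hj : pt T i j <= T by apply: pt_leT => //; exact: ltnW.
apply: H; rewrite ?h0 ?hj //.
  by rewrite (le_trans h0 t1) (le_trans t2 hT).
rewrite ger0_norm ?subr_ge0 //; apply: le_trans (ltW (H0 i ii0)).
by rewrite -(pt_step T i j) lerD2r.
Qed.

End dyadic_path.

Section dyadic_sets.
Context {R : realType}.
Variable T : R.
Hypothesis T_gt0 : 0 < T.

Definition dyadic_cell i j : set R := [set t | pt T i j < t <= pt T i j.+1].

Lemma measurable_dyadic_cell i j : measurable (dyadic_cell i j).
Proof.
by rewrite (_ : dyadic_cell i j = `]pt T i j, pt T i j.+1]%classic).
Qed.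

Lemma dyadic_cell_in i j : (j < 2 ^ i)%N -> dyadic_cell i j `<=` `]0, T].
Proof.
move=> ji t /= /andP[t1 t2]; rewrite in_itv /= (le_lt_trans (pt_ge0 T_gt0 i j) t1) /=.
by apply: le_trans t2 _; exact: pt_leT.
Qed.

Lemma dyadic_cellI i j k : j != k -> dyadic_cell i j `&` dyadic_cell i k = set0.
Proof.
move=> jk; apply/seteqP; split => t // [h1 h2]; move/eqP: jk; apply.
by rewrite -(cellE T_gt0 h1) (cellE T_gt0 h2).
Qed.

Lemma cells_setE i (E : nat -> bool) :
  `]0, T] `&` [set t | E (cell T i t)] =
  \big[setU/set0]_(j < 2 ^ i) (if E j then dyadic_cell i j else set0).
Proof.
rewrite -(bigcup_mkord _ (fun j => if E j then dyadic_cell i j else set0)).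
apply/seteqP; split => t.
  rewrite /= in_itv /= => -[t0 Et]; have [ci tc] := cell_bounds T_gt0 i t0.
  by exists (cell T i t) => //=; rewrite Et.
move=> [j /= ji]; case: ifP => // Ej tj; split; first exact: dyadic_cell_in tj.
by rewrite /= (cellE T_gt0 tj).
Qed.

Lemma measurable_cells i (E : nat -> bool) :
  measurable (`]0, T] `&` [set t | E (cell T i t)]).
Proof.
rewrite cells_setE; apply: bigsetU_measurable => j _.
by case: ifP => // _; exact: measurable_dyadic_cell.
Qed.

(** Only the trace on [`]0, T]] matters. Fixing it this way, rather than taking subsets
    of [`]0, T]], makes the class closed under complements in the whole line. *)
Definition dyadic_sets : set (set R) := [set V | measurable V /\
  exists i (E : nat -> bool), forall t, 0 < t <= T -> (V t <-> E (cell T i t))].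

Lemma dyadic_sets_setC V : dyadic_sets V -> dyadic_sets (~` V).
Proof.
move=> [mV [i [E VE]]]; split; first exact: measurableC.
exists i, (fun j => ~~ E j) => t t0; split => [nV|/negP nE /(VE t t0)] //.
by apply/negP => Et; apply: nV; apply/VE.
Qed.

Lemma dyadic_sets_setU V W : dyadic_sets V -> dyadic_sets W ->
  dyadic_sets (V `|` W).
Proof.
move=> [mV [i [E VE]]] [mW [k [F WF]]]; split; first exact: measurableU.
exists (i + k)%N, (fun c => E (c %/ 2 ^ k)%N || F (c %/ 2 ^ i)%N) => t t0.
rewrite -(cell_coarse T_gt0 i k t0) addnC -(cell_coarse T_gt0 k i t0).
split; first by move=> [/(VE t t0) ->|/(WF t t0) ->]; rewrite ?orbT.
by move=> /orP[/(VE t t0)|/(WF t t0)]; [left|right].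
Qed.

Lemma dyadic_sets0 : dyadic_sets set0.
Proof. by split => //; exists 0%N, xpred0. Qed.

Lemma dyadic_sets_generate (A : set R) : measurable A -> <<s dyadic_sets >> A.
Proof.
move=> mA; have : (@RGenOInfty.G R).-sigma.-measurable A.
  by rewrite -RGenOInfty.measurableE; exact: mA.
move: A {mA}; apply: smallest_sub => [|_ [a ->]].
  exact: smallest_sigma_algebra.
pose V n := (`]a, +oo[ `\` `]0, T]) `|`
  (`]0, T] `&` [set t | (a <= pt T n (cell T n t))%R]).
have -> : `]a, +oo[%classic = \bigcup_n V n.
  apply/seteqP; split => t.
    rewrite /= in_itv /= andbT => ta.
    have [t0|nt] := boolP (0 < t <= T); last first.
      by exists 0%N => //; left; split; rewrite /= in_itv /= ?andbT // ; exact/negP.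
    have ta0 : 0 < t - a by rewrite subr_gt0.
    have [n Hn] := geometric_small T ta0.
    exists n => //; right; split => /=; first by rewrite in_itv.
    have [_ /andP[_ t2]] := cell_bounds T_gt0 n t0.
    have := Hn n (leqnn n); have := pt_step T n (cell T n t); lra.
  move=> [n _ [[//]|[]]]; rewrite /= !in_itv /= andbT => t0 an.
  by have [_ /andP[t1 _]] := cell_bounds T_gt0 n t0; exact: le_lt_trans t1.
apply: sigma_algebra_bigcup => n; apply: sub_sigma_algebra; split.
  apply: measurableU; first exact: measurableD.
  exact: (measurable_cells n (fun j => (a <= pt T n j)%R)).
exists n, (fun j => (a <= pt T n j)%R) => t t0; split.
  by move=> [[_ /=]|[_ //]]; rewrite in_itv /= t0.
by move=> h; right; split => //=; rewrite in_itv.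
Qed.

End dyadic_sets.

(** * Stochastic measures with a continuous distribution function *)

Section continuous_stochastic_measures.
Context {d} {Omega : measurableType d} {R : realType}.
Variable P : probability Omega R.
Variable T : R.
Hypothesis T_gt0 : 0 < T.
Variable mu : set R -> {RV P >-> R}.
Hypothesis mu_sm : stochastic_measure `[0, T] mu.
Variable mut : R -> {RV P >-> R}.
Hypothesis mut_cont : continuous_version T mu mut.

Notation small := (small P).
Notation tail := (tail P).
Notation aeq := (aeq P).
Notation D := (`]0, T]%classic : set R).
Notation meas_in := (@meas_in _ R D).
Notation path_integral := (path_integral T (fun t => mut t : Omega -> R)).

Lemma mD : measurable D. Proof. by []. Qed.

(** The restriction to [`]0, T]], the part of the segment that [mut] describes. *)
Lemma mu_sm' : stochastic_measure D mu.
Proof.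
move=> A mA; apply: mu_sm => n; have [m1 m2] := mA n; split => //.
apply: subset_trans m2 _ => t; rewrite /= !in_itv /= => /andP[t0 tT].
by rewrite tT ltW.
Qed.

Lemma mut_aeq t : 0 <= t <= T -> aeq (mut t) (mu `]0, t]).
Proof. by move=> t0; apply: ae_aeq; apply: mut_cont.2; rewrite in_itv. Qed.

Lemma increment_aeq i j : (j < 2 ^ i)%N ->
  aeq (mu (dyadic_cell T i j)) (fun w => mut (pt T i j.+1) w - mut (pt T i j) w).
Proof.
move=> ji; have l1 : 0 <= pt T i j.+1 <= T by rewrite pt_ge0 // pt_leT.
have l0 : 0 <= pt T i j <= T by rewrite pt_ge0 // pt_leT // ltnW.
have ll : pt T i j <= pt T i j.+1 by exact: pt_le.
have s1 t : 0 <= t <= T -> meas_in `]0, t].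
  move=> /andP[_ tT]; split => // u; rewrite /= !in_itv /= => /andP[-> ut].
  exact: le_trans ut tT.
have := smD mu_sm' (s1 _ l1) (s1 _ l0).
rewrite (_ : _ `\` _ = dyadic_cell T i j); last first.
  apply/seteqP; split => u; rewrite /dyadic_cell /= !in_itv /=.
    by move=> [/andP[u0 ->] /negP]; rewrite u0 /= -ltNge => ->.
  move=> /andP[h1 h2]; rewrite h2 (le_lt_trans (pt_ge0 T_gt0 i j) h1); split => //.
  by apply/negP; rewrite /= -ltNge.
move=> /(_ _) H; apply: aeq_trans (H _) _.
  move=> u; rewrite /= !in_itv /= => /andP[-> h]; exact: le_trans h ll.
by apply: aeqB; apply: aeq_sym; exact: mut_aeq.
Qed.

Lemma path_integral_aeq i h : dyadic_step T i h ->
  aeq (path_integral h)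
      (fun w => \sum_(j < 2 ^ i) h (pt T i j.+1) * mu (dyadic_cell T i j) w).
Proof.
move=> hi; apply: (@aeq_trans _ _ _ _ (fun w => dsum T i h (mut^~ w))).
  by apply: aeq_eq => w; rewrite /path_integral (step_integralE T_gt0 _ hi).
apply: aeq_sum => j _; apply: aeqZ; apply: aeq_sym; exact: increment_aeq.
Qed.

Lemma cell_in i j : (j < 2 ^ i)%N -> meas_in (dyadic_cell T i j).
Proof.
by move=> ji; split; [exact: measurable_dyadic_cell|exact: dyadic_cell_in].
Qed.

(** Total in [j], so that families of cells can be indexed by all natural numbers. *)
Definition clip_cell i j : set R := if (j < 2 ^ i)%N then dyadic_cell T i j else set0.

Lemma clip_cell_in i j : meas_in (clip_cell i j).
Proof. by rewrite /clip_cell; case: ifP => [/cell_in //|_]; split. Qed.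

Lemma path_integral_indicator i (E : nat -> bool) h : dyadic_step T i h ->
  (forall t, 0 < t <= T -> h t = (E (cell T i t))%:R) ->
  aeq (path_integral h) (mu (D `&` [set t | E (cell T i t)])).
Proof.
move=> hi hE; apply: aeq_trans (path_integral_aeq hi) _; rewrite cells_setE //.
pose F j := if E j then clip_cell i j else set0.
have mF j : meas_in (F j) by rewrite /F; case: ifP => _; [exact: clip_cell_in|split].
have -> : \big[setU/set0]_(j < 2 ^ i) (if E j then dyadic_cell T i j else set0) =
    \big[setU/set0]_(j < 2 ^ i) F j.
  by apply: eq_bigr => j _; rewrite /F /clip_cell ltn_ord.
have tF j k : (j < 2 ^ i)%N -> (k < 2 ^ i)%N -> j != k -> F j `&` F k = set0.
  move=> ji ki jk; rewrite /F /clip_cell ji ki.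
  by case: ifP => _; case: ifP => _; rewrite ?set0I ?setI0 // dyadic_cellI.
apply: aeq_trans (aeq_sym (sm_bigU mu_sm' mF tF)).
apply: aeq_sum => j _; rewrite hE; last by rewrite pt_gt0 // pt_leT.
rewrite cell_pt // /F /clip_cell ltn_ord; case: (E j).
  by apply: aeq_eq => w; rewrite mul1r.
by apply: aeq_trans (aeq_sym (sm0 mu_sm')); apply: aeq_eq => w; rewrite mul0r.
Qed.

Lemma mut_small_increments (kappa e : R) : 0 < kappa -> 0 < e ->
  exists i0, forall i, (i0 <= i)%N ->
  pr P [set w | exists2 j, (j < 2 ^ i)%N &
    kappa < `|mut (pt T i j.+1) w - mut (pt T i j) w|] <= e.
Proof.
move=> k0 e0; apply: pr_cvg0 => // [i|w].
  apply: measurable_exists_lt => j; apply: measurable_gt_norm.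
  exact: measurable_funB.
have [i0 H] := dyadic_oscillation T_gt0 (mut_cont.1 w) k0.
exists i0 => i ii0 [j ji]; apply/negP; rewrite -leNgt.
by apply: (H i ii0 j _ ji); rewrite lexx andbT; exact: pt_le.
Qed.

(** * Boundedness of the range *)

(** For these functions the integral is a value of [mu], so that boundedness of their
    integrals is boundedness of the range on the dyadic sets. *)
Definition indicator_class (h : R -> R) := (exists i, dyadic_step T i h) /\
  forall t, h t = 0 \/ h t = 1.

Lemma indicator_class_set h : indicator_class h ->
  measurable (D `&` [set t | h t = 1]) /\
  aeq (path_integral h) (mu (D `&` [set t | h t = 1])).
Proof.
move=> [[i hi] h01]; pose E j := h (pt T i j.+1) == 1.
have hE t : 0 < t <= T -> h t = (E (cell T i t))%:R.
  move=> t0; have [ci tc] := cell_bounds T_gt0 i t0.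
  rewrite (hi _ _ ci tc) /E.
  by case: (h01 (pt T i (cell T i t).+1)) => ->; rewrite ?eqxx // eq_sym oner_eq0.
have -> : D `&` [set t | h t = 1] = D `&` [set t | E (cell T i t)].
  apply/seteqP; split => t [tD /= ht]; split => //=; move: (tD); rewrite /= in_itv /= => t0.
    move: ht; rewrite hE //; case: (E _) => // /eqP.
    by rewrite eq_sym oner_eq0.
  by rewrite hE // ht.
split; first exact: measurable_cells.
exact: path_integral_indicator.
Qed.

(** Otherwise [thinning_sequence], applied to indicators with the zero energy, gives
    disjoint sets whose measures do not tend to zero, against [sm_exhaustive]. *)
Lemma range_bounded_dyadic (eta : R) : 0 < eta -> exists2 lambda, 0 < lambda &
  forall V, dyadic_sets T V -> tail (mu (D `&` V)) lambda <= eta.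
Proof.
move=> eta0; apply: contrapT => H.
have unb N : 0 < N -> exists2 h, indicator_class h &
    Num.min eta 1 <= pr P [set w | N <= `|path_integral h w|].
  move=> N0; apply: contrapT => nH; apply: H; exists N => // V [mV [i [E VE]]].
  rewrite leNgt; apply/negP => HV; apply: nH.
  pose h t : R := (E (cell T i t))%:R.
  have hi : dyadic_step T i h.
    by move=> j t ji tj; rewrite /h cell_pt // (cellE T_gt0 tj).
  exists h; first by split; [exists i|move=> t; rewrite /h; case: (E _); [right|left]].
  have e1 : aeq (path_integral h) (mu (D `&` V)).
    apply: aeq_trans (path_integral_indicator hi (fun t _ => erefl)) _.
    rewrite (_ : D `&` _ = D `&` V); first exact: aeq_refl.
    by apply/seteqP; split => t [tD tV]; split => //; move: (tD); rewrite /= in_itv /= => t0; apply/(VE t t0).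
  apply: (@le_trans _ _ eta); first by rewrite ge_min lexx.
  apply: (le_trans (ltW HV)); rewrite -(aeq_tail _ e1); apply: pr_le => w /=.
  exact: ltW.
have th01 : 0 < Num.min eta 1 <= 1 by rewrite lt_min eta0 ltr01 ge_min lexx orbT.
have e1 (h : R -> R) : indicator_class h ->
    energy T (fun=> 0) h <= 1.
  move=> _; rewrite /energy /step_integral /dsum big1 // => j _.
  by rewrite subrr mulr0.
have res i s h : indicator_class h -> indicator_class (restrict_to T i s h).
  move=> [[l hl] h01]; split; last first.
    by move=> t; rewrite /restrict_to; case: ifP => // _; left.
  exists (maxn i l); apply: dyadic_step_restrict => //; first exact: leq_maxl.
  by apply: dyadic_step_le hl => //; exact: leq_maxr.
have [h_ [h1 h2 h3 h4]] := @thinning_sequence _ _ _ P T T_gt0 (fun t => mut t) (fun t => measurable_funPT _)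
  (fun=> 0) (fun _ _ => lexx _) indicator_class (fun h hh => hh.1) res e1
  mut_small_increments _ th01 unb.
pose A k := D `&` [set t | h_ k t = 1].
have mA k : meas_in (A k).
  by split; [exact: (indicator_class_set (h1 k)).1|exact: subIsetl].
have tA : trivIset setT A.
  have disj k k' : (k < k')%N -> A k `&` A k' = set0.
    move=> kk'; apply/seteqP; split => t // [[tD /= t1] [_ /= t2]].
    move: tD; rewrite /= in_itv /= => t0.
    have := h4 k k' t kk' t0; rewrite t1 oner_neq0 => /(_ isT) /eqP.
    by rewrite t2 oner_eq0.
  apply/trivIsetP => k k' _ _; rewrite neq_ltn => /orP[/disj //|/disj].
  by rewrite setIC.
set th := Num.min eta 1 in th01 h3.
have /andP[th0 th1] := th01.
have c0 : 0 < th / 1024 / 16 by lra.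
have [N /(_ N (leqnn N)) sN] := sm_exhaustive mu_sm' mA tA c0.
have {}sN : tail (path_integral (h_ N)) (th / 1024 / 16) <= th / 1024 / 16.
  by rewrite (aeq_tail _ (indicator_class_set (h1 N)).2); exact: sN.
have := h3 N; apply/negP; rewrite -ltNge.
apply: (@le_lt_trans _ _ (th / 1024 / 16)); last lra.
apply: le_trans sN; apply: pr_le => w /=; apply: lt_le_trans; lra.
Qed.

Lemma range_bounded (eta : R) : 0 < eta -> exists2 lambda, 0 < lambda &
  forall A, meas_in A -> tail (mu A) lambda <= eta.
Proof.
move=> eta0; have eta2 : 0 < eta / 2 by rewrite divr_gt0.
have [lambda l0 Hl] := range_bounded_dyadic eta2.
exists (lambda + eta / 2); first exact: addr_gt0.
move=> A [mA AD]; have -> : A = D `&` A by apply/esym/setIidr.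
rewrite {2}[eta]splitr.
apply: (tail_sigma mD mu_sm' (U := dyadic_sets T)) => //.
- by move=> V [].
- exact: dyadic_sets0.
- exact: dyadic_sets_setC.
- exact: dyadic_sets_setU.
- exact: dyadic_sets_generate.
Qed.

End continuous_stochastic_measures.

(** * The gliding hump argument *)

Section gliding_hump.
Context {d} {Omega : measurableType d} {R : realType}.
Variable P : probability Omega R.
Context {d'} {S : measurableType d'}.
Variable D : set S.
Variable nu : nat -> set S -> Omega -> R.
Implicit Types (A B C F : set S).

Notation small := (small P).
Notation tail := (tail P).
Notation aeq := (aeq P).
Notation meas_in := (@meas_in _ S D).

Hypothesis nuU : forall n A B, meas_in A -> meas_in B -> A `&` B = set0 ->
  aeq (nu n (A `|` B)) (fun w => nu n A w + nu n B w).
Hypothesis nu_shrink : forall n (B : nat -> set S), (forall k, meas_in (B k)) ->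
  (forall k, B k.+1 `<=` B k) -> \bigcap_k B k = set0 ->
  forall e, 0 < e -> exists N, forall C, measurable C -> C `<=` B N ->
  small e (nu n C).
Hypothesis nu_cauchy : forall A, meas_in A -> forall e, 0 < e ->
  exists N, forall p q, (N <= p)%N -> (N <= q)%N ->
  small e (fun w => nu p A w - nu q A w).

Lemma nu_shrinks_tail (A : nat -> set S) : (forall k, meas_in (A k)) ->
  trivIset setT A -> forall n e, 0 < e -> forall k, exists2 k', (k < k')%N &
  forall C, measurable C -> C `<=` \bigcup_(l in [set l | (k' <= l)%N]) A l ->
  small e (nu n C).
Proof.
move=> mA tA n e e0 k.
pose B k := \bigcup_(l in [set l | (k <= l)%N]) A l.
have mB j : meas_in (B j).
  split; first by apply: bigcup_measurable => l _; exact: (mA l).1.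
  by apply: bigcup_sub => l _; exact: (mA l).2.
have Bmn i j : (i <= j)%N -> B j `<=` B i.
  by move=> ij t [l /= jl At]; exists l => //=; exact: leq_trans jl.
have B0 : \bigcap_k B k = set0.
  apply/seteqP; split => t // H.
  have [l _ At] := H 0%N I; have [l' /= ll' At'] := H l.+1 I.
  have /trivIsetP := tA => /(_ l l' I I); rewrite neq_ltn ll' => /(_ isT) E.
  by have : (A l `&` A l') t; [split|rewrite E].
have [N HN] := nu_shrink n mB (fun j => Bmn _ _ (leqnSn j)) B0 e0.
exists (maxn N k.+1); first exact: leq_maxr.
move=> C mC CB; apply: HN => //; apply: subset_trans CB _.
exact: Bmn (leq_maxl _ _).
Qed.

(** The set functions [nu n] are additive, continuous at the empty set and convergent on
    each set. If, for each [k], [nu n (A k)] stayed away from [0] for all large [n], one could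
    choose indices [k] and [n] alternately, so that each [nu n] is stationary on the
    chosen members so far, large on the next one and small on all later ones. Then
    [nu n] would oscillate on the union of the chosen members. *)
Lemma gliding_hump (A : nat -> set S) (c a : R) : 0 < c -> 0 < a ->
  (forall k, meas_in (A k)) -> trivIset setT A ->
  (forall k, exists N, forall n, (N <= n)%N -> c <= tail (nu n (A k)) a) ->
  False.
Proof.
move=> c0 a0 mA tA big.
pose e := Num.min c a / 8.
have e0 : 0 < e by rewrite divr_gt0 // lt_min c0.
have ec : 8 * e <= c by rewrite /e mulrC divfK // ge_min lexx.
have ea : 8 * e <= a by rewrite /e mulrC divfK // ge_min lexx orbT.
pose U k := \bigcup_(l in [set l | (k <= l)%N]) A l.
have Umn i j : (i <= j)%N -> U j `<=` U i.
  by move=> ij t [l /= jl At]; exists l => //=; exact: leq_trans jl.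
have AU k : A k `<=` U k by move=> t At; exists k => /=.
(* A state consists of the union [F] of the chosen members, the last index [k] and a
   rank [n] from which the values of the set functions on [F] are nearly constant. *)
pose good (s : set S * nat * nat) := let: (F, k, n) := s in
  [/\ meas_in F, F `<=` \bigcup_(l in [set l | (l <= k)%N]) A l &
   forall p q, (n <= p)%N -> (n <= q)%N -> small e (fun w => nu p F w - nu q F w)].
pose rel (s s' : set S * nat * nat) := let: (F, k, n) := s in
  let: (F', k', n') := s' in
  [/\ (k < k')%N, (n < n')%N, F' = F `|` A k',
    forall C, measurable C -> C `<=` U k' -> small e (nu n C) &
    c <= tail (nu n' (A k')) a].
have next s : exists s', good s -> good s' /\ rel s s'.
  case: s => [[F k] n]; case: (pselect (good (F, k, n))) => [|ng]; last by exists (F, k, n).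
  move=> [mF Fk cF].
  have [k' kk' Hk'] := nu_shrinks_tail mA tA n e0 k.
  have mF' : meas_in (F `|` A k').
    by split; [exact: measurableU mF.1 (mA k').1|rewrite subUset; split; [exact: mF.2|exact: (mA k').2]].
  have [N1 H1] := nu_cauchy mF' e0.
  have [N2 H2] := big k'.
  exists (F `|` A k', k', maxn n.+1 (maxn N1 N2)) => _; split; split => //.
  - move=> t [/Fk [l /= lk Al]|At]; last by exists k' => /=.
    by exists l => //=; apply: leq_trans lk _; exact: ltnW.
  - move=> p q; rewrite !geq_max => /and3P[_ p1 _] /and3P[_ q1 _]; exact: H1.
  - by rewrite leq_max leqnn.
  - by apply: H2; rewrite !leq_max leqnn !orbT.
have /choice[f fP] := next.
pose st := fix st j := if j is j'.+1 then f (st j') else (set0, 0%N, 0%N).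
have nu0 n : aeq (nu n set0) (fun=> 0).
  have := @nuU n set0 set0 (conj measurable0 (@sub0set _ D)) (conj measurable0 (@sub0set _ D)).
  rewrite setU0 setI0 => /(_ erefl) h.
  by apply: (aeq_le h) => w; lra.
have g0 : good (st 0%N).
  split => //; first by split.
  move=> p q _ _; apply: aeq_small (small0 P (ltW e0)).
  by apply: aeq_sym; apply: (aeq_le2 (nu0 p) (nu0 q)) => w -> ->; rewrite subrr.
have gst j : good (st j) by elim: j => // j /fP[].
have rst j : rel (st j) (st j.+1) by have [] := fP _ (gst j).
pose F j := (st j).1.1; pose k j := (st j).1.2; pose n j := (st j).2.
have G j : [/\ meas_in (F j), F j `<=` \bigcup_(l in [set l | (l <= k j)%N]) A l &
   forall p q, (n j <= p)%N -> (n j <= q)%N -> small e (fun w => nu p (F j) w - nu q (F j) w)].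
  by have := gst j; rewrite /good /F /k /n; case: (st j) => [[]].
have L j : [/\ (k j < k j.+1)%N, (n j < n j.+1)%N, F j.+1 = F j `|` A (k j.+1),
    forall C, measurable C -> C `<=` U (k j.+1) -> small e (nu (n j) C) &
    c <= tail (nu (n j.+1) (A (k j.+1))) a].
  have := rst j; rewrite /rel /F /k /n.
  by case: (st j) => [[a1 a2] a3]; case: (st j.+1) => [[b1 b2] b3].
have nj j : (j <= n j)%N.
  by elim: j => // j IH; apply: leq_ltn_trans IH _; have [] := L j.
have kmono i j : (i <= j)%N -> (k i <= k j)%N.
  move=> /subnK <-; elim: (j - i)%N => // m IH; apply: leq_trans IH _.
  by rewrite addSn; apply: ltnW; have [] := L (m + i)%N.
have Fi j i : (j <= i)%N -> F i `<=` F j `|` U (k j.+1).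
  move=> /subnK <-; elim: (i - j)%N => [|m IH]; first by rewrite add0n; exact: subsetUl.
  rewrite addSn; have [_ _ -> _ _] := L (m + j)%N.
  rewrite subUset; split => //.
  apply: subset_trans (AU _) _; apply: subset_trans (@subsetUr _ _ _).
  by apply: Umn; apply: kmono; rewrite ltnS leq_addl.
have FiS j : F j `<=` F j.+1 by have [_ _ -> _ _] := L j; exact: subsetUl.
have Fij j i : (i <= j)%N -> F i `<=` F j.
  by move=> /subnK <-; elim: (j - i)%N => // m IH; apply: subset_trans IH _; exact: FiS.
pose X := \bigcup_j F j.
have mX : meas_in X.
  split; first by apply: bigcupT_measurable => j; have [[]] := G j.
  by apply: bigcup_sub => j _; have [[]] := G j.
have XD j : X `\` F j `<=` U (k j.+1).
  move=> t [[i _ Fit] nF]; have [ij|ji] := leqP i j.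
    by exfalso; apply: nF; exact: (Fij _ _ ij).
  by have [|//] := Fi j i (ltnW ji) t Fit.
have [N HN] := nu_cauchy mX e0.
have [mF Fk cF] := G N; have [mF' _ _] := G N.+1.
have [kk nn FE sU bigN] := L N; have [_ _ _ sU' _] := L N.+1.
have mXF j : meas_in (X `\` F j).
  by apply: meas_inD => //; have [[]] := G j.
have E1 p : aeq (nu p X) (fun w => nu p (F N) w + nu p (X `\` F N) w).
  rewrite -[X in nu p X](_ : F N `|` (X `\` F N) = X); last first.
    by apply: setDUK => t Ft; exists N.
  apply: nuU => //.
  by rewrite setDE setICA setICr setI0.
have E2 p : aeq (nu p X) (fun w => nu p (F N.+1) w + nu p (X `\` F N.+1) w).
  rewrite -[X in nu p X](_ : F N.+1 `|` (X `\` F N.+1) = X); last first.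
    by apply: setDUK => t Ft; exists N.+1.
  apply: nuU => //.
  by rewrite setDE setICA setICr setI0.
have E3 p : aeq (nu p (F N.+1)) (fun w => nu p (F N) w + nu p (A (k N.+1)) w).
  rewrite FE; apply: nuU => //.
  apply/seteqP; split => t // [/Fk [l /= lk Al] At].
  have /trivIsetP := tA => /(_ l (k N.+1) I I).
  rewrite neq_ltn (leq_ltn_trans lk kk) => /(_ isT) E.
  by have : (A l `&` A (k N.+1)) t; [split|rewrite E].
have H : small (e + e + (e + e)) (nu (n N.+1) (A (k N.+1))).
  have NN1 : (N <= n N.+1)%N by apply: leq_trans (nj N) (ltnW nn).
  have h1 := HN (n N.+1) (n N) NN1 (nj N).
  have h2 := cF (n N.+1) (n N) (ltnW nn) (leqnn _).
  have h3 := sU _ (mXF N).1 (XD N).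
  have h4 := sU' _ (mXF N.+1).1 (XD N.+1).
  apply: aeq_small (smallD (smallB h1 h2) (smallB h3 h4)).
  apply: aeq_sym.
  apply: (aeq_le2 (aeqB (E2 (n N.+1)) (E1 (n N))) (E3 (n N.+1))) => w e1 e2.
  by rewrite e1 e2; ring.
have : tail (nu (n N.+1) (A (k N.+1))) a <= e + e + (e + e).
  by apply: le_trans H; apply: tail_le; lra.
lra.
Qed.

End gliding_hump.

Section simple_integrals.
Import HBSimple.
Context {d} {Omega : measurableType d} {R : realType}.
Variable P : probability Omega R.
Context {d'} {S : measurableType d'}.
Variables (D : set S) (mu : set S -> {RV P >-> R}).
Hypothesis mu_sm : stochastic_measure D mu.
Implicit Types (f : {sfun S >-> R}) (A B C : set S).

Notation small := (small P).
Notation tail := (tail P).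
Notation aeq := (aeq P).
Notation meas_in := (@meas_in _ S D).

Definition sfun_values f : seq R := finmap.enum_fset (fset_set (range f)).

Lemma simple_integralE f A w : simple_integral mu f A w =
  \sum_(c <- sfun_values f) c * mu (f @^-1` [set c] `&` A) w.
Proof. by rewrite /simple_integral fsbig_finite //=. Qed.

Lemma simple_integral_fun f A : simple_integral mu f A =
  fun w => \sum_(c <- sfun_values f) c * mu (f @^-1` [set c] `&` A) w.
Proof. by apply: funext => w; rewrite simple_integralE. Qed.

Lemma sfun_preimage_in f c A : meas_in A -> meas_in (f @^-1` [set c] `&` A).
Proof. by move=> mA; rewrite setIC; apply: meas_inI. Qed.

Lemma measurable_simple_integral f A :
  measurable_fun setT (simple_integral mu f A).
Proof.
by rewrite simple_integral_fun; apply: measurable_sum => c; apply: measurable_funM.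
Qed.

Lemma simple_integralU f A B : meas_in A -> meas_in B -> A `&` B = set0 ->
  aeq (simple_integral mu f (A `|` B))
      (fun w => simple_integral mu f A w + simple_integral mu f B w).
Proof.
move=> mA mB AB; rewrite !simple_integral_fun.
apply: aeq_trans (_ : aeq _ (fun w => \sum_(c <- sfun_values f)
  (c * (mu (f @^-1` [set c] `&` A) w + mu (f @^-1` [set c] `&` B) w)))) _.
  apply: aeq_sum => c _; apply: aeqZ; rewrite setIUr.
  apply: (smU mu_sm); try exact: sfun_preimage_in.
  by rewrite setIACA AB setI0.
by apply: aeq_eq => w; rewrite -big_split /=; apply: eq_bigr => c _; ring.
Qed.

Lemma simple_integral_shrink f (B : nat -> set S) : (forall k, meas_in (B k)) ->
  (forall k, B k.+1 `<=` B k) -> \bigcap_k B k = set0 ->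
  forall e, 0 < e -> exists N, forall C, measurable C -> C `<=` B N ->
  small e (simple_integral mu f C).
Proof.
move=> mB dB B0 e e0.
pose s := 1 + \sum_(c <- sfun_values f) Num.max 1 `|c|.
have s0 : 0 < s.
  by rewrite ltr_pwDl // sumr_ge0 // => c _; rewrite le_max ler01.
have es : 0 < e / s by rewrite divr_gt0.
have [N HN] := sm_shrink_uniform mu_sm mB dB B0 es.
exists N => C mC CB; rewrite simple_integral_fun.
apply: (@small_le _ _ _ P (\sum_(c <- sfun_values f) Num.max 1 `|c| * (e / s))).
  rewrite -mulr_suml mulrA ler_pdivrMr // mulrC ler_pM2l //.
  by rewrite /s lerDr.
apply: small_sum => c; apply: smallZ; apply: HN.
  by apply: measurableI.
by apply: subset_trans CB; exact: subIsetr.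
Qed.

Lemma sfun_partition f A : meas_in A ->
  aeq (mu A) (fun w => \sum_(c <- sfun_values f) mu (f @^-1` [set c] `&` A) w).
Proof.
move=> mA.
have uv : uniq (sfun_values f) by exact: finmap.fset_uniq.
have AE : A = (\bigcup_(c in [set` sfun_values f]) f @^-1` [set c]) `&` A.
  apply/seteqP; split => [t At|t [] //]; split => //.
  exists (f t) => //=; rewrite in_fset_set //; apply/mem_set; by exists t.
have : aeq (mu ((\bigcup_(c in [set` sfun_values f]) f @^-1` [set c]) `&` A))
   (fun w => \sum_(c <- sfun_values f) mu (f @^-1` [set c] `&` A) w).
  elim: (sfun_values f) uv => [|c r IH] /=.
    move=> _; rewrite (_ : [set` [::]] = set0); last by apply/seteqP; split.
    rewrite bigcup_set0 set0I; apply: aeq_trans (sm0 mu_sm) _.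
    by apply: aeq_eq => w; rewrite big_nil.
  move=> /andP[cr ur].
  have -> : [set` c :: r] = c |` [set` r].
    apply/seteqP; split => x /=; rewrite in_cons.
      by move=> /predU1P[->|xr]; [left|right].
    by move=> [->|xr]; [rewrite eqxx|rewrite [x \in r]xr orbT].
  rewrite bigcup_setU1 setIUl.
  apply: aeq_trans (smU mu_sm _ _ _) _.
  - exact: sfun_preimage_in.
  - rewrite setIC; apply: meas_inI => //.
    by apply: fin_bigcup_measurable => [|? _]; [exact: finite_seq|].
  - apply/seteqP; split => t // [[/= fc _] [[c' /= c'r fc'] _]].
    by move: cr; rewrite -fc fc' c'r.
  apply: aeq_trans (aeqD (aeq_refl _ _) (IH ur)) _.
  by apply: aeq_eq => w; rewrite big_cons.
by rewrite -AE.
Qed.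

End simple_integrals.

(** * Step functions with a bounded second moment *)

Section square_integrable.
Import HBSimple.
Context {d} {Omega : measurableType d} {R : realType}.
Variable P : probability Omega R.
Variable T : R.
Hypothesis T_gt0 : 0 < T.
Variable mu : set R -> {RV P >-> R}.
Hypothesis mu_sm : stochastic_measure `[0, T] mu.
Variable mut : R -> {RV P >-> R}.
Hypothesis mut_cont : continuous_version T mu mut.

Notation small := (small P).
Notation tail := (tail P).
Notation aeq := (aeq P).
Notation D := (`]0, T]%classic : set R).
Notation meas_in := (@meas_in _ R D).
Notation path_integral := (path_integral T (fun t => mut t : Omega -> R)).

Let smD := mu_sm' mu_sm.

Lemma cells_partition i A : meas_in A ->
  aeq (mu A) (fun w => \sum_(j < 2 ^ i) mu (clip_cell T i j `&` A) w).
Proof.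
move=> mA; have cin j := clip_cell_in T_gt0 i j.
have mC j : meas_in (clip_cell T i j `&` A) by apply: meas_inI => //; exact: mA.1.
have tC j k : (j < 2 ^ i)%N -> (k < 2 ^ i)%N -> j != k ->
    (clip_cell T i j `&` A) `&` (clip_cell T i k `&` A) = set0.
  by move=> ji ki jk; rewrite setIACA /clip_cell ji ki dyadic_cellI // set0I.
apply: aeq_trans (sm_bigU smD mC tC).
rewrite (_ : \big[setU/set0]_(j < 2 ^ i) _ = A); first exact: aeq_refl.
rewrite -(bigcup_mkord _ (fun j => clip_cell T i j `&` A)).
apply/seteqP; split => t; first by move=> [j _ []].
move=> At; have := mA.2 t At; rewrite /= in_itv /= => t0.
have [ci tc] := cell_bounds T_gt0 i t0.
by exists (cell T i t) => //=; split => //; rewrite /clip_cell ci.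
Qed.

(** On the pieces cut out by the cells and by the level sets of [f] the difference
    [f - h] is a constant of modulus at most [delta], so that the difference of the
    integrals is [delta] times a combination bounded by [tail_simple_sum]. *)
Lemma simple_integral_near_step (f : {sfun R >-> R}) i h A (delta lambda eta : R) :
  0 < delta -> 0 < lambda ->
  (forall B, meas_in B -> tail (mu B) lambda <= eta) ->
  dyadic_step T i h -> meas_in A -> (forall t, A t -> `|f t - h t| <= delta) ->
  tail (fun w => simple_integral mu f A w -
    \sum_(j < 2 ^ i) h (pt T i j.+1) * mu (clip_cell T i j `&` A) w)
    (delta * (6 * lambda)) <= 52 * eta.
Proof.
move=> d0 l0 hb hi mA near.
set r := sfun_values f; set m := size r; set n := (2 ^ i)%N.
(* The pieces are numbered by [q], which encodes a cell and a value of [f]. *)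
pose val q := nth 0 r (q %% m).
pose E q := f @^-1` [set val q] `&` (clip_cell T i (q %/ m) `&` A).
pose x q := val q - h (pt T i (q %/ m).+1).
(* The alternative occurs only for empty pieces. *)
pose b q := if `|x q| <= delta then x q / delta else 0.
have mCA j : meas_in (clip_cell T i j `&` A).
  by apply: meas_inI mA.1; exact: clip_cell_in.
have mE q : meas_in (E q) by exact: sfun_preimage_in.
have ur : uniq r by exact: finmap.fset_uniq.
have m0 q : (q < n * m)%N -> (0 < m)%N.
  by move=> qn; rewrite lt0n; apply/eqP => z; move: qn; rewrite z muln0.
have tE q q' : (q < n * m)%N -> (q' < n * m)%N -> q != q' -> E q `&` E q' = set0.
  move=> qn qn' qq'; apply/seteqP; split => t // [[/= f1 [c1 _]] [/= f2 [c2 _]]].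
  move/eqP: qq'; apply.
  have e1 : (q %/ m = q' %/ m)%N.
    move: c1 c2; rewrite /clip_cell; case: ifP => // _ c1; case: ifP => // _ c2.
    by rewrite -(cellE T_gt0 c1) (cellE T_gt0 c2).
  have e2 : (q %% m = q' %% m)%N.
    apply/eqP; rewrite -(nth_uniq 0 _ _ ur) ?ltn_mod ?(m0 q) //.
    by rewrite -/(val q) -/(val q') -f1 -f2.
  by rewrite (divn_eq q m) (divn_eq q' m) e1 e2.
have b1 q : -1 <= b q <= 1.
  rewrite /b -ler_norml; case: ifP => [h1|_]; last by rewrite normr0.
  by rewrite normrM normfV (gtr0_norm d0) ler_pdivrMr // mul1r.
have bE q : aeq (fun w => delta * (b q * mu (E q) w)) (fun w => x q * mu (E q) w).
  have [h1|h1] := leP `|x q| delta.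
    by apply: aeq_eq => w; rewrite /b h1; field; rewrite gt_eqF.
  have -> : E q = set0.
    apply/seteqP; split => t // [/= ft [ct At]].
    move: ct; rewrite /clip_cell; case: ifP => // qi ct.
    have := near t At; rewrite ft (hi _ _ qi ct) leNgt => /negP; apply.
    exact: h1.
  by apply: (aeq_le (sm0 smD)) => w ->; rewrite !mulr0.
have key : aeq (fun w => simple_integral mu f A w -
    \sum_(j < 2 ^ i) h (pt T i j.+1) * mu (clip_cell T i j `&` A) w)
  (fun w => delta * \sum_(q < n * m) b q * mu (E q) w).
  have bsum : aeq (fun w => delta * \sum_(q < n * m) b q * mu (E q) w)
      (fun w => \sum_(q < n * m) x q * mu (E q) w).
    apply: aeq_trans (_ : aeq _ (fun w => \sum_(q < n * m) delta * (b q * mu (E q) w))) _.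
      by apply: aeq_eq => w; rewrite mulr_sumr.
    by apply: aeq_sum => q _; exact: bE.
  apply: aeq_trans (aeq_sym bsum).
  have Ejc j c : (c < m)%N -> (j < n)%N -> E (j * m + c)%N =
      f @^-1` [set nth 0 r c] `&` (clip_cell T i j `&` A) /\
      x (j * m + c)%N = nth 0 r c - h (pt T i j.+1).
    move=> cm jn; have e1 : ((j * m + c) %/ m)%N = j.
      by rewrite divnMDl ?divn_small ?addn0 //; exact: leq_ltn_trans cm.
    have e2 : ((j * m + c) %% m)%N = c by rewrite modnMDl modn_small.
    by rewrite /E /x /val e1 e2.
  have h1 : aeq (simple_integral mu f A)
      (fun w => \sum_(j < n) \sum_(c < m) nth 0 r c * mu (E (j * m + c)%N) w).
    rewrite simple_integral_fun.
    apply: aeq_trans (_ : aeq _ (fun w => \sum_(c <- r) \sum_(j < n) c *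
       mu (clip_cell T i j `&` (f @^-1` [set c] `&` A)) w)) _.
      apply: aeq_sum => c _.
      apply: aeq_trans (aeqZ c (cells_partition i (sfun_preimage_in f c mA))) _.
      by apply: aeq_eq => w; rewrite mulr_sumr.
    apply: aeq_eq => w; rewrite exchange_big /=; apply: eq_bigr => j _.
    rewrite (big_nth 0) big_mkord; apply: eq_bigr => c _.
    by rewrite (Ejc j c _ _).1 ?ltn_ord // setICA.
  have h2 : aeq (fun w => \sum_(j < 2 ^ i) h (pt T i j.+1) * mu (clip_cell T i j `&` A) w)
      (fun w => \sum_(j < n) \sum_(c < m) h (pt T i j.+1) * mu (E (j * m + c)%N) w).
    apply: aeq_sum => j _.
    apply: aeq_trans (aeqZ _ (sfun_partition smD f (mCA j))) _.
    apply: aeq_eq => w; rewrite mulr_sumr (big_nth 0) big_mkord; apply: eq_bigr => c _.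
    by rewrite (Ejc j c _ _).1 ?ltn_ord.
  apply: aeq_trans (aeqB h1 h2) _; apply: aeq_eq => w.
  rewrite (sum_pairs (fun q => x q * mu (E q) w)) -sumrB; apply: eq_bigr => j _.
  rewrite -sumrB; apply: eq_bigr => c _.
  by rewrite (Ejc j c _ _).2 ?ltn_ord // mulrBl.
rewrite (aeq_tail _ key).
have := tail_simple_sum smD l0 hb mE tE b1.
apply: le_trans; apply: pr_le => w /=.
by rewrite normrM (gtr0_norm d0) ltr_pM2l.
Qed.

Variable m : {finite_measure set (measurableTypeR R) -> \bar R}.
Hypothesis L2_integrable : forall h : R -> R, measurable_fun `[0, T] h ->
  (\int[m]_(x in `[0%R, T]) ((h x) ^+ 2)%:E < +oo)%E ->
  sm_integrable `[0, T] mu h.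

Definition mass (t : R) : R := fine (m `]0, t]%classic).

Lemma mass_cell i j : mass (pt T i j.+1) - mass (pt T i j) =
  fine (m (dyadic_cell T i j)).
Proof.
have fin A : measurable A -> m A \is a fin_num by move=> mA; exact: fin_num_measure.
have E : `]0, pt T i j.+1]%classic = `]0, pt T i j]%classic `|` dyadic_cell T i j.
  have l0 := pt_ge0 T_gt0 i j; have l1 := pt_le T_gt0 i (leqnSn j).
  apply/seteqP; split => t; rewrite /dyadic_cell /= !in_itv /=.
    by move=> /andP[t0 t1]; case: (leP t (pt T i j)) => h; [left|right]; rewrite ?t0.
  move=> [/andP[-> t1]|/andP[t0 ->]]; first by rewrite (le_trans t1 l1).
  by rewrite (le_lt_trans l0 t0).
rewrite /mass E measureU //; last 2 first.
- exact: measurable_dyadic_cell.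
- apply/seteqP; split => t //; rewrite /dyadic_cell /= in_itv /= => -[/andP[_ h1] /andP[h2 _]].
  by move: h2; rewrite ltNge h1.
rewrite fineD ?fin //; first by ring.
exact: measurable_dyadic_cell.
Qed.

Lemma mass_incr i j : mass (pt T i j) <= mass (pt T i j.+1).
Proof. by rewrite -subr_ge0 mass_cell fine_ge0. Qed.

(** Outside [`]0, T]] a dyadic step function is arbitrary, and need not be
    measurable. *)
Definition clip (h : R -> R) (t : R) : R := if 0 < t <= T then h t else 0.

Lemma clip_step i h : dyadic_step T i h -> forall t,
  clip h t = \sum_(j < 2 ^ i) h (pt T i j.+1) * \1_(dyadic_cell T i j) t.
Proof.
move=> hi t; rewrite /clip; case: ifPn => t0; last first.
  rewrite big1 // => j _; rewrite indicE memNset ?mulr0 // => tj.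
  move/negP: t0; apply; have := dyadic_cell_in T_gt0 (ltn_ord j) tj.
  by rewrite /= in_itv.
have [ci tc] := cell_bounds T_gt0 i t0.
rewrite (bigD1 (Ordinal ci)) //= big1 ?addr0.
  by rewrite indicE mem_set // mulr1; exact: hi.
move=> j ne; rewrite indicE memNset ?mulr0 // => tj; move/eqP: ne; apply.
by apply: val_inj; rewrite /= (cellE T_gt0 tj).
Qed.

Lemma measurable_clip i h : dyadic_step T i h -> measurable_fun setT (clip h).
Proof.
move=> hi; rewrite (_ : clip h = (fun t => \sum_(j < 2 ^ i)
  h (pt T i j.+1) * \1_(dyadic_cell T i j) t)); last first.
  by apply: funext => t; exact: clip_step.
apply: measurable_sum => j; apply: measurable_funM => //.
by apply: measurable_indic; exact: measurable_dyadic_cell.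
Qed.

Lemma integral_clip i h : dyadic_step T i h ->
  (\int[m]_(x in `[0%R, T]) ((clip h x) ^+ 2)%:E = (energy T mass h)%:E)%E.
Proof.
move=> hi; have hi2 : dyadic_step T i (fun t => h t ^+ 2).
  by move=> j t jl tj; rewrite (hi _ _ jl tj).
have mC j : measurable (dyadic_cell T i j) := measurable_dyadic_cell T i j.
rewrite (eq_integral (fun x : measurableTypeR R => \sum_(j < 2 ^ i)
   (h (pt T i j.+1) ^+ 2)%:E * (\1_(dyadic_cell T i j) x)%:E)%E); last first.
  move=> x _; rewrite (_ : clip h x ^+ 2 = clip (fun t => h t ^+ 2) x).
    by rewrite (clip_step hi2) -sumEFin; apply: eq_bigr => j _; rewrite EFinM.
  by rewrite /clip; case: ifP => // _; rewrite expr0n.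
rewrite ge0_integral_sum //; first last.
- move=> j x _; rewrite mule_ge0 // lee_fin ?sqr_ge0 //.
- move=> j; apply: emeasurable_funM => //; apply/measurable_EFinP.
  exact: (measurable_indic (mC j)).
rewrite /energy (step_integralE T_gt0 _ hi2) /dsum -sumEFin; apply: eq_bigr => j _.
rewrite ge0_integralZl_EFin ?sqr_ge0 //; last first.
  by apply/measurable_EFinP; exact: (measurable_indic (mC j)).
rewrite integral_indic; [|by []|exact: mC].
rewrite mass_cell [RHS]EFinM fineK; last by apply: fin_num_measure; exact: mC.
congr (_ * m _)%E; apply/setIidl => t /(dyadic_cell_in T_gt0 (ltn_ord j)).
by rewrite /= !in_itv /= => /andP[/ltW -> ->].
Qed.

(** * Continuity of the integral on square-integrable step functions *)

Section disjoint_sequence.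
Variables (h_ : nat -> R -> R) (c : R).
Hypothesis c_gt0 : 0 < c.
Hypothesis h_step : forall k, exists i, dyadic_step T i (h_ k).
Hypothesis h_energy : forall k, energy T mass (h_ k) <= 2^-1 ^+ k.
Hypothesis h_large : forall k, c <= pr P [set w | 1 <= `|path_integral (h_ k) w|].
Hypothesis h_disjoint : forall k k' t, (k < k')%N -> 0 < t <= T ->
  h_ k t != 0 -> h_ k' t = 0.

(** The sum of the [clip (h_ k)]: at most one of them is nonzero at each point. *)
Definition glued (t : R) : R :=
  xget 0 [set x | x != 0 /\ exists k, x = clip (h_ k) t].

Lemma clip_disjoint k k' t : clip (h_ k) t != 0 -> k != k' -> clip (h_ k') t = 0.
Proof.
rewrite /clip; case: ifP => [t0|_]; last by rewrite eqxx.
move=> hk; rewrite neq_ltn => /orP[kk'|k'k]; first exact: h_disjoint hk.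
by apply/eqP; apply: contraNT hk => h; apply/eqP; exact: h_disjoint h.
Qed.

Lemma gluedE k t : clip (h_ k) t != 0 -> glued t = clip (h_ k) t.
Proof.
move=> hk; rewrite /glued; case: xgetP => [x _ [x0 [k' xE]]|/(_ (clip (h_ k) t))].
  have [->//|kk'] := eqVneq k k'.
  by move: x0; rewrite xE (clip_disjoint hk kk') eqxx.
by move=> nP; exfalso; apply: nP; split => //; exists k.
Qed.

Lemma glued0 t : (forall k, clip (h_ k) t = 0) -> glued t = 0.
Proof.
move=> h0; rewrite /glued; case: xgetP => // x _ [x0 [k xE]].
by move: x0; rewrite xE h0 eqxx.
Qed.

Lemma glued_cases t : (exists k, clip (h_ k) t != 0) \/ (forall k, clip (h_ k) t = 0).
Proof.
case: (pselect (exists k, clip (h_ k) t != 0)) => [|nP]; [by left|right] => k.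
by apply/eqP; apply: contrapT => /negP h; apply: nP; exists k.
Qed.

Lemma measurable_glued : measurable_fun setT glued.
Proof.
apply: (@measurable_fun_cvg _ _ _ _ (fun n t => \sum_(k < n) clip (h_ k) t)).
  move=> n; apply: measurable_sum => k; have [i hi] := h_step k.
  exact: measurable_clip hi.
move=> t _; case: (glued_cases t) => [[k hk]|h0]; last first.
  rewrite glued0 //; under eq_fun do rewrite big1 //.
  exact: cvg_cst.
rewrite (gluedE hk); apply: cvg_near_cst; exists k.+1 => // n /= kn.
rewrite (bigD1 (Ordinal kn)) //= big1 ?addr0 // => j ne.
by apply: clip_disjoint hk _; rewrite eq_sym.
Qed.

Lemma glued_square_integrable :
  (\int[m]_(x in `[0%R, T]) ((glued x) ^+ 2)%:E < +oo)%E.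
Proof.
have mclip k : measurable_fun (`[0, T] : set (measurableTypeR R)) (fun x => ((clip (h_ k) x) ^+ 2)%:E).
  have [i hi] := h_step k; apply/measurable_EFinP; apply: measurable_funX.
  by apply: measurable_funTS; exact: measurable_clip hi.
apply: (@le_lt_trans _ _ (\int[m]_(x in `[0%R, T])
    (\sum_(k <oo) ((clip (h_ k) x) ^+ 2)%:E))%E).
  apply: ge0_le_integral => //.
  - by move=> x _; rewrite lee_fin sqr_ge0.
  - apply/measurable_EFinP; apply: measurable_funX.
    by apply: measurable_funTS; exact: measurable_glued.
  - by apply: ge0_emeasurable_sum => // k x _ _; rewrite lee_fin sqr_ge0.
  move=> x _; case: (glued_cases x) => [[k hk]|h0]; last first.
    by rewrite glued0 // expr0n /= nneseries_ge0 // => n _ _; rewrite lee_fin sqr_ge0.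
  rewrite (gluedE hk).
  apply: (@le_trans _ _ (\sum_(0 <= j < k.+1) ((clip (h_ j) x) ^+ 2)%:E)%E).
    rewrite big_nat_recr //= leeDr //; apply: sume_ge0 => j _.
    by rewrite lee_fin sqr_ge0.
  by apply: nneseries_lim_ge => j _ _; rewrite lee_fin sqr_ge0.
rewrite integral_nneseries //; last by move=> k x _; rewrite lee_fin sqr_ge0.
apply: (@le_lt_trans _ _ 2%:E); last exact: ltry.
apply: lime_le; first by apply: is_cvg_nneseries => k _ _; apply: integral_ge0 => x _; rewrite lee_fin sqr_ge0.
apply: nearW => n.
apply: (@le_trans _ _ (\sum_(0 <= k < n) (2^-1 ^+ k)%:E)%E).
  apply: lee_sum => k _; have [i hi] := h_step k.
  by rewrite (integral_clip hi) lee_fin.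
rewrite sumEFin lee_fin; have -> : \sum_(0 <= k < n) (2^-1 : R) ^+ k = 2 - 2 * 2^-1 ^+ n.
  elim: n => [|n IH]; first by rewrite big_geq // expr0; ring.
  by rewrite big_nat_recr //= IH exprS; field.
by rewrite lerBlDr lerDl mulr_ge0 // exprn_ge0 // invr_ge0.
Qed.

(** On the support [Rk k] of [h_ k] the approximations [f_ n] of [glued] converge to
    [h_ k]. Away from the part [Off k n] of the support where some later approximation
    is still far from it, the integrals of [f_ n] and of [h_ k] are close by
    [simple_integral_near_step], and the integral of [h_ k] over [Off k n] is small
    by [sm_shrink_uniform]. So the integrals of the [f_ n] over [Rk k `\` Off k n] are
    not small, which contradicts [gliding_hump]. *)
Lemma disjoint_sequence_absurd : False.
Proof.
have [mh [f_ [f_cvg f_int]]] := L2_integrable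
  (measurable_funTS measurable_glued) glued_square_integrable.
have c8 : 0 < c / 8 / 52 by rewrite !divr_gt0.
have [lambda l0 hb] := range_bounded T_gt0 mu_sm mut_cont c8.
(* Uniform errors below [delta] contribute [delta * (6 * lambda) = 1 / 4]. *)
pose delta := 1 / (24 * lambda).
have d0 : 0 < delta by rewrite divr_gt0 // mulr_gt0.
have dl : delta * (6 * lambda) = 1 / 4 by rewrite /delta; field; rewrite gt_eqF.
have sub0T (A : set R) : A `<=` D -> A `<=` `[0, T].
  move=> AD t /AD; rewrite /= !in_itv /= => /andP[/ltW -> ->] //.
pose Rk k := D `&` [set t | h_ k t != 0].
have mRk k : measurable (Rk k).
  have [i hi] := h_step k.
  rewrite (_ : Rk k = D `&` [set t | h_ k (pt T i (cell T i t).+1) != 0]).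
    exact: (measurable_cells T_gt0 i (fun j => h_ k (pt T i j.+1) != 0)).
  apply/seteqP; split => t [tD /= ht]; split => //=; move: tD; rewrite /= in_itv /= => t0;
    have [ci tc] := cell_bounds T_gt0 i t0; move: ht; by rewrite (hi _ _ ci tc).
have hRk k t : Rk k t -> glued t = h_ k t.
  move=> [tD /= ht]; have ct : clip (h_ k) t = h_ k t.
    by rewrite /clip; move: tD; rewrite /= in_itv /= => ->.
  by rewrite -ct; apply: gluedE; rewrite ct.
pose Off k n := Rk k `&` \bigcup_(n' in [set n' | (n <= n')%N])
  (`[0, T] `&` [set t | delta < `|f_ n' t - glued t|]).
have mOff k n : meas_in (Off k n).
  split; last by apply: subset_trans (@subIsetl _ _ _) _; exact: subIsetl.
  apply: measurableI => //; apply: bigcup_measurable => n' _.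
  have mm : measurable_fun `[0, T] (fun t => f_ n' t - glued t).
    by apply: measurable_funB => //; apply: measurable_funTS.
  rewrite (_ : [set t | _] = (fun t => `|f_ n' t - glued t|) @^-1` `]delta, +oo[).
    by apply: (measurableT_comp (@normr_measurable R setT) mm).
  by apply/seteqP; split => t /=; rewrite in_itv /= andbT.
have dOff k n : Off k n.+1 `<=` Off k n.
  by move=> t [Rt [n' /= nn' h]]; split => //; exists n' => //=; exact: ltnW.
have Off0 k : \bigcap_n Off k n = set0.
  apply/seteqP; split => t // H; have [Rt [n0 _ [tT _]]] := H 0%N I.
  have := f_cvg t tT => /cvgrPdist_le /(_ delta d0)[N _ HN].
  have [_ [n' /= nn' [_ /= h]]] := H N I.
  by have := HN n' nn'; rewrite distrC leNgt h.
have sOff k := sm_shrink_uniform smD (mOff k) (dOff k) (Off0 k).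
have key k : exists A, [/\ meas_in A, A `<=` Rk k & exists N, forall n, (N <= n)%N ->
    c / 2 <= tail (simple_integral mu (f_ n) A) (3 / 8)].
  have [i hi] := h_step k.
  pose a j := h_ k (pt T i j.+1).
  pose s := 1 + \sum_(j < 2 ^ i) Num.max 1 `|a j|.
  have s0 : 0 < s by rewrite ltr_pwDl // sumr_ge0 // => j _; rewrite le_max ler01.
  pose e := Num.min (c / 8) (1 / 4).
  have e0 : 0 < e by rewrite lt_min; apply/andP; split; lra.
  have ec : e <= c / 8 by rewrite ge_min lexx.
  have e4 : e <= 1 / 4 by rewrite ge_min lexx orbT.
  have es0 : 0 < e / s by rewrite divr_gt0.
  have [N HN] := sOff k _ es0.
  pose A := Rk k `\` Off k N.
  have mA : meas_in A.
    split; first by apply: measurableD => //; exact: (mOff k N).1.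
    by apply: subset_trans (@subDsetl _ _ _) _; exact: subIsetl.
  exists A; split => //; first exact: subDsetl.
  exists N => n Nn.
  pose X w := \sum_(j < 2 ^ i) a j * mu (clip_cell T i j `&` A) w.
  pose Y w := \sum_(j < 2 ^ i) a j * mu (clip_cell T i j `&` Off k N) w.
  have IXY : aeq (path_integral (h_ k)) (fun w => X w + Y w).
    apply: aeq_trans (path_integral_aeq T_gt0 mu_sm mut_cont hi) _.
    apply: aeq_trans (_ : aeq _ (fun w => \sum_(j < 2 ^ i) (a j *
      mu (clip_cell T i j `&` A) w + a j * mu (clip_cell T i j `&` Off k N) w))) _;
      last by apply: aeq_eq => w; rewrite big_split.
    apply: aeq_sum => j _; have [aj0|aj] := eqVneq (a j) 0.
      by apply: aeq_eq => w; rewrite -/(a j) aj0 !mul0r addr0.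
    have E : dyadic_cell T i j = (clip_cell T i j `&` A) `|` (clip_cell T i j `&` Off k N).
      rewrite -setIUr /clip_cell ltn_ord /A setUC setDUK; last exact: subIsetl.
      apply/esym/setIidl => t tj; split; first exact: dyadic_cell_in tj.
      by rewrite /= (hi _ _ (ltn_ord j) tj).
    have := smU smD (meas_inI (clip_cell_in T_gt0 i j) mA.1)
      (meas_inI (clip_cell_in T_gt0 i j) (mOff k N).1) _.
    rewrite -E => /(_ _) H; apply: (aeq_le (H _)) => [|w ->]; last by rewrite mulrDr.
    by apply/seteqP; split => t // [[_ [_ nO]] [_ tO]]; exact: nO.
  have tY : tail Y (1 / 4) <= c / 8.
    have sY : small e Y.
      apply: (@small_le _ _ _ P (\sum_(j < 2 ^ i) Num.max 1 `|a j| * (e / s))).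
        rewrite -mulr_suml mulrA ler_pdivrMr // mulrC ler_pM2l //.
        by rewrite /s lerDr.
      apply: small_sum => j; apply: smallZ; apply: HN; last exact: subIsetr.
      by apply: measurableI; [exact: (clip_cell_in T_gt0 i j).1|exact: (mOff k N).1].
    apply: le_trans ec; apply: le_trans sY; exact: tail_le.
  have tX : tail (fun w => simple_integral mu (f_ n) A w - X w) (1 / 4) <= c / 8.
    rewrite -dl [leRHS](_ : _ = 52 * (c / 8 / 52)); last by field.
    apply: simple_integral_near_step => // t [Rt nO].
    rewrite leNgt; apply/negP => h; apply: nO; split => //; exists n => //; split.
      by apply: (sub0T D) => //; exact: Rt.1.
    by rewrite /= (hRk k t Rt).
  have E : aeq (path_integral (h_ k)) (fun w => simple_integral mu (f_ n) A w +
      (Y w - (simple_integral mu (f_ n) A w - X w))).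
    by apply: aeq_trans IXY _; apply: aeq_eq => w; ring.
  have h1 : c <= tail (path_integral (h_ k)) (3 / 8 + (1 / 4 + 1 / 4)).
    apply: le_trans (h_large k) _; apply: pr_le => w /=; apply: lt_le_trans; lra.
  rewrite (aeq_tail _ E) in h1.
  have h2 := tailD P (simple_integral mu (f_ n) A)
    (fun w => Y w - (simple_integral mu (f_ n) A w - X w)) (3 / 8) (1 / 4 + 1 / 4).
  have h3 := tailB P Y (fun w => simple_integral mu (f_ n) A w - X w) (1 / 4) (1 / 4).
  lra.
have /choice[A AP] := key.
have tA : trivIset setT A.
  have dis k k' : (k < k')%N -> A k `&` A k' = set0.
    move=> kk'; apply/seteqP; split => t // [At At'].
    have [_ /(_ t At) [tD h1] _] := AP k; have [_ /(_ t At') [_ h2] _] := AP k'.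
    by move: h2; rewrite /= (h_disjoint kk' _ h1) ?eqxx.
  apply/trivIsetP => k k' _ _; rewrite neq_ltn => /orP[/dis //|/dis].
  by rewrite setIC.
apply: (@gliding_hump _ _ _ P _ R D (fun n => simple_integral mu (f_ n)) _ _ _ A (c / 2) (3 / 8)).
- by move=> n B C mB mC BC; exact: (simple_integralU smD).
- by move=> n B mB dB B0 e e0; exact: (simple_integral_shrink smD).
- move=> B mB e e0; have e2 : 0 < e / 2 by rewrite divr_gt0.
  have [xi Hxi] := f_int B mB.1 (sub0T _ mB.2).
  have [N HN] := cvg_in_probability_small (fun n => measurable_simple_integral mu (f_ n) B)
    (measurable_funPT xi) Hxi e2.
  exists N => p q Np Nq; rewrite [e]splitr.
  apply: aeq_small (smallB (HN p Np) (HN q Nq)).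
  by apply: aeq_eq => w; ring.
- by lra.
- by [].
- by move=> k; have [] := AP k.
- exact: tA.
- by move=> k; have [] := AP k.
Qed.

End disjoint_sequence.

(** If the integrals were unbounded in probability, [thinning_sequence] would
    provide a sequence excluded by [disjoint_sequence_absurd]. *)
Theorem L2_step_bounded (eta : R) : 0 < eta -> exists2 lambda, 0 < lambda &
  forall i h, dyadic_step T i h -> energy T mass h <= 1 ->
  tail (path_integral h) lambda <= eta.
Proof.
move=> eta0; apply: contrapT => H.
pose HH h := (exists i, dyadic_step T i h) /\ energy T mass h <= 1.
have unb N : 0 < N -> exists2 h, HH h &
    Num.min eta 1 <= pr P [set w | N <= `|path_integral h w|].
  move=> N0; apply: contrapT => nH; apply: H; exists N => // i h hi h1.
  rewrite leNgt; apply/negP => Hh; apply: nH; exists h; first by split => //; exists i.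
  apply: (@le_trans _ _ eta); first by rewrite ge_min lexx.
  by apply: (le_trans (ltW Hh)); apply: pr_le => w /=; exact: ltW.
have th01 : 0 < Num.min eta 1 <= 1 by rewrite lt_min eta0 ltr01 ge_min lexx orbT.
have res i s h : HH h -> HH (restrict_to T i s h).
  move=> [[l hl] h1].
  have hl' : dyadic_step T (maxn i l) h.
    by apply: dyadic_step_le hl => //; exact: leq_maxr.
  have hr := dyadic_step_restrict T_gt0 s (leq_maxl i l) hl'.
  split; first by exists (maxn i l).
  apply: le_trans h1; rewrite /energy.
  have sq g : dyadic_step T (maxn i l) g -> dyadic_step T (maxn i l) (fun t => g t ^+ 2).
    by move=> hg j t jl tj; rewrite (hg _ _ jl tj).
  rewrite (step_integralE T_gt0 _ (sq _ hr)) (step_integralE T_gt0 _ (sq _ hl')).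
  apply: ler_sum => j _; apply: ler_wpM2r; first by rewrite subr_ge0 mass_incr.
  by rewrite /restrict_to; case: ifP => // _; rewrite expr0n sqr_ge0.
have [h_ [h1 h2 h3 h4]] := @thinning_sequence _ _ _ P T T_gt0 (fun t => mut t) (fun t => measurable_funPT _)
  mass mass_incr HH (fun h hh => hh.1) res (fun h hh => hh.2)
  (mut_small_increments T_gt0 mut_cont) _ th01 unb.
have c0 : 0 < Num.min eta 1 / 1024 / 8 by case/andP: th01; lra.
exact: (disjoint_sequence_absurd c0 (fun k => (h1 k).1) h2 h3 h4).
Qed.

End square_integrable.

(** * Oscillation of the path over a coarse grid *)

Section coarse_oscillation.
Context {d} {Omega : measurableType d} {R : realType}.
Variable P : probability Omega R.
Variable T : R.
Hypothesis T_gt0 : 0 < T.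
Variable mt : R -> Omega -> R.
Hypothesis mmt : forall t, measurable_fun setT (mt t).
Variable M : R -> R.
Hypothesis M_incr : forall i j, M (pt T i j) <= M (pt T i j.+1).
Variables lambda eta : R.
Hypothesis lambda_gt0 : 0 < lambda.
Hypothesis bounded : forall i h, dyadic_step T i h -> energy T M h <= 1 ->
  tail P (path_integral T mt h) lambda <= eta.
Variables a k : nat.

Let b := (a + k)%N.

(** The oscillation of the path between the [j]-th point of the fine grid and
    the last point of the coarse grid that precedes it. *)
Definition coarse_diff (j : nat) (w : Omega) : R :=
  mt (pt T b j) w - mt (pt T a (j %/ 2 ^ k)) w.

Let M0 := M T - M 0.

Let M0_ge0 : 0 <= M0.
Proof.
have E : pt T 0 1 = T by rewrite -[1%N]/(2 ^ 0)%N pt_end.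
by have := M_incr 0 0; rewrite pt0 E /M0 subr_ge0.
Qed.

(* The weight for which the mean energy in [avg_signed_energy] is at most [1 / 24]. *)
Let q : R := Num.sqrt (24 * (M0 + 1) * 2 ^+ k)^-1.

Let c_gt0 : 0 < 24 * (M0 + 1) * 2 ^+ k.
Proof. have := M0_ge0; have : 0 < 2 ^+ k :> R by rewrite exprn_gt0.
by move=> h1 h2; rewrite mulr_gt0 // mulr_gt0 //; lra. Qed.

Let q2 : q ^+ 2 = (24 * (M0 + 1) * 2 ^+ k)^-1.
Proof. by rewrite sqr_sqrtr // invr_ge0 ltW. Qed.

(** The fine cells between the coarse point that precedes the [j]-th fine point and
    that point: the increment [coarse_diff j] is the sum of the increments over them. *)
Definition between (j c : nat) : bool := ((j %/ 2 ^ k) * 2 ^ k <= c < j)%N.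

(** Its integral is the Rademacher sum of the [q * coarse_diff j]. *)
Definition signed_step (s : nat -> bool) (t : R) : R :=
  \sum_(j < 2 ^ b) (if s j then q else - q) * (between j (cell T b t))%:R.

Lemma signed_step_dyadic s : dyadic_step T b (signed_step s).
Proof.
by move=> c t cb tc; rewrite /signed_step cell_pt // (cellE T_gt0 tc).
Qed.

Lemma coarse_diff_sum j w : (j < 2 ^ b)%N -> coarse_diff j w =
  \sum_(c < 2 ^ b) (between j c)%:R * (mt (pt T b c.+1) w - mt (pt T b c) w).
Proof.
move=> jb; pose F c := (between j c)%:R * (mt (pt T b c.+1) w - mt (pt T b c) w).
set l := ((j %/ 2 ^ k) * 2 ^ k)%N; have lj : (l <= j)%N by exact: leq_divM.
rewrite -(big_mkord xpredT F) (big_cat_nat (leq0n l) (leq_trans lj (ltnW jb))).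
rewrite (big_cat_nat lj (ltnW jb)) /= big_nat_cond big1 ?add0r; last first.
  by move=> c /andP[/andP[_ cl] _]; rewrite /F /between -/l leqNgt cl /= mul0r.
rewrite [X in _ + X]big_nat_cond [X in _ + X]big1 ?addr0; last first.
  by move=> c /andP[/andP[jc _] _]; rewrite /F /between ltnNge jc andbF mul0r.
rewrite (eq_big_nat _ _ (F2 := fun c => mt (pt T b c.+1) w - mt (pt T b c) w)).
  rewrite telescope_sumr // /coarse_diff; congr (_ - _).
  by rewrite /b /l pt_refine.
by move=> c /andP[lc cj]; rewrite /F /between -/l lc cj mul1r.
Qed.

Lemma signed_step_integral s w : path_integral T mt (signed_step s) w =
  \sum_(j < 2 ^ b) (if s j then q * coarse_diff j w else - (q * coarse_diff j w)).
Proof.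
rewrite /path_integral (step_integralE T_gt0 _ (signed_step_dyadic s)) /dsum.
under eq_bigr do rewrite /signed_step mulr_suml.
rewrite exchange_big /=; apply: eq_bigr => j _.
rewrite coarse_diff_sum //; case: (s j); rewrite ?mulr_sumr -?sumrN;
  by apply: eq_bigr => c _; rewrite cell_pt // ?mulrA ?mulNr.
Qed.

(** A fine cell lies below at most [2 ^ k] fine points of the same coarse cell. This
    is the gain of the factor [2 ^ - a] over an arbitrary combination. *)
Lemma between_count c :
  \sum_(j < 2 ^ b) ((between j c)%:R : R) <= 2 ^+ k.
Proof.
have p2 : (0 < 2 ^ k)%N by rewrite expn_gt0.
have cond j : between j c -> (j %/ 2 ^ k == c %/ 2 ^ k)%N.
  move=> /andP[h1 h2]; rewrite eqn_leq leq_divRL // h1 /=.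
  by rewrite leq_div2r // ltnW.
apply: (@le_trans _ _ (\sum_(j < 2 ^ a * 2 ^ k) (j %/ 2 ^ k == c %/ 2 ^ k)%N%:R)).
  rewrite -expnD; apply: ler_sum => j _; rewrite ler_nat.
  by case: (boolP (between j c)) => // /cond ->.
rewrite (sum_pairs (fun j => (j %/ 2 ^ k == c %/ 2 ^ k)%N%:R)).
apply: (@le_trans _ _ (\sum_(j < 2 ^ a) (j == c %/ 2 ^ k :> nat)%N%:R * 2 ^+ k)).
  apply: ler_sum => j _; rewrite le_eqVlt; apply/orP; left; apply/eqP.
  rewrite (eq_bigr (fun=> (j == c %/ 2 ^ k :> nat)%N%:R)).
    by rewrite sumr_const card_ord -[LHS]mulr_natr natrX.
  by move=> r _; rewrite divnMDl // divn_small ?addn0.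
rewrite -mulr_suml ler_piMl ?exprn_ge0 //.
case: (ltnP (c %/ 2 ^ k) (2 ^ a)) => h.
  rewrite (bigD1 (Ordinal h)) //= eqxx big1 ?addr0 // => j ne.
  rewrite (_ : (_ == _) = false) //; apply/eqP => e; move/eqP: ne; apply.
  exact: val_inj.
rewrite big1 // => j _; rewrite (_ : (_ == _) = false) //.
by apply/eqP => e; move: h; rewrite -e leqNgt ltn_ord.
Qed.

Lemma avg_signed_energy :
  avg (fun=> 2^-1) (2 ^ b) (fun s => energy T M (signed_step s)) <= 24^-1.
Proof.
have E s : energy T M (signed_step s) = \sum_(c < 2 ^ b)
    (M (pt T b c.+1) - M (pt T b c)) * (\sum_(j < 2 ^ b)
      (if s j then q * (between j c)%:R else - (q * (between j c)%:R))) ^+ 2.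
  have h2 : dyadic_step T b (fun t => signed_step s t ^+ 2).
    by move=> c t cb tc; rewrite (signed_step_dyadic s cb tc).
  rewrite /energy (step_integralE T_gt0 _ h2); apply: eq_bigr => c _.
  rewrite mulrC; congr (_ * _ ^+ 2); apply: eq_bigr => j _.
  by rewrite cell_pt //; case: (s j); rewrite ?mulNr.
rewrite (funext E).
rewrite (avg_sum _ _ _ (fun c s => (M (pt T b c.+1) - M (pt T b c)) * (\sum_(j < 2 ^ b)
      (if s j then q * (between j c)%:R else - (q * (between j c)%:R))) ^+ 2)).
apply: (@le_trans _ _ (\sum_(c < 2 ^ b) (M (pt T b c.+1) - M (pt T b c)) * (q ^+ 2 * 2 ^+ k))).
  apply: ler_sum => c _; rewrite avgZ ler_wpM2l ?subr_ge0 //.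
  rewrite (avg_signed_sum2 (fun j => q * (between j c)%:R)).
  apply: (@le_trans _ _ (q ^+ 2 * \sum_(j < 2 ^ b) (between j c)%:R)).
    rewrite mulr_sumr le_eqVlt; apply/orP; left; apply/eqP; apply: eq_bigr => j _.
    by rewrite exprMn; case: (between _ _); rewrite ?expr1n ?expr0n.
  by rewrite ler_wpM2l ?sqr_ge0 //; exact: between_count.
rewrite -mulr_suml -(big_mkord xpredT (fun c => M (pt T b c.+1) - M (pt T b c))).
rewrite telescope_sumr // pt_end // pt0 -/M0 q2.
have h0 := M0_ge0; have k0 : 0 < 2 ^+ k :> R by rewrite exprn_gt0.
have -> : M0 * ((24 * (M0 + 1) * 2 ^+ k)^-1 * 2 ^+ k) = M0 / (M0 + 1) * 24^-1.
  by field; rewrite !gt_eqF //; lra.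
by rewrite ler_piMl ?invr_ge0 // ler_pdivrMr; lra.
Qed.

(** At least one twelfth of the sign patterns give an integral comparable to the square
    sum, and at most one twenty-fourth give an energy above one. *)
Lemma coarse_square_bounded :
  pr P [set w | 48 * (M0 + 1) * lambda ^+ 2 <
    (\sum_(j < 2 ^ b) coarse_diff j w ^+ 2) / 2 ^+ k] <= 24 * eta.
Proof.
have mD j : measurable_fun setT (coarse_diff j) by exact: measurable_funB.
pose Q w := \sum_(j < 2 ^ b) (q * coarse_diff j w) ^+ 2.
have mQ : measurable_fun setT Q.
  by apply: measurable_sum => j; apply: measurable_funX; apply: measurable_funM.
have h0 := M0_ge0; have k0 : 0 < 2 ^+ k :> R by rewrite exprn_gt0.
have BE : [set w | 48 * (M0 + 1) * lambda ^+ 2 <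
    (\sum_(j < 2 ^ b) coarse_diff j w ^+ 2) / 2 ^+ k] = Q @^-1` `]2 * lambda ^+ 2, +oo[.
  have QE w : Q w = (\sum_(j < 2 ^ b) coarse_diff j w ^+ 2) / 2 ^+ k / (24 * (M0 + 1)).
    rewrite /Q (eq_bigr (fun j : 'I_(2 ^ b) => q ^+ 2 * coarse_diff j w ^+ 2)); last first.
      by move=> j _; rewrite exprMn.
    by rewrite -mulr_sumr q2; field; rewrite !gt_eqF //; lra.
  have p24 : 0 < 24 * (M0 + 1) by lra.
  have e48 : 2 * lambda ^+ 2 * (24 * (M0 + 1)) = 48 * (M0 + 1) * lambda ^+ 2 by ring.
  by apply/seteqP; split => w /=; rewrite in_itv /= andbT QE (ltr_pdivlMr _ _ p24) e48.
rewrite BE; set B := _ @^-1` _.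
have mB : measurable B by rewrite -[X in measurable X]setTI; exact: mQ.
pose A s := [set w | lambda < `|path_integral T mt (signed_step s) w|] `&`
   [set w | energy T M (signed_step s) < 1].
have mA s : measurable (A s).
  apply: measurableI; first exact: measurable_gt_norm (measurable_path_integral _ _ _).
  case: (pselect (energy T M (signed_step s) < 1)) => h.
    by rewrite (_ : [set _ | _] = setT) //; apply/seteqP; split.
  by rewrite (_ : [set _ | _] = set0) //; apply/seteqP; split.
have eta0 : 0 <= eta.
  apply: le_trans (tail_ge0 _ _ _) (@bounded 0%N (fun=> 0) _ _) => //.
  rewrite /energy (step_integralE T_gt0 (i := 0%N)) // /dsum big1 // => j _.
  by rewrite expr0n /= mul0r.
have i24 : 0 <= 24^-1 :> R by rewrite invr_ge0.
have := avg_pr_ge (n := 2 ^ b) P is_prob_half mA mB i24.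
move=> H; have {}H : 24^-1 * pr P B <= eta.
  apply: le_trans (H _) _; last first.
    rewrite -[leRHS](avg_cst (fun=> 2^-1) (2 ^ b)); apply: avg_le => [|s]; first exact: is_prob_half.
    have [h|h] := ltP (energy T M (signed_step s)) 1; last first.
      rewrite (_ : A s = set0); first by rewrite pr0.
      by apply/seteqP; split => w // [_ /=]; rewrite ltNge h.
    apply: le_trans (bounded (signed_step_dyadic s) (ltW h)).
    by apply: pr_le; exact: subIsetl.
  move=> w; rewrite /B /= in_itv /= andbT => wB.
  have PZ := rademacher_lower (x := fun j => q * coarse_diff j w) (erefl (Q w)).
  have MK := avg_markov (2 ^ b) is_prob_half ltr01
    (fun s => energy_ge0 T_gt0 M_incr (ex_intro _ b (signed_step_dyadic s))).
  have := avg_signed_energy; rewrite divr1 in MK => EN.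
  apply: (@le_trans _ _ (avg (fun=> 2^-1) (2 ^ b) (fun s =>
    (Q w / 2 <= (\sum_(j < 2 ^ b) (if s j then q * coarse_diff j w else - (q * coarse_diff j w))) ^+ 2)%R%:R
    - (1 <= energy T M (signed_step s))%R%:R))).
    rewrite avgB; move: PZ MK EN; lra.
  apply: avg_le => [|s]; first exact: is_prob_half.
  rewrite -signed_step_integral.
  case: (leP 1 (energy T M (signed_step s))) => e1.
    apply: (@le_trans _ _ 0); last by rewrite indicE ler0n.
    by rewrite subr_le0 ler_nat; case: (_ <= _)%R.
  rewrite subr0; case: (leP (Q w / 2)) => h; last by rewrite indicE ler0n.
  rewrite indicE mem_set //; split => //=.
  rewrite ltNge; apply/negP => h2.
  have : `|path_integral T mt (signed_step s) w| ^+ 2 <= lambda ^+ 2.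
    by rewrite lerXn2r ?nnegrE // ltW.
  rewrite real_normK ?num_real //; lra.
lra.
Qed.

End coarse_oscillation.

(** * The flow and its inverse *)

Section mean_value.
Context {R : realType}.
Implicit Types (f df : R -> R).

Lemma is_derive_within_continuous f df (a b : R) :
  (forall x : R, is_derive x 1 f (df x)) -> {within `[a, b], continuous f}.
Proof.
move=> fd; apply: derivable_within_continuous => x _.
by have [] := fd x.
Qed.

Lemma derive_bound_lipschitz f df (k C : R) :
  (forall x : R, is_derive x 1 f (df x)) -> (forall x, `|x| <= k -> `|df x| <= C) ->
  forall a b, `|a| <= k -> `|b| <= k -> `|f b - f a| <= C * `|b - a|.
Proof.
move=> fd dfC a b.
wlog ab : a b / a < b.
  move=> H ak bk; have [/H|/H|->] := ltgtP a b; [exact| |by rewrite !subrr normr0 mulr0].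
  by rewrite distrC (distrC b); exact.
move=> ak bk; have [c] := MVT ab (fun x _ => fd x) (is_derive_within_continuous fd).
rewrite in_itv /= => /andP[ac cb] ->; rewrite normrM ler_wpM2r //; apply: dfC.
by move: ak bk; rewrite !ler_norml; lra.
Qed.

Lemma derive_bound_lipschitz_all f df (C : R) :
  (forall x : R, is_derive x 1 f (df x)) -> (forall x, `|df x| <= C) ->
  forall a b, `|f b - f a| <= C * `|b - a|.
Proof.
move=> fd dfC a b.
apply: (@derive_bound_lipschitz f df (Num.max `|a| `|b|)) => //.
  by rewrite le_max lexx.
by rewrite le_max lexx orbT.
Qed.

(** A limit as [h] tends to [0] from above. *)
Lemma le_small_multiples (x y C : R) : 0 <= C ->
  (forall h, 0 < h -> x <= y + C * h) -> x <= y.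
Proof.
move=> C0 H; apply/ler_addgt0Pr => e e0.
have c1 : 0 < C + 1 by rewrite ltr_wpDl.
apply: le_trans (H (e / (C + 1)) _) _; first by rewrite divr_gt0.
rewrite lerD2l mulrA ler_pdivrMr // mulrC ler_wpM2l ?ltW //; lra.
Qed.

Lemma expR_dist_le (u v k : R) : u <= k -> v <= k ->
  `|expR u - expR v| <= expR k * `|u - v|.
Proof.
wlog uv : u v / u <= v.
  move=> H uk vk; have [/H|/ltW /H] := leP u v; first exact.
  by rewrite distrC (distrC u); exact.
move=> uk vk; rewrite distrC ger0_norm ?subr_ge0 ?ler_expR //.
rewrite (distrC u) [`|v - u|]ger0_norm ?subr_ge0 //.
have -> : expR u = expR v * expR (u - v) by rewrite -expRD; congr expR; ring.
have h := expR_ge1Dx (u - v).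
have : expR v * (1 - expR (u - v)) <= expR v * (v - u).
  by rewrite ler_wpM2l ?expR_ge0 //; lra.
have : expR v * (v - u) <= expR k * (v - u).
  by rewrite ler_wpM2r ?subr_ge0 // ler_expR.
lra.
Qed.

End mean_value.

Section flow.
Context {R : realType}.
Variables (sigma : R -> R) (F H : R -> R -> R) (K1 K2 : R).
Hypothesis sigma_C2 : class_C 2 sigma.
Hypothesis sigma1_le : forall x, `|derive1 sigma x| <= K1.
Hypothesis sigma2_le : forall x, `|derive1n 2 sigma x| <= K2.
Hypothesis F_flow : is_flow sigma F.
Hypothesis H_inv : is_flow_inverse F H.

Let K1_ge0 : 0 <= K1. Proof. exact: le_trans (sigma1_le 0). Qed.
Let K2_ge0 : 0 <= K2. Proof. exact: le_trans (sigma2_le 0). Qed.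

Lemma sigma_derive (x : R) : is_derive x 1 sigma (derive1 sigma x).
Proof. by rewrite derive1E; apply: derivableP; exact: (sigma_C2.1 0%N). Qed.

Lemma sigma1_derive (x : R) : is_derive x 1 (derive1 sigma) (derive1n 2 sigma x).
Proof.
by rewrite derive1nS derive1n1 derive1E; apply: derivableP; exact: (sigma_C2.1 1%N).
Qed.

Lemma sigma_lipschitz a b : `|sigma b - sigma a| <= K1 * `|b - a|.
Proof. exact: derive_bound_lipschitz_all sigma_derive sigma1_le _ _. Qed.

Lemma sigma1_lipschitz a b : `|derive1 sigma b - derive1 sigma a| <= K2 * `|b - a|.
Proof. exact: derive_bound_lipschitz_all sigma1_derive sigma2_le _ _. Qed.

Definition slope (u v : R) : R := (sigma u - sigma v) / (u - v).

Lemma slope_le u v : u != v -> `|slope u v| <= K1.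
Proof.
move=> uv; rewrite /slope normrM normfV ler_pdivrMr; last by rewrite normr_gt0 subr_eq0.
exact: sigma_lipschitz.
Qed.

(** The mean value theorem and the Lipschitz continuity of [derive1 sigma]. *)
Lemma slope_near u v : u != v -> `|slope u v - derive1 sigma v| <= K2 * `|u - v|.
Proof.
have mid a b : a < b -> exists2 c, a < c < b & sigma b - sigma a = derive1 sigma c * (b - a).
  move=> ab; have [c] := MVT ab (fun x _ => sigma_derive x) (is_derive_within_continuous sigma_derive).
  by rewrite in_itv /= => ?; exists c.
move=> uv; suff [c cuv sc] : exists2 c, `|c - v| <= `|u - v| & slope u v = derive1 sigma c.
  rewrite sc; apply: le_trans (sigma1_lipschitz _ _) _.
  by rewrite ler_wpM2l.
rewrite /slope; move: uv; rewrite neq_lt => /orP[uv|vu]; last first.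
  have [c cab E] := mid _ _ vu; exists c; first by rewrite !ger0_norm; lra.
  by rewrite E mulfK // subr_eq0 gt_eqF.
have [c cab E] := mid _ _ uv; exists c; first by rewrite !ler0_norm; lra.
by rewrite -opprB E -mulrN opprB mulfK // subr_eq0 lt_eqF.
Qed.

Lemma F_injective r x y : F r x = F r y -> x = y.
Proof. by move=> /(congr1 (H r)); rewrite !(H_inv r).1. Qed.

(** Along the flow its derivative is the difference quotient [slope], which is
    bounded; the square avoids the sign of the difference. *)
Definition log_dist (x y r : R) : R := ln ((F r x - F r y) ^+ 2) / 2.

Lemma F_derive (x r : R) : is_derive r 1 (F ^~ x) (sigma (F r x)).
Proof. exact: F_flow.1. Qed.

Lemma F_neq x y r : x != y -> F r x != F r y.
Proof. by apply: contra_neq; exact: F_injective. Qed.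

Lemma log_dist_derive x y (r : R) : x != y ->
  is_derive r 1 (log_dist x y) (slope (F r x) (F r y)).
Proof.
move=> xy; have d0 : F r x - F r y != 0 by rewrite subr_eq0; exact: F_neq.
have p0 : 0 < (F r x - F r y) ^+ 2 by rewrite exprn_even_gt0.
have h1 : is_derive r 1 (fun r => F r x - F r y) (sigma (F r x) - sigma (F r y)).
  by apply: is_deriveB; exact: F_derive.
have h2 : is_derive r 1 (fun r => (F r x - F r y) ^+ 2)
    (2 * (F r x - F r y) * (sigma (F r x) - sigma (F r y))).
  rewrite (_ : (fun r => (F r x - F r y) ^+ 2) =
    (fun r => F r x - F r y) * (fun r => F r x - F r y)); last first.
    by apply: funext => u; rewrite expr2.
  by apply: is_derive_eq; rewrite /GRing.scale /= mulr2n; ring.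
have h3 : is_derive r 1 (fun r => ln ((F r x - F r y) ^+ 2))
   (((F r x - F r y) ^+ 2)^-1 * (2 * (F r x - F r y) * (sigma (F r x) - sigma (F r y)))).
  exact: (@is_derive1_comp R (@ln R) (fun r => (F r x - F r y) ^+ 2) r _ _ (is_derive1_ln p0) h2).
have h4 : is_derive r 1 (fun r => 2^-1 * ln ((F r x - F r y) ^+ 2))
   (2^-1 * (((F r x - F r y) ^+ 2)^-1 * (2 * (F r x - F r y) * (sigma (F r x) - sigma (F r y))))).
  exact: (is_deriveZ 2^-1 h3).
rewrite (_ : log_dist x y = (fun r => 2^-1 * ln ((F r x - F r y) ^+ 2))); last first.
  by apply: funext => u; rewrite /log_dist mulrC.
by apply: is_derive_eq h4 _; rewrite /slope; field.
Qed.

Lemma log_dist_exp x y r : x != y -> `|F r x - F r y| = expR (log_dist x y r).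
Proof.
move=> xy; have d0 : 0 < `|F r x - F r y| by rewrite normr_gt0 subr_eq0; exact: F_neq.
rewrite /log_dist -real_normK ?num_real // lnXn //.
have -> : ln `|F r x - F r y| *+ 2 / 2 = ln `|F r x - F r y| by rewrite -mulr_natl; field.
by rewrite lnK.
Qed.

Lemma log_dist0 x y : x != y -> log_dist x y 0 = ln `|x - y|.
Proof.
move=> xy; apply: (can_inj (@expRK R)); rewrite -log_dist_exp // !F_flow.2 lnK //.
by rewrite posrE normr_gt0 subr_eq0.
Qed.

Lemma log_dist_lipschitz x y r r' : x != y ->
  `|log_dist x y r - log_dist x y r'| <= K1 * `|r - r'|.
Proof.
move=> xy; apply: derive_bound_lipschitz_all (fun r => log_dist_derive r xy) _ _ _.
by move=> u; apply: slope_le; exact: F_neq.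
Qed.

Lemma F_lipschitz x y r : `|F r x - F r y| <= expR (K1 * `|r|) * `|x - y|.
Proof.
have [->|xy] := eqVneq x y; first by rewrite !subrr normr0 mulr0.
have d0 : 0 < `|x - y| by rewrite normr_gt0 subr_eq0.
rewrite log_dist_exp // -[in leRHS](lnK (_ : `|x - y| \is Num.pos)) // -expRD ler_expR.
have := log_dist_lipschitz r 0 xy; rewrite log_dist0 // subr0 ler_norml; lra.
Qed.

Lemma F_expansive x y r : expR (- (K1 * `|r|)) * `|x - y| <= `|F r x - F r y|.
Proof.
have [->|xy] := eqVneq x y; first by rewrite !subrr normr0 mulr0.
have d0 : 0 < `|x - y| by rewrite normr_gt0 subr_eq0.
rewrite log_dist_exp // -[in leLHS](lnK (_ : `|x - y| \is Num.pos)) // -expRD ler_expR.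
have := log_dist_lipschitz r 0 xy; rewrite log_dist0 // subr0 ler_norml; lra.
Qed.

(** The logarithm of the difference quotient of [F r] at [x]. *)
Definition log_quot (h r x : R) : R := log_dist (x + h) x r - ln `|h|.

Lemma shift_neq (x h : R) : h != 0 -> x + h != x.
Proof. by move=> h0; rewrite -subr_eq0 addrAC subrr add0r. Qed.

Lemma log_quot_derive h x (r : R) : h != 0 ->
  is_derive r 1 (fun r => log_quot h r x) (slope (F r (x + h)) (F r x)).
Proof.
move=> h0; rewrite -[slope _ _]subr0; apply: is_deriveB.
by apply: log_dist_derive; exact: shift_neq.
Qed.

Lemma log_quot0 h x : h != 0 -> log_quot h 0 x = 0.
Proof.
move=> h0; rewrite /log_quot log_dist0 ?shift_neq //.
by rewrite addrAC subrr add0r subrr.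
Qed.

Lemma slope_quot h x (r k : R) : h != 0 -> `|r| <= k ->
  `|slope (F r (x + h)) (F r x) - derive1 sigma (F r x)|
    <= K2 * expR (K1 * k) * `|h|.
Proof.
move=> h0 rk; apply: le_trans (slope_near _) _; first by apply: F_neq; exact: shift_neq.
rewrite -mulrA ler_wpM2l //; apply: le_trans (F_lipschitz _ _ _) _.
rewrite addrAC subrr add0r ler_wpM2r // ler_expR ler_wpM2l //.
Qed.

(** At [r = 0] both quantities vanish, and their derivatives in [r] are difference quotients
    of [sigma] at neighbouring points, which differ by at most the distance of these
    points since [derive1 sigma] is Lipschitz continuous. *)
Lemma log_quot_dist h h' x y (r k : R) : h != 0 -> h' != 0 -> `|r| <= k ->
  `|log_quot h r x - log_quot h' r y| <=
  K2 * expR (K1 * k) * k * (`|h| + `|h'| + `|x - y|).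
Proof.
move=> h0 h0' rk; have k0 : 0 <= k by exact: le_trans rk.
pose f r := log_quot h r x - log_quot h' r y.
pose df r := slope (F r (x + h)) (F r x) - slope (F r (y + h')) (F r y).
have fd (u : R) : is_derive u 1 f (df u).
  by apply: is_deriveB; exact: log_quot_derive.
have dfb u : `|u| <= k -> `|df u| <= K2 * expR (K1 * k) * (`|h| + `|h'| + `|x - y|).
  move=> uk; have e1 := slope_quot x h0 uk; have e2 := slope_quot y h0' uk.
  have e3 : `|derive1 sigma (F u x) - derive1 sigma (F u y)| <=
      K2 * expR (K1 * k) * `|x - y|.
    apply: le_trans (sigma1_lipschitz _ _) _; rewrite -mulrA ler_wpM2l //.
    apply: le_trans (F_lipschitz _ _ _) _; rewrite ler_wpM2r // ler_expR ler_wpM2l //.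
  rewrite !mulrDr.
  have -> : df u = (slope (F u (x + h)) (F u x) - derive1 sigma (F u x)) -
     (slope (F u (y + h')) (F u y) - derive1 sigma (F u y)) +
     (derive1 sigma (F u x) - derive1 sigma (F u y)) by rewrite /df; ring.
  apply: le_trans (ler_normD _ _) _; apply: lerD => //.
  by apply: le_trans (ler_normB _ _) _; apply: lerD.
have := derive_bound_lipschitz fd dfb (a := 0) (b := r); rewrite normr0 => /(_ k0 rk).
rewrite /f !log_quot0 // subrr !subr0 => H1; apply: le_trans H1 _.
have C0 : 0 <= K2 * expR (K1 * k) * (`|h| + `|h'| + `|x - y|).
  by rewrite mulr_ge0 ?addr_ge0 // mulr_ge0 // expR_ge0.
have := ler_wpM2l C0 rk; lra.
Qed.

(** By [log_quot_dist] this is the limit of [log_quot h r x] as [h] tends to [0], with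
    the rate of [log_deriv_near]; so it is the logarithm of the derivative of [F r]
    at [x]. Writing the limit as a supremum of lower bounds makes the rate immediate. *)
Definition log_deriv (r x : R) : R := sup [set y | exists2 h, h != 0 &
  y = log_quot h r x - K2 * expR (K1 * `|r|) * `|r| * `|h|].

Lemma log_deriv_near h r x : h != 0 ->
  `|log_quot h r x - log_deriv r x| <= K2 * expR (K1 * `|r|) * `|r| * `|h|.
Proof.
move=> h0; set C := K2 * expR (K1 * `|r|) * `|r|.
set S := [set y | exists2 h, h != 0 & y = log_quot h r x - C * `|h|].
have ub h' : h' != 0 -> ubound S (log_quot h' r x + C * `|h'|).
  move=> h0' _ [k k0 ->].
  have := log_quot_dist x x k0 h0' (lexx `|r|).
  rewrite -/C subrr normr0 addr0 mulrDr ler_norml; lra.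
have S0 : has_sup S.
  split; first by exists (log_quot h r x - C * `|h|); exists h.
  by exists (log_quot h r x + C * `|h|); exact: ub.
have l1 : log_quot h r x - C * `|h| <= log_deriv r x.
  by apply: sup_upper_bound => //; exists h.
have l2 : log_deriv r x <= log_quot h r x + C * `|h|.
  by apply: sup_le_ub; [exact: S0.1|exact: ub].
rewrite ler_norml; lra.
Qed.

Lemma log_deriv_lipschitz_r r r' x : `|log_deriv r x - log_deriv r' x| <= K1 * `|r - r'|.
Proof.
pose C (r : R) := K2 * expR (K1 * `|r|) * `|r|.
have C0 s : 0 <= C s by rewrite mulr_ge0 // mulr_ge0 // expR_ge0.
apply: (@le_small_multiples _ _ _ (C r + C r')); first by rewrite addr_ge0.
move=> h h0; have hn : h != 0 by rewrite gt_eqF.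
have := log_deriv_near r x hn; have := log_deriv_near r' x hn.
rewrite -!/(C _) (gtr0_norm h0).
have : `|log_quot h r x - log_quot h r' x| <= K1 * `|r - r'|.
  rewrite /log_quot opprB addrA subrK.
  by apply: log_dist_lipschitz; exact: shift_neq.
rewrite !ler_norml; lra.
Qed.

Lemma log_deriv_lipschitz_x r k x y : `|r| <= k ->
  `|log_deriv r x - log_deriv r y| <= K2 * expR (K1 * k) * k * `|x - y|.
Proof.
move=> rk; have k0 : 0 <= k by exact: le_trans rk.
pose C (r : R) := K2 * expR (K1 * r) * r.
have C0 s : 0 <= s -> 0 <= C s by move=> s0; rewrite mulr_ge0 // mulr_ge0 // expR_ge0.
apply: (@le_small_multiples _ _ _ (C `|r| + C `|r| + C k + C k)).
  by rewrite !addr_ge0 // C0.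
move=> h h0; have hn : h != 0 by rewrite gt_eqF.
have := log_deriv_near r x hn; have := log_deriv_near r y hn.
have := log_quot_dist x y hn hn rk.
rewrite -!/(C _) (gtr0_norm h0) -/(C k) !mulrDr !mulrDl.
rewrite !ler_norml; lra.
Qed.

Lemma log_deriv_le r x : `|log_deriv r x| <= K1 * `|r|.
Proof.
have := log_deriv_lipschitz_r r 0 x; rewrite subr0.
suff -> : log_deriv 0 x = 0 by rewrite subr0.
apply/eqP; rewrite -normr_le0; apply: (@le_small_multiples _ _ _ 0) => // h h0.
have hn : h != 0 by rewrite gt_eqF.
by have := log_deriv_near 0 x hn; rewrite log_quot0 // normr0 mulr0 mul0r sub0r normrN mul0r add0r.
Qed.

(** Trajectories do not cross, so the quotient, which is [1] at [r = 0], cannot change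
    its sign. *)
Lemma F_quot_gt0 h r x : h != 0 -> 0 < (F r (x + h) - F r x) / h.
Proof.
move=> h0; rewrite ltNge; apply/negP => neg.
pose f r := (F r (x + h) - F r x) / h.
have f0 : f 0 = 1 by rewrite /f !F_flow.2 addrAC subrr add0r divff.
have fd (u : R) : is_derive u 1 f (h^-1 * (sigma (F u (x + h)) - sigma (F u x))).
  rewrite (_ : f = (fun u => h^-1 * (F u (x + h) - F u x))); last first.
    by apply: funext => s; rewrite /f mulrC.
  by apply: is_deriveZ; apply: is_deriveB; exact: F_derive.
have nz c : f c != 0.
  rewrite mulf_neq0 ?invr_neq0 // subr_eq0.
  by apply: F_neq; exact: shift_neq.
have frn : f r <= 0 by exact: neg.
have [r0|r0] := leP 0 r.
  have [|c _ fc0] := @IVT R f 0 r 0 r0 (is_derive_within_continuous fd).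
  - by rewrite f0 ge_min le_max ler01 frn orbT.
  - by move: (nz c); rewrite fc0 eqxx.
have [|c _ fc0] := @IVT R f r 0 0 (ltW r0) (is_derive_within_continuous fd).
- by rewrite f0 ge_min le_max ler01 frn orbT.
- by move: (nz c); rewrite fc0 eqxx.
Qed.

Lemma F_quot_exp h r x : h != 0 -> (F r (x + h) - F r x) / h = expR (log_quot h r x).
Proof.
move=> h0; rewrite -[LHS]gtr0_norm; last exact: F_quot_gt0.
rewrite normrM normfV log_dist_exp ?shift_neq // /log_quot expRD expRN lnK //.
by rewrite posrE normr_gt0.
Qed.

(** The increment of [H r] between [F r x] and [F r x + k] is the [h] with
    [F r (x + h) = F r x + k]; its quotient by [k] is the inverse of the quotient whose
    logarithm is [log_quot h r x], and [h] tends to [0] with [k] by [F_expansive]. *)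
Lemma H_derive r x : derive1 (H r) (F r x) = expR (- log_deriv r x).
Proof.
apply: cvg_lim => //; apply/cvgrPdist_le => e e0.
set C := K2 * expR (K1 * `|r|) * `|r|.
set B := expR (K1 * `|r| + C).
have C0 : 0 <= C by rewrite mulr_ge0 // mulr_ge0 // expR_ge0.
set E := expR (K1 * `|r|).
have E0 : 0 < E by rewrite expR_gt0.
pose dl := Num.min 1 (e / (B * C + 1)) / E.
have B0 : 0 < B by rewrite expR_gt0.
have BC : 0 < B * C + 1 by rewrite ltr_wpDl // mulr_ge0 // ltW.
have dl0 : 0 < dl by rewrite divr_gt0 // lt_min ltr01 divr_gt0.
near=> k.
have k0 : k != 0 by near: k; exact: nbhs_dnbhs_neq.
have kd : `|k| <= dl.
  near: k; apply: nbhs_dnbhs; apply/nbhs_ballP; exists dl => //= u.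
  by rewrite /ball /= sub0r normrN => /ltW.
pose h := H r (F r x + k) - x.
have xh : F r (x + h) = F r x + k by rewrite /h addrC subrK (H_inv r).2.
have h0 : h != 0.
  apply/eqP => hz; move: xh; rewrite hz addr0 => /eqP.
  by rewrite -subr_eq0 opprD addrA subrr sub0r oppr_eq0 (negPf k0).
have hk : `|h| <= E * `|k|.
  have := F_expansive (x + h) x r; rewrite xh addrAC subrr add0r addrAC subrr add0r.
  by rewrite expRN mulrC ler_pdivrMr ?expR_gt0 // mulrC.
have hm : `|h| <= Num.min 1 (e / (B * C + 1)).
  by apply: le_trans hk _; rewrite mulrC -ler_pdivlMr.
have h1 : `|h| <= 1 by apply: le_trans hm _; rewrite ge_min lexx.
have he : `|h| <= e / (B * C + 1) by apply: le_trans hm _; rewrite ge_min lexx orbT.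
rewrite (_ : k^-1 *: _ = expR (- log_quot h r x)); last first.
  rewrite -[LHS]/(k^-1 * (H r (k + F r x) - H r (F r x))).
  rewrite expRN -F_quot_exp // xh (H_inv r).1 (addrC k) -/h.
  by rewrite (addrAC (F r x)) subrr add0r invf_div mulrC.
have near := log_deriv_near r x h0; rewrite -/C in near.
have lq := log_deriv_le r x.
have Ch : C * `|h| <= C by rewrite -[leRHS]mulr1 ler_wpM2l.
apply: le_trans (expR_dist_le (k := K1 * `|r| + C) _ _) _.
- by move: lq; rewrite ler_norml; lra.
- by move: lq near; rewrite !ler_norml; lra.
rewrite -/B opprK addrC.
apply: (@le_trans _ _ (B * (C * `|h|))); first by rewrite ler_wpM2l // ltW.
rewrite mulrA; apply: (@le_trans _ _ ((B * C + 1) * `|h|)).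
  by rewrite ler_wpM2r // lerDl.
by rewrite mulrC -ler_pdivlMr.
Unshelve. all: by end_near. Qed.

Lemma flow_estimates (k : R) : 0 < k -> exists2 C, 0 < C &
  forall r r' x x', `|r| <= k -> `|r'| <= k -> `|x| <= k -> `|x'| <= k ->
  [/\ `|F r x| <= C, `|F r x - F r' x'| <= C * (`|r - r'| + `|x - x'|),
      `|derive1 (H r) (F r x)| <= C &
      `|derive1 (H r) (F r x) - derive1 (H r') (F r' x')| <=
         C * (`|r - r'| + `|x - x'|)].
Proof.
move=> k0; have kk : - k <= k by lra.
have [B B0 HB] := bounded_itv kk (is_derive_within_continuous (a := - k) (b := k) (F_derive 0)).
set E := expR (K1 * k); have E0 : 0 < E by exact: expR_gt0.
have Ek r : `|r| <= k -> expR (K1 * `|r|) <= E by move=> rk; rewrite ler_expR ler_wpM2l.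
have Fx r x x' : `|r| <= k -> `|F r x - F r x'| <= E * `|x - x'|.
  by move=> rk; apply: le_trans (F_lipschitz _ _ _) _; rewrite ler_wpM2r // Ek.
have FB r x : `|r| <= k -> `|x| <= k -> `|F r x| <= B + E * k.
  move=> rk xk; have h1 : `|F r 0| <= B by apply: HB; rewrite -ler_norml.
  have h2 := Fx r x 0 rk; rewrite subr0 in h2.
  have h3 : E * `|x| <= E * k by rewrite ler_wpM2l // ltW.
  have : `|F r x| <= `|F r x - F r 0| + `|F r 0| by rewrite -{1}(subrK (F r 0) (F r x)) ler_normD.
  lra.
set B1 := B + E * k.
set S := `|sigma 0| + K1 * B1.
have Fr r r' x : `|r| <= k -> `|r'| <= k -> `|x| <= k -> `|F r x - F r' x| <= S * `|r - r'|.
  move=> rk rk' xk; apply: (derive_bound_lipschitz (F_derive x) (k := k)) => // u uk.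
  have h1 := sigma_lipschitz 0 (F u x); rewrite subr0 in h1.
  have h2 : K1 * `|F u x| <= K1 * B1 by rewrite ler_wpM2l // FB.
  have : `|sigma (F u x)| <= `|sigma (F u x) - sigma 0| + `|sigma 0|.
    by rewrite -{1}(subrK (sigma 0) (sigma (F u x))) ler_normD.
  rewrite /S; lra.
have B10 : 0 <= B1 by rewrite addr_ge0 // ?mulr_ge0 // ltW.
have S0 : 0 <= S by rewrite addr_ge0 // mulr_ge0.
set L := K2 * E * k.
have L0 : 0 <= L by rewrite !mulr_ge0 // ltW.
have EK0 : 0 <= E * K1 by rewrite mulr_ge0 // ltW.
have EL0 : 0 <= E * L by rewrite mulr_ge0 // ltW.
exists (B1 + E + S + E * K1 + E * L); first by lra.
move=> r r' x x' rk rk' xk xk'.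
have a0 := normr_ge0 (r - r'); have b0 := normr_ge0 (x - x').
set a := `|r - r'| in a0 *; set b := `|x - x'| in b0 *.
split.
- by apply: le_trans (FB _ _ rk xk) _; rewrite -/B1; lra.
- have h1 := Fr _ _ _ rk rk' xk; have h2 := Fx r' x x' rk'.
  have : `|F r x - F r' x'| <= `|F r x - F r' x| + `|F r' x - F r' x'|.
    by rewrite -{1}(subrK (F r' x) (F r x)) -addrA ler_normD.
  rewrite -/a in h1; rewrite -/b in h2.
  have := mulr_ge0 (ltW E0) a0; have := mulr_ge0 S0 b0.
  have := mulr_ge0 B10 a0; have := mulr_ge0 B10 b0.
  have := mulr_ge0 EK0 a0; have := mulr_ge0 EK0 b0.
  have := mulr_ge0 EL0 a0; have := mulr_ge0 EL0 b0.
  lra.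
- rewrite H_derive ger0_norm ?expR_ge0 //; apply: (@le_trans _ _ E); last by lra.
  rewrite ler_expR; have := log_deriv_le r x.
  have : K1 * `|r| <= K1 * k by rewrite ler_wpM2l.
  rewrite ler_norml; lra.
rewrite !H_derive.
have lk s y : `|s| <= k -> - log_deriv s y <= K1 * k.
  move=> sk; have := log_deriv_le s y.
  have : K1 * `|s| <= K1 * k by rewrite ler_wpM2l.
  rewrite ler_norml; lra.
apply: le_trans (expR_dist_le (lk _ _ rk) (lk _ _ rk')) _; rewrite -/E opprK addrC.
have h1 := log_deriv_lipschitz_r r r' x; have h2 := log_deriv_lipschitz_x x x' rk'.
rewrite -/a in h1; rewrite -/E -/L -/b in h2.
have h3 : `|log_deriv r' x' - log_deriv r x| <= K1 * a + L * b.
  have : `|log_deriv r' x' - log_deriv r x| <= `|log_deriv r x - log_deriv r' x| + `|log_deriv r' x - log_deriv r' x'|.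
    by rewrite distrC -{1}(subrK (log_deriv r' x) (log_deriv r x)) -addrA ler_normD.
  lra.
have := ler_wpM2l (ltW E0) h3.
have := mulr_ge0 (ltW E0) a0; have := mulr_ge0 (ltW E0) b0.
have := mulr_ge0 S0 a0; have := mulr_ge0 S0 b0.
have := mulr_ge0 B10 a0; have := mulr_ge0 B10 b0.
have := mulr_ge0 EK0 b0; have := mulr_ge0 EL0 a0.
lra.
Qed.

End flow.

(** * Integrals of continuous functions *)

Section integral_of_continuous.
Context {R : realType}.
Implicit Types (f g : R -> R) (a b c : R).

Local Notation integral a b f := (\int[lebesgue_measure]_(s in `[a, b]) f s).

Lemma within_continuous_sub f a b a' b' : {within `[a, b], continuous f} ->
  a <= a' -> b' <= b -> {within `[a', b'], continuous f}.
Proof.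
move=> fc aa bb; apply: continuous_subspaceW fc => x /=; rewrite !in_itv /=.
by move=> /andP[h1 h2]; rewrite (le_trans aa h1) (le_trans h2 bb).
Qed.

Lemma within_continuous_norm f a b : {within `[a, b], continuous f} ->
  {within `[a, b], continuous (fun s => `|f s|)}.
Proof. by move=> fc x; apply: continuous_comp; [exact: fc|exact: norm_continuous]. Qed.

Lemma within_continuousB f g a b : {within `[a, b], continuous f} ->
  {within `[a, b], continuous g} -> {within `[a, b], continuous (fun s => f s - g s)}.
Proof. by move=> fc gc x; apply: cvgB; [exact: fc|exact: gc]. Qed.

Lemma within_continuousD f g a b : {within `[a, b], continuous f} ->
  {within `[a, b], continuous g} -> {within `[a, b], continuous (fun s => f s + g s)}.
Proof. by move=> fc gc x; apply: cvgD; [exact: fc|exact: gc]. Qed.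

Lemma within_continuousM f g a b : {within `[a, b], continuous f} ->
  {within `[a, b], continuous g} -> {within `[a, b], continuous (fun s => f s * g s)}.
Proof. by move=> fc gc x; apply: cvgM; [exact: fc|exact: gc]. Qed.

Lemma within_continuous_cst c a b : {within `[a, b], continuous (fun _ : R => c)}.
Proof. by move=> x; exact: cvg_cst. Qed.

Lemma within_continuous_integrable f a b : {within `[a, b], continuous f} ->
  lebesgue_measure.-integrable `[a, b] (EFin \o f).
Proof. by move=> fc; apply: continuous_compact_integrable => //; exact: segment_compact. Qed.

Lemma integral_cat f a c b : a <= c -> c <= b -> {within `[a, b], continuous f} ->
  integral a b f = integral a c f + integral c b f.
Proof.
move=> ac cb fc; apply/eqP; rewrite addrC -subr_eq; apply/eqP.
rewrite Rintegral_itvB ?bnd_simp //; last exact: within_continuous_integrable.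
apply: Rintegral_itv_obnd_cbnd.
apply: integrableS (within_continuous_integrable (within_continuous_sub fc ac (lexx b))) => //.
by apply: subset_itvr; rewrite bnd_simp.
Qed.

Lemma integral_le f g a b : {within `[a, b], continuous f} ->
  {within `[a, b], continuous g} -> (forall x, a <= x <= b -> f x <= g x) ->
  integral a b f <= integral a b g.
Proof.
move=> fc gc fg; apply: le_Rintegral => //; exact: within_continuous_integrable.
Qed.

Lemma integral_norm_le f g a b : {within `[a, b], continuous f} ->
  {within `[a, b], continuous g} -> (forall x, a <= x <= b -> `|f x| <= g x) ->
  `|integral a b f| <= integral a b g.
Proof.
move=> fc gc fg; apply: le_trans (le_normr_Rintegral _ (within_continuous_integrable fc)) _ => //.
by apply: integral_le => //; exact: within_continuous_norm.
Qed.

Lemma integral_const c a b : a <= b -> integral a b (fun=> c) = c * (b - a).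
Proof.
move=> ab; rewrite Rintegral_cst //= lebesgue_measure_itv /= lte_fin.
by move: ab; rewrite le_eqVlt => /predU1P[->|->] //; rewrite ltxx subrr.
Qed.

Lemma integral_bound f a b c : a <= b -> {within `[a, b], continuous f} ->
  (forall x, a <= x <= b -> `|f x| <= c) -> `|integral a b f| <= c * (b - a).
Proof.
move=> ab fc H; rewrite -integral_const //.
by apply: integral_norm_le => //; exact: within_continuous_cst.
Qed.

Lemma integral_addition f g a b : {within `[a, b], continuous f} ->
  {within `[a, b], continuous g} ->
  integral a b (fun s => f s + g s) = integral a b f + integral a b g.
Proof. by move=> fc gc; apply: RintegralD => //; exact: within_continuous_integrable. Qed.

Lemma integral_subtraction f g a b : {within `[a, b], continuous f} ->
  {within `[a, b], continuous g} ->
  integral a b (fun s => f s - g s) = integral a b f - integral a b g.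
Proof. by move=> fc gc; apply: RintegralB => //; exact: within_continuous_integrable. Qed.

Lemma integral_scaling f a b c : {within `[a, b], continuous f} ->
  integral a b (fun s => c * f s) = c * integral a b f.
Proof. by move=> fc; apply: RintegralZl => //; exact: within_continuous_integrable. Qed.

Lemma fundamental_theorem f F a b : a <= b -> continuous f ->
  (forall x : R, is_derive x 1 F (f x)) -> integral a b f = F b - F a.
Proof.
move=> ab fc Fd; have [ab'|->] : a < b \/ a = b.
- by case: ltgtP ab => //; [left|right].
- rewrite /Rintegral (@continuous_FTC2 R f F a b) //.
  + exact: continuous_subspaceT.
  + have Fc x : {for x, continuous F}.
      by apply: differentiable_continuous; apply/derivable1_diffP; have [] := Fd x.
    split.
    * by move=> x _; have [] := Fd x.
    * by apply: cvg_at_right_filter; exact: Fc.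
    * by apply: cvg_at_left_filter; exact: Fc.
  + by move=> x _; rewrite derive1E; have [] := Fd x.
- by rewrite set_itv1 Rintegral_set1 subrr.
Qed.

Lemma integral_expR c t : 0 < c -> 0 <= t ->
  integral 0 t (fun s => expR (c * s)) = (expR (c * t) - 1) / c.
Proof.
move=> c0 t0; have cn : c != 0 by rewrite gt_eqF.
have d (x : R) : is_derive x 1 (fun s => c^-1 * expR (c * s)) (expR (c * x)).
  have h1 : is_derive x 1 (fun s => c * s) c.
    by apply: is_derive_eq; rewrite /GRing.scale /= mulr1.
  have h2 := @is_derive1_comp R (@expR R) (fun s => c * s) x _ _ (is_derive_expR _) h1.
  have h3 : is_derive x 1 (fun s => c^-1 * expR (c * s)) (c^-1 * (expR (c * x) * c)).
    exact: (is_deriveZ c^-1 h2).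
  by apply: is_derive_eq h3 _; rewrite mulrCA mulVf ?mulr1.
rewrite (fundamental_theorem t0 _ d) ?mulr0 ?expR0; first by field.
by move=> x; apply: continuous_comp; [exact: mulrl_continuous|exact: continuous_expR].
Qed.

(** The change of variable from the slow to the fast time. *)
Lemma integral_rescale f (e a b : R) : 0 < e -> a <= b -> continuous f ->
  integral a b (fun s => f (s / e)) = e * integral (a / e) (b / e) f.
Proof.
move=> e0 ab fc; have en : e != 0 by rewrite gt_eqF.
have ei : 0 < e^-1 by rewrite invr_gt0.
pose F (s : R) := s / e.
have Fd (x : R) : is_derive x 1 F e^-1.
  rewrite (_ : F = fun s => e^-1 * s); last by apply: funext => s; rewrite /F mulrC.
  by apply: is_derive_eq; rewrite /GRing.scale /= mulr1.
have Fd1 : derive1 F = fun=> e^-1.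
  by apply: funext => x; rewrite derive1E; have [] := Fd x.
have Fc : continuous F by exact: mulrr_continuous.
rewrite [in RHS]/Rintegral (@integration_by_substitution_increasing R F f a b) //.
- rewrite Fd1 -/(Rintegral lebesgue_measure `[a, b] (fun s => f (F s) * e^-1)).
  under [in RHS]eq_Rintegral do rewrite mulrC.
  rewrite integral_scaling ?mulrA ?mulfV ?mul1r //.
  by apply: continuous_subspaceT => x; apply: continuous_comp; [exact: Fc|exact: fc].
- by move=> x y _ _ xy; rewrite /F ltr_pM2r.
- by rewrite Fd1 => x _; exact: cvg_cst.
- by rewrite Fd1; exact: is_cvg_cst.
- by rewrite Fd1; exact: is_cvg_cst.
- split.
  + by move=> x _; have [] := Fd x.
  + by apply: cvg_at_right_filter; exact: Fc.
  + by apply: cvg_at_left_filter; exact: Fc.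
- exact: continuous_subspaceT.
Qed.

(** Let [g] be [`|dl t|] times the weight [expR (- (2 * C * t))], and [S] its maximum. The
    integral term contributes at most [S / 2] to [g], so that [S <= E + S / 2]. *)
Lemma gronwall (dl : R -> R) (T C E : R) : 0 < T -> 0 < C -> {within `[0, T], continuous dl} ->
  (forall t, 0 <= t <= T -> `|dl t| <= E + C * integral 0 t (fun s => `|dl s|)) ->
  forall t, 0 <= t <= T -> `|dl t| <= 2 * E * expR (2 * C * T).
Proof.
move=> T0 C0 dc H.
pose g s := `|dl s| * expR (- (2 * C) * s).
have ec (c : R) : continuous (fun s : R => expR (c * s)).
  by move=> x; apply: continuous_comp; [exact: mulrl_continuous|exact: continuous_expR].
have gc : {within `[0, T], continuous g}.
  apply: within_continuousM; first exact: within_continuous_norm.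
  exact: continuous_subspaceT.
have [m mT gm] := EVT_max (ltW T0) gc.
rewrite in_itv /= in mT.
have dg s : `|dl s| = g s * expR (2 * C * s).
  by rewrite /g -mulrA -expRD mulNr addNr expR0 mulr1.
have C2 : 0 < 2 * C by rewrite mulr_gt0.
have gm0 : 0 <= g m by rewrite mulr_ge0 ?expR_ge0.
have S2 : g m <= 2 * E.
  have [m0 m1] := andP mT.
  have h1 : integral 0 m (fun s => `|dl s|) <= g m * ((expR (2 * C * m) - 1) / (2 * C)).
    rewrite -integral_expR // -integral_scaling; last exact: continuous_subspaceT.
    apply: integral_le.
    - by apply: within_continuous_norm; exact: within_continuous_sub dc _ _.
    - apply: within_continuousM; first exact: within_continuous_cst.
      exact: continuous_subspaceT.
    - move=> x /andP[x0 xm]; rewrite dg ler_wpM2r ?expR_ge0 //; apply: gm.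
      by rewrite in_itv /= x0 (le_trans xm m1).
  have h2 := H m mT; rewrite dg in h2.
  have h3 := ler_wpM2l (ltW C0) h1.
  have h4 : C * (g m * ((expR (2 * C * m) - 1) / (2 * C))) = g m * (expR (2 * C * m) - 1) / 2.
    by field; rewrite gt_eqF.
  rewrite h4 in h3.
  have e1 : 1 <= expR (2 * C * m).
    by have := expR_ge1Dx (2 * C * m); have := mulr_ge0 (ltW C2) m0; lra.
  have h5 : g m * expR (2 * C * m) <= 2 * E - g m by lra.
  have : g m * 1 <= g m * expR (2 * C * m) by rewrite ler_wpM2l.
  lra.
move=> t tT; rewrite dg; apply: (@le_trans _ _ (2 * E * expR (2 * C * t))).
  by rewrite ler_wpM2r ?expR_ge0 //; apply: le_trans S2; apply: gm; rewrite in_itv.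
have [t0 t1] := andP tT.
rewrite ler_wpM2l ?ler_expR ?ler_wpM2l //; last exact: ltW.
exact: le_trans S2.
Qed.

Section dyadic_integral.
Variables (T : R) (f : R -> R).
Hypothesis T_gt0 : 0 < T.
Hypothesis fc : {within `[0, T], continuous f}.

Lemma integral_dyadic i n : (n <= 2 ^ i)%N ->
  integral 0 (pt T i n) f = \sum_(j < n) integral (pt T i j) (pt T i j.+1) f.
Proof.
elim: n => [_|n IH ni]; first by rewrite big_ord0 pt0 set_itv1 Rintegral_set1.
rewrite big_ord_recr /= -IH; last exact: ltnW.
apply: integral_cat; [exact: pt_ge0|by apply: pt_le|].
apply: within_continuous_sub fc _ _ => //; exact: pt_leT.
Qed.

End dyadic_integral.

Lemma integral_dyadic_refine (T : R) f i k j : 0 < T -> (j < 2 ^ i)%N ->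
  {within `[0, T], continuous f} ->
  integral (pt T i j) (pt T i j.+1) f = \sum_(c < 2 ^ k)
    integral (pt T (i + k) (j * 2 ^ k + c)) (pt T (i + k) (j * 2 ^ k + c).+1) f.
Proof.
move=> T0 ji fc; rewrite -!(pt_refine T i _ k).
have -> : (j.+1 * 2 ^ k = j * 2 ^ k + 2 ^ k)%N by rewrite mulSnr.
suff H n : (n <= 2 ^ k)%N ->
    integral (pt T (i + k) (j * 2 ^ k)) (pt T (i + k) (j * 2 ^ k + n)) f = \sum_(c < n)
    integral (pt T (i + k) (j * 2 ^ k + c)) (pt T (i + k) (j * 2 ^ k + c).+1) f.
  exact: H.
elim: n => [_|n IH nk].
  by rewrite big_ord0 addn0 set_itv1 Rintegral_set1.
rewrite big_ord_recr /= -IH; last exact: ltnW.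
rewrite -addnS; apply: integral_cat; [by apply: pt_le => //; rewrite leq_addr|by apply: pt_le => //; rewrite leq_add2l|].
apply: within_continuous_sub fc _ _; first exact: pt_ge0.
apply: pt_leT => //; rewrite expnD; apply: leq_trans (_ : j.+1 * 2 ^ k <= _)%N.
  by rewrite mulSnr leq_add2l.
by rewrite leq_mul2r ji orbT.
Qed.

End integral_of_continuous.

(** * Averaging along one path *)

Section averaging.
Context {R : realType}.
Variables (T k C eps : R) (phi : R -> R -> R -> R) (phibar : R -> R -> R).
Hypotheses (T_gt0 : 0 < T) (C_gt0 : 0 < C) (eps_gt0 : 0 < eps).
Hypothesis phi_le : forall m y s, `|m| <= k -> `|y| <= k -> `|phi m y s| <= C.
Hypothesis phibar_le : forall m y, `|m| <= k -> `|y| <= k -> `|phibar m y| <= C.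
Hypothesis phi_lipschitz : forall m m' y y' s,
  `|m| <= k -> `|m'| <= k -> `|y| <= k -> `|y'| <= k ->
  `|phi m y s - phi m' y' s| <= C * (`|m - m'| + `|y - y'|).
Hypothesis phibar_lipschitz : forall m m' y y',
  `|m| <= k -> `|m'| <= k -> `|y| <= k -> `|y'| <= k ->
  `|phibar m y - phibar m' y'| <= C * (`|m - m'| + `|y - y'|).
Hypothesis phi_average : forall m y u v,
  `|m| <= k -> `|y| <= k -> 0 <= u -> u <= v ->
  `|\int[lebesgue_measure]_(s in `[u, v]) (phi m y (s / eps) - phibar m y)| <= C * eps.
Hypothesis phi_cont : forall m y, continuous (phi m y).
Variables (m y z : R -> R) (x0 : R).
Hypothesis mc : {within `[0, T], continuous m}.
Hypothesis yc : {within `[0, T], continuous y}.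
Hypothesis zc : {within `[0, T], continuous z}.
Hypothesis phi_path :
  {within `[0, T], continuous (fun s => phi (m s) (y s) (s / eps))}.
Hypothesis phibar_path_y : {within `[0, T], continuous (fun s => phibar (m s) (y s))}.
Hypothesis phibar_path_z : {within `[0, T], continuous (fun s => phibar (m s) (z s))}.
Hypothesis mk : forall t, 0 <= t <= T -> `|m t| <= k.
Hypothesis yk : forall t, 0 <= t <= T -> `|y t| <= k.
Hypothesis zk : forall t, 0 <= t <= T -> `|z t| <= k.
Hypothesis y_eq : forall t, 0 <= t <= T -> y t = x0 +
  \int[lebesgue_measure]_(s in `[0, t]) phi (m s) (y s) (s / eps).
Hypothesis z_eq : forall t, 0 <= t <= T -> z t = x0 +
  \int[lebesgue_measure]_(s in `[0, t]) phibar (m s) (z s).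

Local Notation integral a b f := (\int[lebesgue_measure]_(s in `[a, b]) f s).

Definition oscillation (a : nat) : R :=
  \sum_(j < 2 ^ a) integral (pt T a j) (pt T a j.+1) (fun s => `|m s - m (pt T a j)|).

Let err s := phi (m s) (y s) (s / eps) - phibar (m s) (y s).

Let err_cont : {within `[0, T], continuous err}.
Proof. exact: within_continuousB. Qed.

Let osc_cont u : {within `[0, T], continuous (fun s => `|m s - m u|)}.
Proof.
by apply: within_continuous_norm; apply: within_continuousB => //; exact: within_continuous_cst.
Qed.

Let sub (f : R -> R) u v : {within `[0, T], continuous f} -> 0 <= u -> v <= T ->
  {within `[u, v], continuous f}.
Proof. exact: within_continuous_sub. Qed.

Let y_step u s : 0 <= u -> u <= s -> s <= T -> `|y s - y u| <= C * (s - u).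
Proof.
move=> u0 us sT.
rewrite !y_eq ?u0 ?sT ?(le_trans u0 us) ?(le_trans us sT) //.
rewrite (integral_cat u0 us (sub phi_path _ sT)) // opprD addrACA subrr add0r.
rewrite addrAC subrr add0r; apply: integral_bound => //; first exact: sub.
move=> x /andP[ux xs]; have xT : 0 <= x <= T by rewrite (le_trans u0 ux) (le_trans xs sT).
by apply: phi_le; [exact: mk|exact: yk].
Qed.

(** On a short interval the slow variables are frozen at the left end; the frozen part
    is averaged, and the rest is Lipschitz continuous in the slow variables. *)
Lemma cell_error u v : 0 <= u -> u <= v -> v <= T ->
  `|integral u v err| <= 2 * C * integral u v (fun s => `|m s - m u|)
     + 2 * C * (C * (v - u)) * (v - u) + C * eps.
Proof.
move=> u0 uv vT; have uT : 0 <= u <= T by rewrite u0 (le_trans uv vT).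
pose fr s := phi (m u) (y u) (s / eps) - phibar (m u) (y u).
have frc : {within `[u, v], continuous fr}.
  apply: within_continuousB; last exact: within_continuous_cst.
  apply: continuous_subspaceT => x; apply: continuous_comp; last exact: phi_cont.
  exact: mulrr_continuous.
have ec : {within `[u, v], continuous err} by exact: sub.
have -> : integral u v err = integral u v (fun s => err s - fr s) + integral u v fr.
  by rewrite (integral_subtraction ec frc) subrK.
apply: le_trans (ler_normD _ _) _; apply: lerD; last first.
  by apply: phi_average => //; [exact: mk|exact: yk].
have oc : {within `[u, v], continuous (fun s => 2 * C * `|m s - m u|)}.
  by apply: within_continuousM; [exact: within_continuous_cst|exact: sub].
rewrite -integral_scaling; last exact: sub.
rewrite -(integral_const (2 * C * (C * (v - u))) uv) -integral_addition //; last first.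
  exact: within_continuous_cst.
apply: integral_norm_le.
- exact: within_continuousB.
- by apply: within_continuousD => //; exact: within_continuous_cst.
move=> s /andP[us sv].
have sT : 0 <= s <= T by rewrite (le_trans u0 us) (le_trans sv vT).
have h1 := phi_lipschitz (s / eps) (mk sT) (mk uT) (yk sT) (yk uT).
have h2 := phibar_lipschitz (mk sT) (mk uT) (yk sT) (yk uT).
have h3 := y_step u0 us (le_trans sv vT).
have h4 : `|y s - y u| <= C * (v - u).
  by apply: le_trans h3 _; rewrite ler_wpM2l ?lerD2r // ltW.
have h5 := ler_wpM2l (ltW C_gt0) h4.
have -> : err s - fr s = (phi (m s) (y s) (s / eps) - phi (m u) (y u) (s / eps))
   - (phibar (m s) (y s) - phibar (m u) (y u)) by rewrite /err /fr; ring.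
apply: le_trans (ler_normB _ _) _; move: h1 h2; rewrite !mulrDr; lra.
Qed.

(** The sum over the cells of the bounds of [cell_error], with the bound of the last,
    incomplete cell. *)
Definition averaging_error (a : nat) : R :=
  2 * C * oscillation a + (2 * C * C * T * T + 2 * C * T) / 2 ^+ a + 2 ^+ a * (C * eps).

Lemma integral_err_le a t : 0 <= t <= T -> `|integral 0 t err| <= averaging_error a.
Proof.
move=> tT; have [t0 t1] := andP tT.
have p2 : 0 < 2 ^+ a :> R by rewrite exprn_gt0.
have [n n2 /andP[n0 n1]] : exists2 n, (n < 2 ^ a)%N & pt T a n <= t <= pt T a n.+1.
  move: t0; rewrite le_eqVlt => /predU1P[<-|t0].
    by exists 0%N; rewrite ?expn_gt0 // pt0 lexx pt_ge0.
  have [|h1 /andP[h2 h3]] := @cell_bounds _ T T_gt0 a t; first by rewrite t0.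
  by exists (cell T a t) => //; rewrite (ltW h2).
have pn0 := pt_ge0 T_gt0 a n.
rewrite (integral_cat pn0 n0 (sub err_cont _ t1)) //.
rewrite (integral_dyadic T_gt0 err_cont (ltnW n2)).
have lastle : `|integral (pt T a n) t err| <= 2 * C * T / 2 ^+ a.
  apply: (@le_trans _ _ (2 * C * (t - pt T a n))).
    apply: integral_bound => //; first exact: sub.
    move=> s /andP[ns st]; have sT : 0 <= s <= T by rewrite (le_trans pn0 ns) (le_trans st t1).
    have := phi_le (s / eps) (mk sT) (yk sT); have := phibar_le (mk sT) (yk sT).
    by have := ler_normB (phi (m s) (y s) (s / eps)) (phibar (m s) (y s)); rewrite -/(err s); lra.
  rewrite -[leRHS]mulrA ler_wpM2l ?mulr_ge0 ?(ltW C_gt0) //.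
  by rewrite -(pt_step T a n) lerD2r.
pose c (j : nat) := 2 * C * integral (pt T a j) (pt T a j.+1) (fun s => `|m s - m (pt T a j)|)
     + 2 * C * (C * (T / 2 ^+ a)) * (T / 2 ^+ a) + C * eps.
have c0 j : (j < 2 ^ a)%N -> `|integral (pt T a j) (pt T a j.+1) err| <= c j.
  move=> ja; have := @cell_error (pt T a j) (pt T a j.+1) (pt_ge0 T_gt0 _ _) (pt_le T_gt0 _ (leqnSn _)) (pt_leT T_gt0 ja).
  by rewrite pt_step.
have -> : averaging_error a = \sum_(j < 2 ^ a) c j + 2 * C * T / 2 ^+ a.
  rewrite /c big_split big_split /= -mulr_sumr -/(oscillation a) !sumr_const card_ord /=.
  have N2 (x : R) : x *+ 2 ^ a = x * 2 ^+ a by rewrite -[LHS]mulr_natr natrX.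
  rewrite !N2 /averaging_error; move: (oscillation a) (2 ^+ a) p2 => W N N0.
  by field; rewrite gt_eqF.
apply: le_trans (ler_normD _ _) _; apply: lerD => //.
apply: le_trans (ler_norm_sum _ _ _) _.
rewrite -(big_mkord xpredT (fun j => `|integral (pt T a j) (pt T a j.+1) err|)).
rewrite -(big_mkord xpredT c) (big_cat_nat (leq0n n) (ltnW n2)) /=.
rewrite -[leLHS]addr0; apply: lerD.
  by apply: ler_sum_nat => j /andP[_ jn]; apply: c0; exact: ltn_trans n2.
rewrite big_nat_cond; apply: sumr_ge0 => j /andP[/andP[_ ja] _].
by apply: le_trans (c0 j ja).
Qed.

Theorem averaging a t : 0 <= t <= T ->
  `|y t - z t| <= 2 * averaging_error a * expR (2 * C * T).
Proof.
apply: (@gronwall R (fun t => y t - z t)) => //; first exact: within_continuousB.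
move=> {}t tT; have [t0 t1] := andP tT.
have py := sub phibar_path_y (lexx 0) t1; have pz := sub phibar_path_z (lexx 0) t1.
have -> : y t - z t = integral 0 t err
    + integral 0 t (fun s => phibar (m s) (y s) - phibar (m s) (z s)).
  rewrite y_eq // z_eq // !integral_subtraction //; first by ring.
  exact: sub phi_path _ _.
apply: le_trans (ler_normD _ _) _; apply: lerD; first exact: integral_err_le.
have dc : {within `[0, t], continuous (fun s => `|y s - z s|)}.
  by apply: within_continuous_norm; apply: within_continuousB; exact: sub.
rewrite -integral_scaling //; apply: integral_norm_le.
- exact: within_continuousB.
- by apply: within_continuousM => //; exact: within_continuous_cst.
move=> s /andP[s0 st]; have sT : 0 <= s <= T by rewrite s0 (le_trans st t1).
have := phibar_lipschitz (mk sT) (mk sT) (yk sT) (zk sT).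
by rewrite subrr normr0 add0r.
Qed.

(** Over a fine cell the path is replaced by its value at the left end, up to [e], so
    that the integrals become a mean over the fine grid. *)
Lemma oscillation_le a l e : 0 <= e ->
  (forall j t, (j < 2 ^ (a + l))%N -> pt T (a + l) j <= t <= pt T (a + l) j.+1 ->
     `|m t - m (pt T (a + l) j)| <= e) ->
  oscillation a <= T * ((\sum_(j < 2 ^ (a + l))
     `|m (pt T (a + l) j) - m (pt T a (j %/ 2 ^ l))|) / 2 ^+ (a + l) + e).
Proof.
move=> e0 H; have p2 : 0 < 2 ^+ (a + l) :> R by rewrite exprn_gt0.
pose D j := `|m (pt T (a + l) j) - m (pt T a (j %/ 2 ^ l))|.
have -> : T * ((\sum_(j < 2 ^ (a + l)) D j) / 2 ^+ (a + l) + e) =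
   \sum_(j < 2 ^ (a + l)) (D j + e) * (T / 2 ^+ (a + l)).
  rewrite -mulr_suml big_split /= sumr_const card_ord.
  have -> : e *+ 2 ^ (a + l) = e * 2 ^+ (a + l) by rewrite -[LHS]mulr_natr natrX.
  move: (2 ^+ (a + l)) p2 (\sum_(j < _) D j) => N N0 S.
  by field; rewrite gt_eqF.
pose I j := integral (pt T (a + l) j) (pt T (a + l) j.+1)
  (fun s => `|m s - m (pt T a (j %/ 2 ^ l))|).
have -> : oscillation a = \sum_(j < 2 ^ (a + l)) I j.
  rewrite expnD (sum_pairs I); apply: eq_bigr => i _.
  rewrite (integral_dyadic_refine l T_gt0 (ltn_ord i) (@osc_cont _)).
  apply: eq_bigr => c _; rewrite /I.
  by rewrite divnMDl ?expn_gt0 // divn_small // addn0.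
apply: ler_sum => j _; apply: le_trans (ler_norm _) _; rewrite -(pt_step T (a + l) j).
apply: integral_bound; first exact: pt_le.
  by apply: sub => //; [exact: pt_ge0|exact: pt_leT].
move=> s sj; rewrite normr_id.
have -> : m s - m (pt T a (j %/ 2 ^ l)) =
  (m (pt T (a + l) j) - m (pt T a (j %/ 2 ^ l))) + (m s - m (pt T (a + l) j)) by ring.
by apply: le_trans (ler_normD _ _) _; rewrite lerD2l; exact: H.
Qed.

End averaging.

(** * The coefficients of the random equation *)

Section coefficients.
Context {R : realType}.
Variables (T : R) (sigma : R -> R) (F H : R -> R -> R) (K1 K2 : R).
Hypothesis T_gt0 : 0 < T.
Hypothesis sigma_C2 : class_C 2 sigma.
Hypothesis sigma1_le : forall x, `|derive1 sigma x| <= K1.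
Hypothesis sigma2_le : forall x, `|derive1n 2 sigma x| <= K2.
Hypothesis F_flow : is_flow sigma F.
Hypothesis H_inv : is_flow_inverse F H.
Variables (b : R -> R -> R) (bbar : R -> R) (B KG : R).
Hypothesis b_cont : continuous (fun p : R * R => b p.1 p.2).
Hypothesis b_le : forall x t, `|b x t| <= B.
Hypothesis b_loclip : forall c, 0 < c -> exists L, forall x y t,
     `|x| <= c -> `|y| <= c -> `|b x t - b y t| <= L * `|x - y|.
Hypothesis G_le : forall y r, 0 <= r ->
     `|\int[lebesgue_measure]_(s in `[0, r]) (b y s - bbar y)| <= KG.

Local Notation integral a b f := (\int[lebesgue_measure]_(s in `[a, b]) f s).

Let B_ge0 : 0 <= B. Proof. exact: le_trans (b_le 0 0). Qed.

Let KG_ge0 : 0 <= KG. Proof. exact: le_trans (G_le 0 (lexx 0)). Qed.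

Let b_dist (x t e : R) : 0 < e -> exists2 dl, 0 < dl & forall x' t',
  `|x' - x| < dl -> `|t' - t| < dl -> `|b x' t' - b x t| < e.
Proof.
move=> e0; have /cvgrPdist_lt /(_ e e0) /nbhs_ballP [dl /= dl0 h] := @b_cont (x, t).
exists dl => // x' t' xd td; rewrite distrC; apply: (h (x', t')).
by split; rewrite /ball /= distrC.
Qed.

Lemma drift_continuous x : continuous (b x).
Proof.
move=> t; apply/cvgrPdist_lt => e e0; have [dl dl0 h] := b_dist x t e0.
apply/nbhs_ballP; exists dl => //= t' tt'; rewrite distrC; apply: h.
  by rewrite subrr normr0.
by rewrite distrC.
Qed.

Let b_within x u v : {within `[u, v], continuous (b x)}.
Proof. exact: continuous_subspaceT (@drift_continuous x). Qed.

Lemma averaged_drift x r : 0 < r -> `|integral 0 r (b x) - r * bbar x| <= KG.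
Proof.
move=> r0; have := G_le x (ltW r0).
rewrite integral_subtraction //; last exact: within_continuous_cst.
by rewrite (integral_const _ (ltW r0)) subr0 (mulrC r).
Qed.

(** Up to an error of order [1 / r], the averaged drift is the mean of [b] over [[0, r]]. *)
Lemma averaged_drift_le x : `|bbar x| <= B.
Proof.
apply: (le_small_multiples KG_ge0) => h h0.
have r0 : 0 < h^-1 by rewrite invr_gt0.
have h1 := averaged_drift x r0.
have h2 := integral_bound (ltW r0) (@b_within x 0 h^-1) (fun s _ => b_le x s).
rewrite subr0 in h2.
have h3 : `|h^-1 * bbar x| <= KG + B * h^-1.
  rewrite -[_ * bbar x](subKr (integral 0 h^-1 (b x))).
  by apply: le_trans (ler_normB _ _) _; lra.
rewrite normrM gtr0_norm // mulrC ler_pdivrMr // in h3.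
by move: h3; rewrite mulrDl divfK ?gt_eqF //; lra.
Qed.

(** Averaging over longer and longer intervals preserves a Lipschitz bound. *)
Lemma averaged_drift_lipschitz c L :
  (forall x y t, `|x| <= c -> `|y| <= c -> `|b x t - b y t| <= L * `|x - y|) ->
  forall x y, `|x| <= c -> `|y| <= c -> `|bbar x - bbar y| <= L * `|x - y|.
Proof.
move=> bL x y xc yc; apply: (@le_small_multiples _ _ _ (2 * KG)); first by rewrite mulr_ge0.
move=> h h0; have r0 : 0 < h^-1 by rewrite invr_gt0.
have h1 := averaged_drift x r0; have h2 := averaged_drift y r0.
have h3 : `|integral 0 h^-1 (b x) - integral 0 h^-1 (b y)| <= L * `|x - y| * h^-1.
  rewrite -integral_subtraction // -[X in _ * X]subr0; apply: integral_bound; first exact: ltW.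
    exact: within_continuousB.
  by move=> s _; exact: bL.
have h4 : `|h^-1 * (bbar x - bbar y)| <= 2 * KG + L * `|x - y| * h^-1.
  have -> : h^-1 * (bbar x - bbar y) = (integral 0 h^-1 (b x) - integral 0 h^-1 (b y))
    - (integral 0 h^-1 (b x) - h^-1 * bbar x) + (integral 0 h^-1 (b y) - h^-1 * bbar y) by ring.
  apply: le_trans (ler_normD _ _) _.
  by have := ler_normB (integral 0 h^-1 (b x) - integral 0 h^-1 (b y))
      (integral 0 h^-1 (b x) - h^-1 * bbar x); lra.
rewrite normrM gtr0_norm // mulrC ler_pdivrMr // in h4.
by move: h4; rewrite mulrDl divfK ?gt_eqF //; lra.
Qed.

(** The right-hand side of the random equation, as a function of the driving
    path, of the solution and of the fast time. *)
Definition field (m y s : R) : R := derive1 (H m) (F m y) * b (F m y) s.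
Definition averaged_field (m y : R) : R := derive1 (H m) (F m y) * bbar (F m y).

(** After the change of variable the integral is, up to a factor bounded by [C], [eps]
    times a difference of two values of the primitive bounded by [KG]. *)
Lemma field_average C m y eps u v : `|derive1 (H m) (F m y)| <= C ->
  0 < eps -> 0 <= u -> u <= v ->
  `|integral u v (fun s => field m y (s / eps) - averaged_field m y)|
     <= C * (2 * KG) * eps.
Proof.
move=> DC e0 u0 uv; set x := F m y in DC *; set D := derive1 (H m) x in DC *.
pose f s := b x s - bbar x.
have fc : continuous f.
  by move=> s; apply: cvgB; [exact: drift_continuous|exact: cvg_cst].
have fw p q : {within `[p, q], continuous f} by exact: continuous_subspaceT.
have fe : continuous (fun s : R => f (s / eps)).
  move=> s; apply: (@continuous_comp _ _ _ (fun s : R => s / eps) f); last exact: fc.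
  exact: mulrr_continuous.
have -> : (fun s => field m y (s / eps) - averaged_field m y) = (fun s => D * f (s / eps)).
  by apply: funext => s; rewrite /field /averaged_field -/x -/D -mulrBr.
rewrite integral_scaling; last exact: continuous_subspaceT.
rewrite integral_rescale //.
have u0' : 0 <= u / eps by rewrite divr_ge0 // ltW.
have uv' : u / eps <= v / eps by rewrite ler_pM2r ?invr_gt0.
have h1 := G_le x u0'; have h2 := G_le x (le_trans u0' uv').
rewrite (integral_cat u0' uv' (@fw _ _)) in h2.
have h3 : `|integral (u / eps) (v / eps) f| <= 2 * KG.
  have := ler_normB (integral 0 (u / eps) f + integral (u / eps) (v / eps) f) (integral 0 (u / eps) f).
  by rewrite addrAC subrr add0r; move: h1 h2; rewrite -/f; lra.
rewrite !normrM (gtr0_norm e0) [eps * _]mulrC mulrA ler_wpM2r ?(ltW e0) //.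
by apply: ler_pM.
Qed.

Lemma field_estimates (k : R) : 0 < k -> exists2 C, 0 < C &
  [/\ forall m y s, `|m| <= k -> `|y| <= k -> `|field m y s| <= C,
      forall m y, `|m| <= k -> `|y| <= k -> `|averaged_field m y| <= C,
      forall m m' y y' s, `|m| <= k -> `|m'| <= k -> `|y| <= k -> `|y'| <= k ->
        `|field m y s - field m' y' s| <= C * (`|m - m'| + `|y - y'|),
      forall m m' y y', `|m| <= k -> `|m'| <= k -> `|y| <= k -> `|y'| <= k ->
        `|averaged_field m y - averaged_field m' y'| <= C * (`|m - m'| + `|y - y'|) &
      forall m y eps u v, 0 < eps -> `|m| <= k -> `|y| <= k -> 0 <= u -> u <= v ->
        `|integral u v (fun s => field m y (s / eps) - averaged_field m y)| <= C * eps].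
Proof.
move=> k0.
have [A A0 est] := flow_estimates sigma_C2 sigma1_le sigma2_le F_flow H_inv k0.
have [L0 bL0] := b_loclip A0.
pose L := `|L0|.
have bL x y t : `|x| <= A -> `|y| <= A -> `|b x t - b y t| <= L * `|x - y|.
  move=> xA yA; apply: le_trans (bL0 x y t xA yA) _.
  by rewrite ler_wpM2r // ler_norm.
have bbL := averaged_drift_lipschitz bL.
have AB0 : 0 <= A * B by rewrite mulr_ge0 // ltW.
have AL0 : 0 <= A * (L * A) by rewrite !mulr_ge0 ?(ltW A0) // normr_ge0.
have AG0 : 0 <= A * (2 * KG) by rewrite !mulr_ge0 // ltW.
set C := A * B + A * (L * A) + A * (2 * KG) + 1.
have bnd be m y : (forall x, `|be x| <= B) -> `|m| <= k -> `|y| <= k ->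
    `|derive1 (H m) (F m y) * be (F m y)| <= C.
  move=> beB mk yk; have [_ _ h _] := est m m y y mk mk yk yk.
  by have := ler_pM (normr_ge0 _) (normr_ge0 _) h (beB (F m y)); rewrite normrM /C; lra.
have lip be m m' y y' : (forall x, `|be x| <= B) ->
    (forall x y, `|x| <= A -> `|y| <= A -> `|be x - be y| <= L * `|x - y|) ->
    `|m| <= k -> `|m'| <= k -> `|y| <= k -> `|y'| <= k ->
    `|derive1 (H m) (F m y) * be (F m y) - derive1 (H m') (F m' y') * be (F m' y')|
       <= C * (`|m - m'| + `|y - y'|).
  move=> beB beL mk mk' yk yk'.
  have [x1 x2 x3 x4] := est _ _ _ _ mk mk' yk yk'.
  have [y1 _ y3 _] := est _ _ _ _ mk' mk yk' yk.
  set dist := `|m - m'| + `|y - y'| in x2 x4 *.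
  have d0 : 0 <= dist by rewrite addr_ge0.
  set D := derive1 (H m) _ in x3 x4 *; set D' := derive1 (H m') _ in x4 y3 *.
  have e1 := ler_pM (normr_ge0 _) (normr_ge0 _) x4 (beB (F m y)).
  have e2 := beL _ _ x1 y1.
  have e3 := ler_wpM2l (normr_ge0 L0) x2.
  have e4 := ler_pM (normr_ge0 _) (normr_ge0 _) y3 (le_trans e2 e3).
  have -> : D * be (F m y) - D' * be (F m' y') =
    (D - D') * be (F m y) + D' * (be (F m y) - be (F m' y')) by ring.
  apply: le_trans (ler_normD _ _) _; rewrite !normrM.
  have := mulr_ge0 AG0 d0; rewrite /C !mulrDl -/L in e1 e4 *; lra.
exists C; first by rewrite /C; lra.
split.
- by move=> m y s; apply: (bnd (b ^~ s)) => x; exact: b_le.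
- by move=> m y; apply: bnd; exact: averaged_drift_le.
- move=> m m' y y' s; apply: (lip (b ^~ s)) => [x|x z]; first exact: b_le.
  exact: bL.
- by move=> m m' y y'; apply: lip; [exact: averaged_drift_le|exact: bbL].
move=> m y eps u v e0 mk yk u0 uv; have [_ _ h _] := est m m y y mk mk yk yk.
apply: le_trans (field_average h e0 u0 uv) _.
by rewrite ler_wpM2r ?(ltW e0) // /C; lra.
Qed.

(** The derivative of the inverse flow is bounded uniformly in the space variable;
    this bounds the solution before any local constant is chosen. *)
Lemma field_growth k m y s : `|m| <= k ->
  `|field m y s| <= expR (K1 * k) * B /\ `|averaged_field m y| <= expR (K1 * k) * B.
Proof.
move=> mk; have K10 : 0 <= K1 by exact: le_trans (sigma1_le 0).
have h : `|derive1 (H m) (F m y)| <= expR (K1 * k).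
  rewrite (H_derive sigma_C2 sigma1_le sigma2_le F_flow H_inv) ger0_norm ?expR_ge0 //.
  rewrite ler_expR; have := log_deriv_le sigma_C2 sigma1_le sigma2_le F_flow H_inv m y.
  by have := ler_wpM2l K10 mk; rewrite ler_norml; lra.
rewrite !normrM; split; apply: ler_pM => //; exact: averaged_drift_le.
Qed.

Lemma within_continuous_loclip (f : R -> R -> R) (m y : R -> R) :
  (forall k, 0 < k -> exists2 C, 0 < C & forall r r' x x',
     `|r| <= k -> `|r'| <= k -> `|x| <= k -> `|x'| <= k ->
     `|f r x - f r' x'| <= C * (`|r - r'| + `|x - x'|)) ->
  {within `[0, T], continuous m} -> {within `[0, T], continuous y} ->
  {within `[0, T], continuous (fun s => f (m s) (y s))}.
Proof.
move=> fl mc yc; have [A A0 mA] := bounded_itv (ltW T_gt0) mc.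
have [A' A'0 yA] := bounded_itv (ltW T_gt0) yc.
have [C C0 H'] := fl (A + A') (addr_gt0 A0 A'0).
have bm s : 0 <= s <= T -> `|m s| <= A + A' by move=> /mA; lra.
have bY s : 0 <= s <= T -> `|y s| <= A + A' by move=> /yA; lra.
apply: dist_within_continuous => x xT e e0.
have e2 : 0 < e / (2 * C) by rewrite divr_gt0 // mulr_gt0.
have [d1 d10 h1] := within_continuous_dist mc xT e2.
have [d2 d20 h2] := within_continuous_dist yc xT e2.
exists (Num.min d1 d2); first by rewrite lt_min d10.
move=> t tT; rewrite lt_min => /andP[t1 t2].
apply: le_lt_trans (H' _ _ _ _ (bm t tT) (bm x xT) (bY t tT) (bY x xT)) _.
have := ltr_pM2l C0 (`|m t - m x| + `|y t - y x|) (e / (2 * C) + e / (2 * C)).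
rewrite ltrD ?h1 ?h2 // => h; apply: (lt_le_trans h).
by rewrite le_eqVlt; apply/orP; left; apply/eqP; field; rewrite gt_eqF.
Qed.

Section path.
Variables m y : R -> R.
Hypothesis mc : {within `[0, T], continuous m}.
Hypothesis yc : {within `[0, T], continuous y}.

Lemma flow_path_continuous : {within `[0, T], continuous (fun s => F (m s) (y s))}.
Proof.
apply: within_continuous_loclip => // k k0.
have [C C0 h] := flow_estimates sigma_C2 sigma1_le sigma2_le F_flow H_inv k0.
by exists C => // r r' x x' rk rk' xk xk'; have [] := h _ _ _ _ rk rk' xk xk'.
Qed.

Lemma field_path_continuous eps :
  {within `[0, T], continuous (fun s => field (m s) (y s) (s / eps))}.
Proof.
apply: within_continuousM.
  apply: (@within_continuous_loclip (fun r x => derive1 (H r) (F r x))) => // k k0.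
  have [C C0 h] := flow_estimates sigma_C2 sigma1_le sigma2_le F_flow H_inv k0.
  by exists C => // r r' x x' rk rk' xk xk'; have [] := h _ _ _ _ rk rk' xk xk'.
apply: dist_within_continuous => s sT e e0.
have [dl dl0 h] := b_dist (F (m s) (y s)) (s / eps) e0.
have [d1 d10 h1] := within_continuous_dist flow_path_continuous sT dl0.
have sc : {within `[0, T], continuous (fun s => s / eps)}.
  exact: (continuous_subspaceT (@mulrr_continuous R eps^-1)).
have [d2 d20 h2] := within_continuous_dist sc sT dl0.
exists (Num.min d1 d2); first by rewrite lt_min d10.
by move=> u uT; rewrite lt_min => /andP[u1 u2]; apply: h; [exact: h1|exact: h2].
Qed.

Lemma averaged_field_path_continuous :
  {within `[0, T], continuous (fun s => averaged_field (m s) (y s))}.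
Proof.
apply: within_continuous_loclip => // k k0.
have [C C0 [_ _ _ h _]] := field_estimates k0.
by exists C => // r r' x x' rk rk' xk xk'; exact: h.
Qed.

End path.

Lemma flow_inverse0 x : H 0 x = x.
Proof. by rewrite -[in LHS](F_flow.2 x) (H_inv 0).1. Qed.

(** The bound of [field_growth] confines the solutions to a segment that depends on [k]
    only, on which the constants of [averaging] are then taken. *)
Theorem pathwise_averaging (k : R) : 0 < k -> exists2 C, 0 < C &
  forall (m y z : R -> R) (x0 eps : R), 0 < eps ->
  {within `[0, T], continuous m} -> {within `[0, T], continuous y} ->
  {within `[0, T], continuous z} ->
  (forall t, 0 <= t <= T -> `|m t| <= k) -> `|x0| <= k ->
  (forall t, 0 <= t <= T -> y t = H 0 x0 +
     integral 0 t (fun s => field (m s) (y s) (s / eps))) ->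
  (forall t, 0 <= t <= T -> z t = H 0 x0 +
     integral 0 t (fun s => averaged_field (m s) (z s))) ->
  forall t, 0 <= t <= T -> `|F (m t) (y t) - F (m t) (z t)| <= C /\
  forall a, `|F (m t) (y t) - F (m t) (z t)|
     <= C * (oscillation T m a + 1 / 2 ^+ a + 2 ^+ a * eps).
Proof.
move=> k0; set g := expR (K1 * k) * B.
have g0 : 0 <= g by rewrite mulr_ge0 // expR_ge0.
have gT : 0 <= g * T by rewrite mulr_ge0 // ltW.
set k' := k + g * T; have k'0 : 0 < k' by rewrite /k'; lra.
have [A A0 est] := flow_estimates sigma_C2 sigma1_le sigma2_le F_flow H_inv k'0.
have [C C0 [f1 f2 f3 f4 f5]] := field_estimates k'0.
set E := expR (2 * C * T); have E0 : 0 < E by exact: expR_gt0.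
set S := 2 * C + (2 * C * C * T * T + 2 * C * T) + C.
have CT0 : 0 < C * T by rewrite mulr_gt0.
have CTT0 : 0 < C * T * (C * T) by rewrite mulr_gt0.
have S0 : 0 < S by rewrite /S; lra.
have ASE : 0 < A * (2 * S * E) by rewrite !mulr_gt0.
exists (2 * A + A * (2 * S * E)); first by lra.
move=> m y z x0 eps e0 mc yc zc mk xk y_eq z_eq.
have ph := field_path_continuous mc yc (eps := eps).
have py := averaged_field_path_continuous mc yc.
have pz := averaged_field_path_continuous mc zc.
have mk' t : 0 <= t <= T -> `|m t| <= k' by move=> /mk; rewrite /k'; lra.
have yk' t : 0 <= t <= T -> `|y t| <= k'.
  move=> tT; have [t0 t1] := andP tT; rewrite y_eq // flow_inverse0.
  apply: le_trans (ler_normD _ _) _; rewrite /k'; apply: lerD => //.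
  apply: (@le_trans _ _ (g * (t - 0))); last by rewrite subr0 ler_wpM2l.
  apply: integral_bound => //; first exact: within_continuous_sub ph _ _.
  move=> s /andP[s0 st]; apply: (field_growth _ _ (mk s _)).1.
  by rewrite s0 (le_trans st t1).
have zk' t : 0 <= t <= T -> `|z t| <= k'.
  move=> tT; have [t0 t1] := andP tT; rewrite z_eq // flow_inverse0.
  apply: le_trans (ler_normD _ _) _; rewrite /k'; apply: lerD => //.
  apply: (@le_trans _ _ (g * (t - 0))); last by rewrite subr0 ler_wpM2l.
  apply: integral_bound => //; first exact: within_continuous_sub pz _ _.
  move=> s /andP[s0 st]; apply: (field_growth _ 0 (mk s _)).2.
  by rewrite s0 (le_trans st t1).
have fcont r x : continuous (field r x).
  by move=> s; apply: cvgM; [exact: cvg_cst|exact: drift_continuous].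
move=> t tT.
have [h1 h2 _ _] := est _ _ _ _ (mk' t tT) (mk' t tT) (yk' t tT) (zk' t tT).
have [h3 _ _ _] := est _ _ _ _ (mk' t tT) (mk' t tT) (zk' t tT) (yk' t tT).
split; first by apply: le_trans (ler_normB _ _) _; lra.
move=> a.
have av := averaging (phi := field) (phibar := averaged_field) T_gt0 C0 f1 f2 f3 f4
  (fun r x u v rk xk u0 uv => f5 r x eps u v e0 rk xk u0 uv) fcont mc yc zc ph py pz
  mk' yk' zk' y_eq z_eq a tT.
set W := oscillation T m a in av *.
have W0 : 0 <= W.
  apply: sumr_ge0 => j _; rewrite /Rintegral fine_ge0 //; apply: integral_ge0 => s _.
  by rewrite lee_fin.
have p2 : 0 < 2 ^+ a :> R by rewrite exprn_gt0.
have i2 : 0 < 1 / 2 ^+ a :> R by rewrite divr_gt0.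
have e2 : 0 < 2 ^+ a * eps by rewrite mulr_gt0.
rewrite subrr normr0 add0r in h2; apply: (le_trans h2).
have aS : averaging_error T C eps m a <= S * (W + 1 / 2 ^+ a + 2 ^+ a * eps).
  rewrite /averaging_error -/W.
  have q1 := mulr_ge0 (ltW C0) W0; have q2 := mulr_gt0 CT0 i2.
  have q3 := mulr_gt0 CTT0 i2; have q4 := mulr_gt0 C0 e2; have q5 := mulr_gt0 C0 i2.
  have q6 := mulr_ge0 (ltW CT0) W0; have q7 := mulr_ge0 (ltW CTT0) W0.
  have q8 := mulr_gt0 CT0 e2; have q9 := mulr_gt0 CTT0 e2.
  have r1 : C * T * (C * T) * (1 / 2 ^+ a) = C * C * T * T / 2 ^+ a by ring.
  have r2 : C * T * (1 / 2 ^+ a) = C * T / 2 ^+ a by ring.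
  have r3 : 2 ^+ a * (C * eps) = C * (2 ^+ a * eps) by ring.
  rewrite r1 in q3; rewrite r2 in q2; rewrite r3 /S; lra.
set Z := W + _ + _ in aS *.
have Z0 : 0 <= Z by rewrite !addr_ge0 // ltW.
have aE := ler_wpM2r (ltW E0) aS.
have := ler_wpM2l (ltW A0) av; rewrite -/E.
have := ler_wpM2l (ltW A0) aE; have := mulr_ge0 (ltW A0) Z0.
have -> : A * (S * Z * E) = A * (2 * S * E) * Z / 2 by field.
have -> : A * (2 * averaging_error T C eps m a * E) = 2 * (A * (averaging_error T C eps m a * E)) by ring.
rewrite mulrDl; lra.
Qed.

End coefficients.

(** * The averaging principle *)

Section dense_supremum.
Context {d} {Omega : measurableType d} {R : realType} (P : probability Omega R).
Variable T : R.
Hypothesis T_gt0 : 0 < T.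

Lemma dyadic_dense_le (f : R -> R) c : {within `[0, T], continuous f} ->
  (forall i j, (j <= 2 ^ i)%N -> f (pt T i j) <= c) ->
  forall t, 0 <= t <= T -> f t <= c.
Proof.
move=> fc H t /andP[t0 t1]; apply/ler_addgt0Pr => e e0.
have [i h] := dyadic_oscillation T_gt0 fc e0.
move: t0; rewrite le_eqVlt => /predU1P[<-|t0].
  by have := H 0%N 0%N isT; rewrite pt0; lra.
have [|ji /andP[j1 j2]] := @cell_bounds _ T T_gt0 i t; first by rewrite t0.
have := h i (leqnn i) _ t ji; rewrite (ltW j1) j2 => /(_ isT).
by have := H _ _ (ltnW ji); rewrite ler_norml; lra.
Qed.

(** An enumeration of the dyadic points, with a default value for the codes of pairs
    outside the grid. *)
Definition dyadic_point (n : nat) : R :=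
  if unpickle n is Some (i, j) then
    if (j <= 2 ^ i)%N then pt T i j else 0
  else 0.

Lemma dyadic_point_in n : 0 <= dyadic_point n <= T.
Proof.
rewrite /dyadic_point; case: (unpickle n) => [[i j]|]; last by rewrite lexx ltW.
by case: ifP => ji; rewrite ?lexx ?(ltW T_gt0) // pt_ge0 // pt_leT.
Qed.

Lemma dyadic_pointP i j : (j <= 2 ^ i)%N -> exists n, dyadic_point n = pt T i j.
Proof. by move=> ji; exists (pickle (i, j)); rewrite /dyadic_point pickleK ji. Qed.

Section sup_distance.
Variables X Z : R -> {RV P >-> R}.
Hypotheses (Xc : continuous_paths T X) (Zc : continuous_paths T Z).

Let dist w t := `|X t w - Z t w|.

Let dist_cont w : {within `[0, T], continuous (dist w)}.
Proof. by apply: within_continuous_norm; apply: within_continuousB; [exact: Xc|exact: Zc]. Qed.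

Let dist_sup w : has_sup [set dist w t | t in `[0, T]].
Proof.
have [K K0 HK] := bounded_itv (ltW T_gt0) (dist_cont (w := w)).
split; first by exists (dist w 0); exists 0 => //=; rewrite in_itv /= lexx ltW.
exists K => _ [t /= tT <-]; rewrite in_itv /= in tT.
by have := HK t tT; rewrite ger0_norm // /dist.
Qed.

Lemma sup_distance_le w c : (forall t, 0 <= t <= T -> `|X t w - Z t w| <= c) ->
  0 <= sup_distance T X Z w <= c.
Proof.
move=> H; have [s0 s1] := dist_sup w; apply/andP; split.
  apply: (@le_trans _ _ (dist w 0)); first exact: normr_ge0.
  apply: (sup_upper_bound (dist_sup w)).
  by exists 0 => //=; rewrite in_itv /= lexx ltW.
by apply: sup_le_ub => // _ [t /= tT <-]; apply: H; move: tT; rewrite in_itv.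
Qed.

(** By continuity the supremum can be taken over the dyadic points. *)
Lemma measurable_sup_distance : measurable_fun setT (sup_distance T X Z).
Proof.
pose h (n : nat) w := dist w (dyadic_point n).
have ub w : has_ubound (range (h ^~ w)).
  have [_ [K HK]] := dist_sup w; exists K => _ [n _ <-]; apply: HK.
  by exists (dyadic_point n) => //=; rewrite in_itv /= dyadic_point_in.
rewrite (_ : sup_distance T X Z = (fun w => sups (h ^~ w) 0)); last first.
  apply: funext => w; have [s0 s1] := dist_sup w.
  have E : sups (h ^~ w) 0 = sup (range (h ^~ w)).
    by rewrite /sups /sdrop; congr sup; apply/seteqP; split => x [n _ <-]; exists n.
  have r0 : range (h ^~ w) !=set0 by exists (h 0%N w); exists 0%N.
  rewrite E; apply/eqP; rewrite eq_le; apply/andP; split.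
    apply: sup_le_ub => // _ [t /= tT <-]; rewrite in_itv /= in tT.
    apply: (dyadic_dense_le (dist_cont (w := w))) tT => i j ji.
    by have [n <-] := dyadic_pointP ji; apply: sup_upper_bound => //; exists n.
  apply: sup_le_ub => // _ [n _ <-]; apply: sup_upper_bound => //.
  by exists (dyadic_point n) => //=; rewrite in_itv /= dyadic_point_in.
apply: measurable_fun_sups => // n.
by apply: measurableT_comp => //; apply: measurable_funB.
Qed.

End sup_distance.

(** The events that the path or the initial value exceeds [n] decrease to the
    empty event. *)
Lemma paths_bounded (X : R -> {RV P >-> R}) (X0 : {RV P >-> R}) e :
  continuous_paths T X -> 0 < e -> exists2 k, 0 < k & exists2 A, pr P A <= e &
  forall w, ~ A w -> `|X0 w| <= k /\ forall t, 0 <= t <= T -> `|X t w| <= k.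
Proof.
move=> Xc e0.
pose A (n : nat) := [set w | n%:R < `|X0 w|] `|`
   \bigcup_m [set w | n%:R < `|X (dyadic_point m) w|].
have mA n : measurable (A n).
  apply: measurableU; first exact: measurable_gt_norm.
  by apply: bigcupT_measurable => m; exact: measurable_gt_norm.
have Aw w : exists N, forall n, (N <= n)%N -> ~ A n w.
  have [K K0 HK] := bounded_itv (ltW T_gt0) (Xc w).
  exists (Num.truncn (K + `|X0 w|)).+1 => n Nn.
  have nK : K + `|X0 w| < n%:R.
    by apply: lt_le_trans (truncnS_gt _) _; rewrite ler_nat.
  have x0 := normr_ge0 (X0 w).
  case => [/= h|[m _ /= h]]; first by lra.
  by have := HK _ (dyadic_point_in m); lra.
have [N HN] := pr_cvg0 P mA e0 Aw.
exists N.+1%:R; first by rewrite ltr0n.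
exists (A N.+1); first exact: HN.
move=> w nA; split; first by rewrite leNgt; apply/negP => h; apply: nA; left.
apply: (dyadic_dense_le (within_continuous_norm (Xc w))) => i j ji.
have [n <-] := dyadic_pointP ji.
by rewrite leNgt; apply/negP => h; apply: nA; right; exists n.
Qed.

End dense_supremum.

(** The largest [a] with [2 ^+ a * r ^+ 2 <= 1]. *)
Lemma dyadic_scale {R : realType} (r : R) : 0 < r <= 1 ->
  exists a, 2 ^+ a * r ^+ 2 <= 1 /\ 1 <= 2 * (2 ^+ a * r ^+ 2).
Proof.
move=> /andP[r0 r1]; have r2 : 0 < r ^+ 2 by rewrite exprn_gt0.
pose Q n := 1 < 2 ^+ n * r ^+ 2.
have ex : exists n, Q n.
  have [N h] := @geometric_small R 1 _ r2; exists N.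
  have p : 0 < 2 ^+ N :> R by rewrite exprn_gt0.
  by have := h N (leqnn N); rewrite (ltr_pdivrMr _ _ p) /Q mulrC.
have := ex_minnP ex; case=> -[|a] Qa min.
  by move: Qa; rewrite /Q expr0 mul1r ltNge exprn_ile1 // ltW.
exists a; split; last by rewrite mulrA -exprS; exact: ltW.
rewrite leNgt; apply/negP => h; have := min a h.
by rewrite ltnn.
Qed.

Lemma cube_root_le1 {R : realType} (eps : R) : 0 < eps ->
  let r := eps `^ (3^-1) in [/\ 0 < r, r ^+ 3 = eps, eps <= 1 -> r <= 1 & 1 < eps -> 1 <= r].
Proof.
move=> e0 r; have r0 : 0 < r by exact: powR_gt0.
have r3 : r ^+ 3 = eps.
  by rewrite /r -powR_mulrn ?ltW // -powRrM mulVf // powRr1 // ltW.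
split => //.
- move=> e1; rewrite leNgt; apply/negP => r1; move: e1; rewrite -r3 leNgt.
  by rewrite exprn_egt1.
- move=> e1; rewrite leNgt; apply/negP => r1; move: e1; rewrite -r3 ltNge.
  by rewrite exprn_ile1 // ltW.
Qed.

(** The Cauchy-Schwarz bound of a mean of absolute values, in the form
    [2 * `|x| <= x ^+ 2 / r + r]. *)
Lemma mean_norm_le {R : realType} n (D : nat -> R) (N r V : R) : 0 < N -> 0 < r ->
  N = n%:R -> (\sum_(j < n) D j ^+ 2) / N <= V * r ^+ 2 ->
  (\sum_(j < n) `|D j|) / N <= r * (V + 1).
Proof.
move=> N0 r0 Nn H.
have ri : 0 < r^-1 by rewrite invr_gt0.
have h : \sum_(j < n) `|D j| <= \sum_(j < n) (r^-1 * D j ^+ 2 + r).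
  apply: ler_sum => j _; rewrite -[D j ^+ 2]real_normK ?num_real //.
  set x := `|D j|; have x0 : 0 <= x by exact: normr_ge0.
  have : 0 <= r^-1 * (x - r) ^+ 2 by rewrite mulr_ge0 ?sqr_ge0 // ltW.
  have -> : r^-1 * (x - r) ^+ 2 = r^-1 * x ^+ 2 - 2 * x + r by field; rewrite gt_eqF.
  lra.
rewrite big_split /= -mulr_sumr sumr_const card_ord -[r *+ n]mulr_natr -Nn in h.
have h1 := ler_wpM2l (ltW ri) H.
have h2 : r^-1 * (V * r ^+ 2) = r * V by field; rewrite gt_eqF.
rewrite h2 in h1; rewrite ler_pdivrMr //; apply: (le_trans h).
have -> : r * (V + 1) * N = r * V * N + r * N by ring.
rewrite lerD2r -ler_pdivrMr // -mulrA; exact: h1.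
Qed.

Lemma bounded_in_probability_eps {d} {Omega : measurableType d} {R : realType}
    (P : probability Omega R) (I : Type) (A : set I) (xi : I -> Omega -> R) :
  A !=set0 -> (forall a, A a -> measurable_fun setT (xi a)) ->
  (forall e, 0 < e -> exists c0, forall c a, c0 <= c -> A a ->
     pr P [set w | c <= `|xi a w|] <= e) ->
  bounded_in_probability P A xi.
Proof.
move=> [a0 Aa0] mxi H; rewrite /bounded_in_probability.
have prP c a : A a -> P [set w | c <= `|xi a w|] = (pr P [set w | c <= `|xi a w|])%:E.
  by move=> Aa; rewrite prE //; exact: measurable_ge_norm (mxi a Aa).
set f := fun c : R => ereal_sup _.
have f0 c : (0 <= f c)%E.
  apply: (@le_trans _ _ (P [set w | c <= `|xi a0 w|])); first exact: measure_ge0.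
  by apply: ereal_sup_ubound; exists a0.
have fe e : 0 < e -> \forall c \near +oo, (f c <= e%:E)%E.
  move=> e0; have [c0 h] := H e e0; near=> c.
  apply: ub_ereal_sup => _ [a Aa <-]; rewrite prP // lee_fin; apply: h; last exact: Aa.
  by near: c; apply: nbhs_pinfty_ge; exact: num_real.
have ff : \forall c \near +oo, f c \is a fin_num.
  near=> c; rewrite ge0_fin_numE //; apply: le_lt_trans (_ : 1%:E < _)%E; last exact: ltry.
  by near: c; exact: fe.
apply/fine_cvgP; split => //.
apply/cvgrPdist_le => e e0; near=> c.
have fc : f c \is a fin_num by near: c.
rewrite /= sub0r normrN ger0_norm; last by rewrite fine_ge0.
by rewrite -lee_fin fineK //; near: c; exact: fe.
Unshelve. all: by end_near. Qed.

Section averaging_principle.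
Context {R : realType} {d : measure_display} {Omega : measurableType d}.
Variable P : probability Omega R.
Variable T : R.
Hypothesis T_gt0 : 0 < T.
Variable mu : set R -> {RV P >-> R}.
Hypothesis mu_sm : stochastic_measure `[0, T] mu.
Variable mut : R -> {RV P >-> R}.
Hypothesis mu_cont : continuous_version T mu mut.
Variable X0 : {RV P >-> R}.
Variable D : R -> Omega -> R.
Hypothesis D_measurable : forall eps, 0 < eps -> measurable_fun setT (D eps).
(* The conclusion of [pathwise_averaging], for the distance of the solutions. *)
Hypothesis D_le : forall k, 0 < k -> exists2 C, 0 < C & forall w eps, 0 < eps ->
  `|X0 w| <= k -> (forall t, 0 <= t <= T -> `|mut t w| <= k) ->
  [/\ 0 <= D eps w, D eps w <= C & forall a,
    D eps w <= C * (oscillation T (mut ^~ w) a + 1 / 2 ^+ a + 2 ^+ a * eps)].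

(** First [a] is chosen large, which makes [oscillation a] small by the uniform continuity of
    the path, and then [eps] small. *)
Lemma pathwise_convergence w : D eps w @[eps --> 0^'+] --> 0.
Proof.
have mc := mu_cont.1 w.
have [K K0 HK] := bounded_itv (ltW T_gt0) mc.
have x0 := normr_ge0 (X0 w).
have kpos : 0 < K + `|X0 w| by rewrite ltr_pwDl.
have [C C0 HC] := D_le kpos.
have mk t : 0 <= t <= T -> `|mut t w| <= K + `|X0 w| by move=> /HK; lra.
have xk : `|X0 w| <= K + `|X0 w| by lra.
apply/cvgrPdist_le => e e0.
have e3 : 0 < e / (3 * C) by rewrite divr_gt0 // mulr_gt0.
have e3T : 0 < e / (3 * C) / T by rewrite divr_gt0.
have [i hi] := dyadic_oscillation T_gt0 mc e3T.
have [N hN] := @geometric_small R 1 _ e3.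
pose a := maxn i N.
have osc : oscillation T (mut ^~ w) a <= e / (3 * C).
  have := @oscillation_le R T T_gt0 (mut ^~ w) mc a 0 _ (ltW e3T).
  rewrite addn0 => /(_ (hi a (leq_maxl _ _))); rewrite big1; last first.
    by move=> j _; rewrite expn0 divn1 subrr normr0.
  by rewrite mul0r add0r mulrC divfK // gt_eqF.
have ia := ltW (hN a (leq_maxr _ _)).
have p2 : 0 < 2 ^+ a :> R by rewrite exprn_gt0.
near=> eps.
have ep : 0 < eps by near: eps; exact: nbhs_right_gt.
have es : 2 ^+ a * eps <= e / (3 * C).
  rewrite mulrC -ler_pdivlMr //; near: eps; apply: nbhs_right_le.
  by rewrite divr_gt0.
have [D0 _ /(_ a) Da] := HC w eps ep xk mk.
rewrite sub0r normrN ger0_norm //; apply: (le_trans Da).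
have : C * (oscillation T (mut ^~ w) a + 1 / 2 ^+ a + 2 ^+ a * eps) <=
   C * (e / (3 * C) + e / (3 * C) + e / (3 * C)).
  by rewrite ler_wpM2l ?(ltW C0) // !lerD.
have -> : C * (e / (3 * C) + e / (3 * C) + e / (3 * C)) = e by field; rewrite gt_eqF.
by [].
Unshelve. all: by end_near. Qed.

Variable m : {finite_measure set (measurableTypeR R) -> \bar R}.
Hypothesis L2_integrable : forall h : R -> R, measurable_fun `[0, T] h ->
  (\int[m]_(x in `[0%R, T]) ((h x) ^+ 2)%:E < +oo)%E -> sm_integrable `[0, T] mu h.

(** The grid of level [a] is chosen with [2 ^+ a] close to [eps `^ (- 2 / 3)],
    which balances the mean oscillation, of order [2 ^ (- a / 2)], against the
    accumulated averaging errors, of order [2 ^ a * eps]. For [eps > 1] the distance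
    is simply bounded. *)
Lemma cube_root_rate :
  bounded_in_probability P [set eps | 0 < eps] (fun eps w => D eps w / eps `^ (3^-1)).
Proof.
apply: bounded_in_probability_eps; first by exists 1 => /=; rewrite ltr01.
  by move=> eps e0; apply: measurable_funM => //; exact: D_measurable.
move=> e e0.
have e2 : 0 < e / 2 by rewrite divr_gt0.
have e48 : 0 < e / 2 / 24 by rewrite divr_gt0.
have [k k0 [A Ae Ak]] := paths_bounded T_gt0 X0 mu_cont.1 e2.
have [C C0 HC] := D_le k0.
have [lambda l0 bd] := L2_step_bounded T_gt0 mu_sm mu_cont L2_integrable e48.
pose M := mass m.
pose S := 48 * (M T - M 0 + 1) * lambda ^+ 2.
have M0 : 0 <= M T - M 0.
  have E : pt T 0 1 = T by rewrite -[1%N]/(2 ^ 0)%N pt_end.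
  by have := mass_incr T_gt0 m 0 0; rewrite pt0 E subr_ge0.
have S0 : 0 <= S by rewrite !mulr_ge0 // ?sqr_ge0 //; lra.
pose Bl a l := [set w | S <
  (\sum_(j < 2 ^ (a + l)) coarse_diff T (fun t => mut t) a l j w ^+ 2) / 2 ^+ l].
have mBl a l : measurable (Bl a l).
  pose f w := (\sum_(j < 2 ^ (a + l)) coarse_diff T (fun t => mut t) a l j w ^+ 2) / 2 ^+ l.
  rewrite (_ : Bl a l = f @^-1` `]S, +oo[); last first.
    by apply/seteqP; split => w /=; rewrite in_itv /= andbT.
  rewrite -[X in measurable X]setTI.
  have mf : measurable_fun setT f.
    apply: measurable_funM => //; apply: measurable_sum => j.
    by apply: measurable_funX; apply: measurable_funB.
  exact: mf.
have prBl a l : pr P (Bl a l) <= e / 2.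
  have := coarse_square_bounded T_gt0 (mt := fun t => mut t) (fun t => measurable_funPT (mut t))
    (mass_incr T_gt0 m) l0 bd a l.
  by move=> h; apply: (le_trans h); lra.
(* Outside [Ba a] the square sums are bounded for arbitrarily fine grids,
   among which one resolves the oscillation of the given path. *)
pose Ba a := [set w | exists N, forall l, (N <= l)%N -> Bl a l w].
have prBa a : pr P (Ba a) <= e / 2.
  by apply: (@pr_liminf _ _ _ P (Bl a)).
pose c0 := C * (T * (2 * S + 3) + 3) + 1.
have TS : 0 <= T * (2 * S + 3) by rewrite mulr_ge0 ?(ltW T_gt0) //; lra.
exists c0 => c eps cc0 /= ep.
have [r0 r3 rle1 rge1] := cube_root_le1 ep; set r := eps `^ (3^-1) in r0 r3 rle1 rge1 *.
have good w : ~ A w -> D eps w < c0 * r -> ~ (c <= `|D eps w / r|).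
  move=> nA Dr; have [xk mk] := Ak w nA; have [D0 _ _] := HC w eps ep xk mk.
  rewrite ger0_norm; last by rewrite divr_ge0 // ltW.
  by rewrite ler_pdivlMr // => h; have := ler_wpM2r (ltW r0) cc0; lra.
have [e1|e1] := leP eps 1; last first.
  apply: (@le_trans _ _ (pr P A)); last by lra.
  apply: pr_le => w /= cw; apply: contrapT => nA.
  have [xk mk] := Ak w nA; have [_ DC _] := HC w eps ep xk mk.
  have Dr : D eps w < c0 * r.
    apply: (le_lt_trans DC); apply: (@lt_le_trans _ _ c0).
      by have := mulr_ge0 (ltW C0) TS; rewrite /c0 mulrDr; lra.
    rewrite -[leLHS]mulr1 ler_wpM2l ?rge1 //.
    by have := mulr_ge0 (ltW C0) TS; rewrite /c0 mulrDr; lra.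
  exact: good nA Dr cw.
have r1 := rle1 e1.
have r01 : 0 < r <= 1 by rewrite r0.
have [a [a1 a2]] := dyadic_scale r01.
have p2 : 0 < 2 ^+ a :> R by rewrite exprn_gt0.
have rr : r ^+ 2 <= r by rewrite expr2 ler_piMr // ltW.
have ia : 1 / 2 ^+ a <= 2 * r ^+ 2 by rewrite ler_pdivrMr //; lra.
have ae : 2 ^+ a * eps <= r.
  by rewrite -r3 exprS mulrCA ler_piMr // ltW.
apply: (@le_trans _ _ (e / 2 + e / 2)); last by rewrite -splitr.
apply: pr_le_add Ae (prBa a) => w /= cw; have [wA|nA] := pselect (A w); [by left|right].
apply: contrapT => nB.
have [xk mk] := Ak w nA; have [_ _ /(_ a) Da] := HC w eps ep xk mk.
have i0 : 0 < 1 / 2 ^+ a :> R by rewrite divr_gt0.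
have [N HN] := dyadic_oscillation T_gt0 (mu_cont.1 w) i0.
have [l [Nl nBl]] : exists l, (N <= l)%N /\ ~ Bl a l w.
  apply: contrapT => nE; apply: nB; exists N => l Nl.
  by apply: contrapT => nBl; apply: nE; exists l.
have osc := @oscillation_le R T T_gt0 (mut ^~ w) (mu_cont.1 w) a l _ (ltW i0)
  (HN _ (leq_trans Nl (leq_addl a l))).
have pl : 0 < 2 ^+ (a + l) :> R by rewrite exprn_gt0.
have mean : (\sum_(j < 2 ^ (a + l)) `|mut (pt T (a + l) j) w - mut (pt T a (j %/ 2 ^ l)) w|)
    / 2 ^+ (a + l) <= r * (2 * S + 1).
  apply: (@mean_norm_le R (2 ^ (a + l))
    (fun j => mut (pt T (a + l) j) w - mut (pt T a (j %/ 2 ^ l)) w)) => //.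
    by rewrite natrX.
  move: nBl; rewrite /Bl /= => /negP; rewrite -leNgt => nBl.
  rewrite exprD invfM [X in _ * X]mulrC mulrA.
  apply: (@le_trans _ _ (S * (1 / 2 ^+ a))).
    by rewrite div1r ler_wpM2r // invr_ge0 ltW.
  by have := ler_wpM2l S0 ia; rewrite [S * (2 * _)]mulrCA [2 * (S * _)]mulrA.
have Dr : D eps w < c0 * r.
  have o2 : oscillation T (mut ^~ w) a <= T * (r * (2 * S + 3)).
    apply: (le_trans osc); rewrite ler_wpM2l ?(ltW T_gt0) //.
    by move: mean ia; rewrite !mulrDr mulr1; lra.
  have tot : oscillation T (mut ^~ w) a + 1 / 2 ^+ a + 2 ^+ a * eps <=
     (T * (2 * S + 3) + 3) * r.
    have -> : (T * (2 * S + 3) + 3) * r = T * (r * (2 * S + 3)) + 3 * r by ring.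
    lra.
  apply: (le_lt_trans Da); apply: (le_lt_trans (ler_wpM2l (ltW C0) tot)).
  by rewrite mulrA /c0 [ltRHS]mulrDl mul1r ltrDl.
exact: good nA Dr cw.
Qed.

End averaging_principle.

Theorem theorem3p1 (R : realType) (d : measure_display)
  (Omega : measurableType d) (P : probability Omega R)
  (P_complete : measure_is_complete P)
  (T : R) (T_gt0 : 0 < T)
  (mu : set R -> {RV P >-> R})
  (mu_sm : stochastic_measure `[0, T] mu)
  (mut : R -> {RV P >-> R}) (mu_cont : continuous_version T mu mut)
  (X0 : {RV P >-> R})
  (sigma : R -> R) (b : R -> R -> R) (bbar : R -> R)
  (sigma_C2 : class_C 2 sigma)
  (sigma'_bounded : exists K, forall x, `|derive1 sigma x| <= K)
  (sigma''_bounded : exists K, forall x, `|derive1n 2 sigma x| <= K)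
  (b_cont : continuous (fun p : R * R => b p.1 p.2))
  (b_bounded : exists K, forall x t, `|b x t| <= K)
  (b_loclip : forall c, 0 < c -> exists L, forall x y t,
     `|x| <= c -> `|y| <= c -> `|b x t - b y t| <= L * `|x - y|)
  (bbar_lim : forall y,
     t^-1 * (\int[lebesgue_measure]_(s in `[0, t]) b y s) @[t --> +oo]
       --> bbar y)
  (G_bounded : exists K, forall y r, 0 <= r ->
     `|\int[lebesgue_measure]_(s in `[0, r]) (b y s - bbar y)| <= K)
  (F H : R -> R -> R)
  (F_flow : is_flow sigma F) (H_inv : is_flow_inverse F H)
  (X : R -> R -> {RV P >-> R}) (Xbar : R -> {RV P >-> R})
  (X_sol : forall eps, 0 < eps ->
     is_solution T mut sigma (fun x t => b x (t / eps)) X0 (X eps) /\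
     is_doss_sussmann T mut (fun x t => b x (t / eps)) F H X0 (X eps))
  (Xbar_sol :
     is_solution T mut sigma (fun x _ => bbar x) X0 Xbar /\
     is_doss_sussmann T mut (fun x _ => bbar x) F H X0 Xbar) :
  (forall w, sup_distance T (X eps) Xbar w @[eps --> 0^'+] --> 0) /\
  ((exists m : {finite_measure set (measurableTypeR R) -> \bar R},
      forall h : R -> R, measurable_fun `[0, T] h ->
        (\int[m]_(x in `[0%R, T]) ((h x) ^+ 2)%:E < +oo)%E ->
        sm_integrable `[0, T] mu h) ->
   bounded_in_probability P [set eps | 0 < eps]
     (fun eps w => sup_distance T (X eps) Xbar w / eps `^ (3^-1))).
Proof.
have [K1 sigma1_le] := sigma'_bounded; have [K2 sigma2_le] := sigma''_bounded.
have [B b_le] := b_bounded; have [KG G_le] := G_bounded.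
have [_ [Z [Zc Z_eq Z_F]]] := Xbar_sol.
have flow_path (m y x : R -> R) : {within `[0, T], continuous m} ->
    {within `[0, T], continuous y} -> (forall t, t \in `[0, T] -> x t = F (m t) (y t)) ->
    {within `[0, T], continuous x}.
  move=> mc yc xF.
  have Fc := flow_path_continuous T_gt0 sigma_C2 sigma1_le sigma2_le F_flow H_inv mc yc.
  apply: dist_within_continuous => t tT e e0.
  have [dl dl0 h] := within_continuous_dist Fc tT e0; exists dl => // s sT st.
  by rewrite !xF ?in_itv //; exact: h.
have Xbar_cont : continuous_paths T Xbar.
  by move=> w; apply: flow_path (mu_cont.1 w) (Zc w) _ => t; exact: Z_F.
have X_cont eps : 0 < eps -> continuous_paths T (X eps).
  move=> e0; have [_ [Y [Yc _ Y_F]]] := X_sol _ e0.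
  by move=> w; apply: flow_path (mu_cont.1 w) (Yc w) _ => t; exact: Y_F.
have D_measurable eps : 0 < eps -> measurable_fun setT (sup_distance T (X eps) Xbar).
  by move=> e0; apply: measurable_sup_distance => //; exact: X_cont.
have D_le k : 0 < k -> exists2 C, 0 < C & forall w eps, 0 < eps ->
    `|X0 w| <= k -> (forall t, 0 <= t <= T -> `|mut t w| <= k) ->
    [/\ 0 <= sup_distance T (X eps) Xbar w, sup_distance T (X eps) Xbar w <= C &
      forall a, sup_distance T (X eps) Xbar w <=
        C * (oscillation T (mut ^~ w) a + 1 / 2 ^+ a + 2 ^+ a * eps)].
  move=> k0; have [C C0 HC] := pathwise_averaging T_gt0 sigma_C2 sigma1_le sigma2_le
    F_flow H_inv b_cont b_le b_loclip G_le k0.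
  exists C => // w eps e0 xk mk; have [_ [Y [Yc Y_eq Y_F]]] := X_sol _ e0.
  have Y_eq' t : 0 <= t <= T -> Y t w = H 0 (X0 w) + \int[lebesgue_measure]_(s in `[0, t])
      field F H b (mut s w) (Y s w) (s / eps).
    by move=> tT; rewrite Y_eq ?in_itv.
  have Z_eq' t : 0 <= t <= T -> Z t w = H 0 (X0 w) + \int[lebesgue_measure]_(s in `[0, t])
      averaged_field F H bbar (mut s w) (Z s w).
    by move=> tT; rewrite Z_eq ?in_itv.
  have est := HC _ _ _ _ _ e0 (mu_cont.1 w) (Yc w) (Zc w) mk xk Y_eq' Z_eq'.
  have sd c : (forall t, 0 <= t <= T -> `|F (mut t w) (Y t w) - F (mut t w) (Z t w)| <= c) ->
      0 <= sup_distance T (X eps) Xbar w <= c.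
    move=> h; apply: sup_distance_le => //; first exact: X_cont.
    by move=> t tT; rewrite Y_F ?in_itv // Z_F ?in_itv //; exact: h.
  have /andP[s0 sC] := sd C (fun t tT => (est t tT).1).
  by split => // a; have /andP[_ ->] := sd _ (fun t tT => (est t tT).2 a).
split; first exact: (pathwise_convergence T_gt0 mu_cont D_le).
by move=> [m L2]; exact: (cube_root_rate T_gt0 mu_sm mu_cont D_measurable D_le L2).
Qed.
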